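(* Fix a prime power $q$. For each $n\ge 1$ let $A_n$ be a uniformly random element of the finite set $$\mathfrak g(n,q)=\{A=(a_{i,j})_{1\le i,j\le n}\in \mathrm{Mat}_n(\mathbb F_q): a_{i,j}=0\text{ for all } i\ge j\}$$ of strictly upper-triangular matrices over $\mathbb F_q$. Then for every integer $k\ge 1$, $$\lim_{n\to\infty} D_\infty\Big(\big(\mathrm{rank}(A_n^{i-1})-\mathrm{rank}(A_n^i)-\lfloor \log_q n\rfloor\big)_{1\le i\le k},\ \big(\mathcal L^{(i)}_{q^{-1},\,q^{\{\log_q n\}}}\big)_{1\le i\le k}\Big)=0,$$ where $\mathcal L_{t,\chi}=(\mathcal L^{(i)}_{t,\chi})_{i\ge1}$ is the family of random integer sequences defined in the context, and $D_\infty$ is taken on the countable set $\mathrm{Sig}_k$.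
   Context: Notation. $\{x\}=x-\lfloor x\rfloor$ is the fractional part; $A^0$ is the identity matrix. $(a;t)_m=\prod_{i=0}^{m-1}(1-at^i)$ for $m\in\mathbb Z_{\ge0}\cup\{\infty\}$, and $\begin{bmatrix}a\\ b\end{bmatrix}_t=\frac{(t;t)_a}{(t;t)_b(t;t)_{a-b}}$ for integers $0\le b\le a$. Signatures. $\mathrm{Sig}_k=\{(L_1,\dots,L_k)\in\mathbb Z^k: L_1\ge\dots\ge L_k\}$ ($\mathrm{Sig}_0$ consists of the empty signature). For $\mu\in\mathrm{Sig}_{k-1}$, $L\in\mathrm{Sig}_k$, write $\mu\prec L$ if $L_1\ge\mu_1\ge L_2\ge\dots\ge\mu_{k-1}\ge L_k$. $|\mu|=\sum_i\mu_i$, and $\mu-(d[k-1])=(\mu_1-d,\dots,\mu_{k-1}-d)$. For a partition $\lambda$ (eventually zero weakly decreasing sequence of nonnegative integers), $\lambda'$ is the conjugate partition, $\lambda'_i=\#\{j:\lambda_j\ge i\}$, and $m_i(\lambda)=\#\{j:\lambda_j=i\}$. Distance. For two $S$-valued random variables $X_1,X_2$ ($S$ countable and discrete) with laws $M_1,M_2$, $D_\infty(X_1,X_2)=\sup_{x\in S}|M_1(\{x\})-M_2(\{x\})|$. Hall-Littlewood functions. Let $\Lambda=\mathbb C[p_1,p_2,\dots]$ be the ring of symmetric functions ($p_i$ the power sums). For a partition $\lambda$, $P_\lambda(\,\cdot\,;0,t)\in\Lambda$ is the Hall-Littlewood symmetric function, whose restriction to $n\geq \#\{i:\lambda_i>0\}$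 variables is $$P_\lambda(x_1,\dots,x_n;0,t)=\frac1{v_\lambda(t)}\sum_{w\in S_n} w\Big(x_1^{\lambda_1}\cdots x_n^{\lambda_n}\prod_{i<j}\frac{x_i-tx_j}{x_i-x_j}\Big),\quad v_\lambda(t)=\prod_{i\ge0}\frac{(t;t)_{m_i(\lambda)}}{(1-t)^{m_i(\lambda)}},$$ where here $m_0(\lambda)$ is the number of zeros among $\lambda_1,\dots,\lambda_n$; and $Q_\lambda(\,\cdot\,;0,t)=\prod_{i\ge1}(t;t)_{m_i(\lambda)}\,P_\lambda(\,\cdot\,;0,t)$. For $\tau\in\mathbb R_{\ge0}$, $Q_\lambda(\gamma(\tau),\alpha(1);0,t)$ denotes the image of $Q_\lambda(\,\cdot\,;0,t)$ under the algebra homomorphism $\Lambda\to\mathbb C$ with $p_1\mapsto 1+\frac{\tau}{1-t}$ and $p_r\mapsto1$ for $r\ge2$. The limit object. For $t\in(0,1)$ and $\chi>0$, $\mathcal L_{t,\chi}=(\mathcal L_{t,\chi}^{(i)})_{i\ge1}$ is the random weakly decreasing integer sequence whose finite-dimensional marginals $\mathcal L_{k,t,\chi}=(\mathcal L^{(i)}_{t,\chi})_{1\le i\le k}$ are given, for $L=(L_1,\dots,L_k)\in\mathrm{Sig}_k$, by $$\Pr(\mathcal L_{k,t,\chi}=L)=\frac1{(t;t)_\infty}\sum_{d\in\mathbb Z,\,d\le L_k}e^{-\chi t^d}\frac{t^{\sum_{i=1}^k\binom{L_i-d}2}}{(t;t)_{L_k-d}\prod_{i=1}^{k-1}(t;t)_{L_i-L_{i+1}}}\sum_{\mu\in\mathrm{Sig}_{k-1},\,\mu\prec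 L}(-1)^{|L|-|\mu|-d}\prod_{i=1}^{k-1}\begin{bmatrix}L_i-L_{i+1}\\ L_i-\mu_i\end{bmatrix}_t\,Q_{(\mu-(d[k-1]))'}\big(\gamma((1-t)t^d\chi),\alpha(1);0,t\big).$$ (It is known that these formulas define probability measures on $\mathrm{Sig}_k$, consistent in $k$.) *)

(* Defs.v *)
From HB Require Import structures.
From mathcomp Require Import all_boot all_order all_fingroup all_algebra.
From mathcomp Require Import fraction.
From mathcomp Require Import boolp classical_sets.
From mathcomp Require finmap mpoly monalg.

Set Implicit Arguments.
Unset Strict Implicit.
Unset Printing Implicit Defensive.

Import Order.TTheory GRing.Theory Num.Theory.

Local Open Scope ring_scope.

(* A partition is a [seq nat], weakly decreasing and possibly with trailing
   zeros; the part of index i >= 1 is [nth 0 lam i.-1]. *)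

Definition partmult (i : nat) (lam : seq nat) : nat := count_mem i lam.

Definition plength (lam : seq nat) : nat := count (leq 1) lam.

Definition conjpart (lam : seq nat) : seq nat :=
  mkseq (fun i => count (leq i.+1) lam) (\max_(a <- lam) a).

Definition qpoch (K : pzRingType) (a t : K) (m : nat) : K :=
  \prod_(i < m) (1 - a * t ^+ i).

Definition qbinom (K : fieldType) (a b : nat) (t : K) : K :=
  qpoch t t a / (qpoch t t b * qpoch t t (a - b)).

(* [mpoly] and the topological notations loaded below cannot be imported
   together, hence the local imports in this module. *)
Module HallLittlewood.

Import finmap monalg mpoly.

Section HallLittlewood.
Variable K : fieldType.

(* C[p_1, p_2, ...], over an arbitrary field K of coefficients: the polynomial
   ring on the variables indexed by nat, the variable r being p_(r+1). *)
Local Notation symfun := {malg K[{cmonom nat}]}.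

Definition cmonom_eval (S : comNzRingType) (v : nat -> S)
    (m : {cmonom nat}) : S :=
  \prod_(r <- finsupp m) v r ^+ m r.

(* The algebra homomorphism to K sending p_(r+1) to [v r]. *)
Definition specialize (v : nat -> K) (f : symfun) : K :=
  monalg.mmap (idfun : K -> K) (cmonom_eval v) f.

Definition psum (n r : nat) : mpoly n K := \sum_(i < n) 'X_i ^+ r.

Definition restrict (n : nat) (f : symfun) : mpoly n K :=
  monalg.mmap (@mpolyC n K) (cmonom_eval (fun r => psum n r.+1)) f.

Section Polynomials.
Variables (n : nat) (t : K).

(* The n parts of lam (zeros included) that matter in n variables. *)
Definition parts (lam : seq nat) : seq nat := mkseq (nth 0%N lam) n.

Definition HLv (lam : seq nat) : K :=
  \prod_(i < (\max_(a <- parts lam) a).+1)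
     (qpoch t t (partmult i (parts lam)) / (1 - t) ^+ partmult i (parts lam)).

Definition HLx (i : 'I_n) : {fraction mpoly n K} := tofrac 'X_i.

Definition HLcst (c : K) : {fraction mpoly n K} := tofrac c%:MP_[n].

Definition HLpoly (lam : seq nat) : {fraction mpoly n K} :=
  HLcst (HLv lam)^-1 *
  \sum_(w : 'S_n)
     (\prod_(i < n) HLx (w i) ^+ nth 0%N lam i) *
     (\prod_(i < n) \prod_(j < n | (i < j)%N)
        ((HLx (w i) - HLcst t * HLx (w j)) / (HLx (w i) - HLx (w j)))).

End Polynomials.

Definition isHLP (t : K) (lam : seq nat) (f : symfun) : Prop :=
  forall n : nat, (plength lam <= n)%N ->
    tofrac (restrict n f) = HLpoly n t lam.

(* When K has characteristic 0, t is not a root of unity and lam is a partition,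
   exactly one symmetric function has the prescribed restrictions, and the
   default value plays no role. *)
Definition HLP (t : K) (lam : seq nat) : symfun := xget 0 (isHLP t lam).

Definition HLQ (t : K) (lam : seq nat) : symfun :=
  (\prod_(1 <= i < (\max_(a <- lam) a).+1) qpoch t t (partmult i lam)) *:
    HLP t lam.

Definition HLQ_gamma_alpha (t tau : K) (lam : seq nat) : K :=
  specialize (fun r => if r == 0%N then 1 + tau / (1 - t) else 1) (HLQ t lam).

End HallLittlewood.
End HallLittlewood.

From mathcomp Require Import all_classical all_reals all_analysis.
Import numFieldNormedType.Exports.

Local Open Scope classical_set_scope.
Local Open Scope ring_scope.

Definition signature (k : nat) : set {ffun 'I_k -> int} :=
  [set L | forall i j : 'I_k, (i <= j)%N -> L j <= L i].
Arguments signature k : clear implicits.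

Definition wt (k : nat) (L : {ffun 'I_k -> int}) : int := \sum_(i < k) L i.

(* For i : 'I_k, the entries of index i and i+1 of a vector of length k+1. *)
Definition cur (k : nat) (L : {ffun 'I_k.+1 -> int}) (i : 'I_k) : int :=
  L (widen_ord (leqnSn k) i).

Definition nxt (k : nat) (L : {ffun 'I_k.+1 -> int}) (i : 'I_k) : int :=
  L (lift ord0 i).

Definition interlaces (k : nat) (mu : {ffun 'I_k -> int})
    (L : {ffun 'I_k.+1 -> int}) : Prop :=
  forall i : 'I_k, nxt L i <= mu i <= cur L i.

(* [`|z|%N] is used below only for integers z >= 0. *)
Definition shiftpart (k : nat) (mu : {ffun 'I_k -> int}) (d : int) : seq nat :=
  [seq `|mu i - d|%N | i <- enum 'I_k].

Section LimitLaw.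
Variables (R : realType) (t chi : R) (k : nat) (L : {ffun 'I_k.+1 -> int}).

Definition Lterm (d : int) : R :=
  expR (- (chi * t ^ d)) *
  (t ^+ (\sum_(i < k.+1) 'C(`|L i - d|%N, 2)) /
   (qpoch t t `|L ord_max - d|%N *
    \prod_(i < k) qpoch t t `|cur L i - nxt L i|%N)) *
  (\sum_(mu \in [set mu | signature k mu /\ interlaces mu L])
     ((-1) ^ (wt L - wt mu - d) *
      (\prod_(i < k) qbinom `|cur L i - nxt L i|%N `|cur L i - mu i|%N t) *
      HallLittlewood.HLQ_gamma_alpha t ((1 - t) * t ^ d * chi)
        (conjpart (shiftpart mu d)))).

(* The probability that the first k+1 entries of the limit sequence are L; the
   sum over the integers d <= L_(k+1) converges absolutely and is indexed by
   m = L_(k+1) - d. *)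
Definition Llaw : R :=
  (limn (qpoch t t))^-1 *
  limn (series (fun m : nat => Lterm (L ord_max - m%:Z))).

End LimitLaw.
Arguments Llaw {R} t chi {k} L.

(* Valued in the extended reals, so that no boundedness is presupposed. *)
Definition Dinfty (R : realType) (T : Type) (S : set T) (M1 M2 : T -> R) :
    \bar R :=
  ereal_sup [set (`|M1 x - M2 x|)%:E | x in S].

Definition strict_upper (F : finFieldType) (n : nat) : {set 'M[F]_n} :=
  [set A : 'M[F]_n | [forall i : 'I_n, forall j : 'I_n,
                        (j <= i)%N ==> (A i j == 0)]]%SET.

Definition unif_law (R : realType) (U : finType) (G : {set U}) (T : eqType)
    (X : U -> T) (x : T) : R :=
  #|[set A in G | X A == x]%SET|%:R / #|G|%:R.

Definition log_base (R : realType) (q n : nat) : R := ln n%:R / ln q%:R.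

Definition frac_part (R : realType) (x : R) : R := x - (Num.floor x)%:~R.

(* The i-th entry, i = 0, ..., k-1, is rank(A^i) - rank(A^(i+1)) - c. *)
Definition rank_drops (F : fieldType) (n k : nat) (c : int) (A : 'M[F]_n) :
    {ffun 'I_k -> int} :=
  [ffun i : 'I_k => (\rank (A ^+ i))%:Z - (\rank (A ^+ i.+1))%:Z - c].

(* Main.v *)
Require Import Defs.
From HB Require Import structures.
From mathcomp Require Import all_boot all_order all_fingroup all_algebra.
From mathcomp Require Import fraction polyXY mxabelem.
From mathcomp Require Import boolp classical_sets.
From mathcomp Require Import ring lra zify.
From mathcomp Require finmap mpoly monalg.

(** Write t = 1/q, let eta(A) be the vector of the rank drops
    rank(A^i) - rank(A^(i+1)), 0 <= i <= k, and p_n the law of eta for a uniform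
    strictly upper triangular matrix of size n.

    The chain. Deleting the first row and column of a uniform matrix of size n+1
    leaves a uniform matrix A of size n and an independent uniform row r.  Adding
    the row raises exactly one rank drop, the first i such that r A^i lies in the
    row space of A^(i+1), or none; for given A this event has probability
    t^(eta_i), and it grows with i.  So eta is a Markov chain [sum_add_row], and
    p_(n+1) = P p_n for the explicit operator [transfer] on functions on Z^(k+1).

    The exact solution. The limit formula is made of the same operator.  The
    derivative of Q_lambda(gamma(tau), alpha(1)) in tau is a combination of the
    functions of the same kind with one box removed, so that its Taylor
    coefficients in tau satisfy a recursion [gcoef, HLQ_gamma_alpha_expansion].
    Summing them over interlacing vectors against the product of q-factorials
    [weight] gives functions wsum_m with P wsum_m = wsum_(m+1) [wsumS], by a
    telescoping identity, and wsum_0 = pi - pi(. - 1) [wsum0], where pi is a signed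
    measure carried by the vectors (e, 0, ..., 0).  A diagonal shift by d commutes
    with P up to an affine map with slope t^d [transfer_shift], so that telescoping
    over d gives [iter_transfer_start]: P^n pi is the sum over d and m of
    wsum_m(. - d) times the binomial probability of m successes among n trials
    with success probability t^d.  At n = chi q^s, around the vectors L + s, the
    binomial laws become Poisson laws with mean chi t^d, and summing the Taylor
    series back [Lterm_expansion] yields the terms of the limit law
    [iter_start_close].

    Comparison of P^n pi with p_n. P^n applied to the point mass at (e, 0, ..., 0)
    is the law of eta for the block matrix (A V; 0 0) with V uniform of size n x e.
    The border V leaves eta unchanged unless some nonzero combination of its
    columns is absorbed, hence changes p_n by at most q^e E[t^(eta_k)]
    [expect_ext_close], and the Lyapunov function t^(eta_0) + ... + t^(eta_k) shows
    that E[t^(eta_k)] = O(1/n) [expect_last].  As pi has total mass (t; t)_oo by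
    Euler's identity [euler_sum], p_n and P^n pi / (t; t)_oo differ by O(1/n).

    Uniformity. This gives convergence for each fixed L, uniformly in chi in
    [1, q] [law_close].  The moments E[t^(eta_k)] = O(1/n) and E[q^(eta_0)] = O(n)
    bound p_n(L + s) by a constant times q^(L_k) and by a constant times t^(L_0)
    [law_lower, law_upper].  The limit law inherits both bounds, because for given
    chi it is the limit of p_n along n q^j, j -> oo, at the levels s + j
    [Llaw_le].  Hence only finitely many L matter for a given precision.

    The symmetric functions. [HLrows] builds Q_lambda by adding rows one at a time
    with Jing's operators; in finitely many variables it is the symmetrization
    defining Hall-Littlewood polynomials [HLrows_HLsym], so that it has the
    restrictions required of the abstract P_lambda [HLExistence.isHLP_rows].  The
    specialization gamma(tau), alpha(1) depends on these restrictions only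
    [PowerSums.specialize_determined]. *)

Set Implicit Arguments.
Unset Strict Implicit.
Unset Printing Implicit Defensive.
Import Order.TTheory GRing.Theory Num.Theory.
Local Open Scope ring_scope.

(** * Adding rows to Hall-Littlewood functions *)

Section Pairing.
Variable S : comNzRingType.
Implicit Types (p a b : {poly S}) (q : nat -> S).

Definition pairing (q : nat -> S) (r : nat) (p : {poly S}) : S :=
  \sum_(j < size p) q (r + j)%N * p`_j.

Lemma pairingE q r p N : (size p <= N)%N ->
  pairing q r p = \sum_(j < N) q (r + j)%N * p`_j.
Proof.
move=> hN; rewrite /pairing (big_ord_widen N (fun j => q (r + j)%N * p`_j)) //.
rewrite big_mkcond; apply: eq_bigr => j _.
by case: ltnP => // h; rewrite nth_default ?mulr0.
Qed.

Lemma pairingD q r : {morph pairing q r : a b / a + b}.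
Proof.
move=> a b; pose N := maxn (size (a + b)) (maxn (size a) (size b)).
rewrite !(@pairingE _ _ _ N) ?leq_max ?leqnn ?orbT // -big_split.
by apply: eq_bigr => j _; rewrite coefD mulrDr.
Qed.

Lemma pairing0 q r : pairing q r 0 = 0.
Proof. by rewrite /pairing size_poly0 big_ord0. Qed.

Lemma pairingCM q r c p : pairing q r (c%:P * p) = c * pairing q r p.
Proof.
pose N := maxn (size (c%:P * p)) (size p).
rewrite !(@pairingE _ _ _ N) ?leq_max ?leqnn ?orbT // mulr_sumr.
by apply: eq_bigr => j _; rewrite coefCM; ring.
Qed.

Lemma pairingN q r p : pairing q r (- p) = - pairing q r p.
Proof. by rewrite -mulN1r -polyCN pairingCM mulN1r. Qed.

Lemma pairing_sum q r (I : Type) (s : seq I) (P : pred I) (F : I -> {poly S}) :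
  pairing q r (\sum_(i <- s | P i) F i) = \sum_(i <- s | P i) pairing q r (F i).
Proof. exact: (big_morph _ (pairingD q r) (pairing0 q r)). Qed.

Lemma pairingC q r c : pairing q r c%:P = q r * c.
Proof.
rewrite (@pairingE _ _ _ 1) ?size_polyC_leq1 //.
by rewrite big_ord_recl big_ord0 addr0 addn0 coefC.
Qed.

Lemma pairingXM q r p : pairing q r ('X * p) = pairing q r.+1 p.
Proof.
rewrite (@pairingE _ _ _ (size p).+1); last first.
  by have [->|p0] := eqVneq p 0; rewrite ?mulr0 ?size_poly0 // mulrC size_mulX.
rewrite big_ord_recl coefXM eqxx mulr0 add0r /pairing.
by apply: eq_bigr => j _; rewrite coefXM /= addnS addSn.
Qed.

End Pairing.

(** With generating functions q(u) for q and R(u) for the result, this is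
    R(u) = q(u) (1 - 'X u) / (1 - t 'X u): when q(u) belongs to an alphabet
    containing the variable 'X, that variable is removed. *)
Fixpoint rowshift (S : comNzRingType) (t : S) (q : nat -> S) (r : nat) :
    {poly S} :=
  if r is r'.+1 then
    t%:P * 'X * rowshift t q r' + (q r)%:P - 'X * (q r')%:P
  else (q 0%N)%:P.

(** Jing's vertex operators: the row r is added by replacing q with [rowshift] in
    the function of the rows l', which becomes a polynomial in an auxiliary
    variable, and then pairing the power j of that variable with q_(r+j). The rows
    may come in any order; for a partition l and the one-row
    functions q, this is Q_l. *)
Fixpoint HLrows (l : seq nat) (S : comNzRingType) (t : S) (q : nat -> S) : S :=
  if l is r :: l' then
    pairing q r (HLrows l' (t%:P : {poly S}) (rowshift t q))
  else 1.

Section Naturality.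
Variables (S T : comNzRingType) (f : {rmorphism S -> T}) (t : S) (u : T)
  (q : nat -> S) (p : nat -> T).
Hypotheses (ftu : f t = u) (fqp : forall r, f (q r) = p r).

Lemma pairing_morph r (a : {poly S}) :
  f (pairing q r a) = pairing p r (map_poly f a).
Proof.
rewrite (@pairingE _ p r _ (size a)) ?size_poly // rmorph_sum.
by apply: eq_bigr => j _; rewrite rmorphM coef_map fqp.
Qed.

Lemma rowshift_morph r : map_poly f (rowshift t q r) = rowshift u p r.
Proof.
elim: r => [|r IH] /=; first by rewrite map_polyC /= fqp.
rewrite !(rmorphB, rmorphD, rmorphM) /= IH.
by rewrite !map_polyC !map_polyX /= ftu !fqp.
Qed.
End Naturality.

Lemma HLrows_morph l (S T : comNzRingType) (f : {rmorphism S -> T}) t u q p :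
  f t = u -> (forall r, f (q r) = p r) -> f (HLrows l t q) = HLrows l u p.
Proof.
elim: l S T f t u q p => [|r l IH] S T f t u q p ftu fqp /=.
  exact: rmorph1.
rewrite (pairing_morph fqp); congr pairing.
apply: (IH _ _ (map_poly f)) => [|i]; first by rewrite /= map_polyC /= ftu.
exact: (rowshift_morph ftu fqp).
Qed.

(** Two successive shifts multiply q(u) by a function that is symmetric in the two
    auxiliary variables. The induction follows the two-term recursion of the double
    shift, which is displayed in symmetric form. *)
Lemma rowshift_fixed (S : comNzRingType) (t : S) q r
    (f : {rmorphism {poly {poly S}} -> {poly {poly S}}}) :
  (forall a, f a%:P%:P = a%:P%:P) -> f 'X = 'Y -> f 'Y = 'X ->
  f (rowshift t%:P (rowshift t q) r) = rowshift t%:P (rowshift t q) r.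
Proof.
move=> fC fX fY.
suff [] : f (rowshift t%:P (rowshift t q) r) = rowshift t%:P (rowshift t q) r /\
          f (rowshift t%:P (rowshift t q) r.+1) =
            rowshift t%:P (rowshift t q) r.+1 by [].
elim: r => [|r [IH0 IH1]].
  split => /=; first exact: fC.
  rewrite !(polyCB, polyCD, polyCM).
  by rewrite !(rmorphB, rmorphD, rmorphM) !fC fX fY; ring.
split=> //.
have -> : rowshift t%:P (rowshift t q) r.+2 =
   (t%:P%:P * 'X + t%:P%:P * 'Y) * rowshift t%:P (rowshift t q) r.+1
   - t%:P%:P ^+ 2 * 'X * 'Y * rowshift t%:P (rowshift t q) r
   + (q r.+2)%:P%:P - (q r.+1)%:P%:P * 'X - (q r.+1)%:P%:P * 'Y
   + (q r)%:P%:P * 'X * 'Y.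
  by rewrite /= !(polyCB, polyCD, polyCM); ring.
move: IH0 IH1; move: (rowshift _ _ r) (rowshift _ _ r.+1) => A0 A1 IH0 IH1.
by rewrite !(rmorphB, rmorphD, rmorphM, rmorphXn) !fC IH0 IH1 fX fY; ring.
Qed.

Lemma rowshift_sym (S : comNzRingType) (t : S) q r :
  swapXY (rowshift t%:P (rowshift t q) r) = rowshift t%:P (rowshift t q) r.
Proof.
apply: (rowshift_fixed t q r (f := (swapXY : {rmorphism _ -> _}))) => [a||].
- by rewrite /= swapXY_polyC map_polyC.
- exact: swapXY_X.
- exact: swapXY_Y.
Qed.

(** After both rows are added, the contribution of the rows below is a polynomial
    in two auxiliary variables with a symmetric matrix of coefficients
    [rowshift_sym]. Expanding the inner shift leaves, besides the claimed multiple,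
    an antisymmetric expression, which cancels against that symmetry. *)
Lemma HLrows_straighten (S : comNzRingType) (t : S) q l1 s l2 :
  HLrows (l1 ++ s :: s.+1 :: l2) t q = t * HLrows (l1 ++ s.+1 :: s :: l2) t q.
Proof.
elim: l1 S t q => [|r l1 IH] S t q; last by rewrite /= IH pairingCM.
rewrite /=.
set f := HLrows l2 _ _.
have fS i j : (f`_i)`_j = (f`_j)`_i.
  have fsw : swapXY f = f.
    rewrite /f; apply: (HLrows_morph l2 (f := (swapXY : {rmorphism _ -> _}))) => [|r].
      by rewrite /= swapXY_polyC map_polyC.
    exact: rowshift_sym.
  by rewrite -{1}fsw coef_swapXY.
have key r i : pairing q s (rowshift t q r.+1 * f`_i) =
    t * pairing q s.+1 (rowshift t q r * f`_i) +
    q r.+1 * pairing q s f`_i - q r * pairing q s.+1 f`_i.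
  rewrite /= !(mulrDl, mulNr) !pairingD pairingN.
  by rewrite -!mulrA !pairingCM !pairingXM pairingCM.
rewrite [pairing (rowshift _ _) s.+1 f]/pairing [pairing (rowshift _ _) s f]/pairing.
rewrite !pairing_sum mulr_sumr.
under eq_bigr do rewrite addSn key.
rewrite sumrB big_split /= -addrA -[RHS]addr0; congr +%R.
apply/eqP; rewrite subr_eq0; apply/eqP.
pose N := maxn (size f) (\max_(i < size f) size (f`_i)%R).
have sN i : (size (f`_i)%R <= N)%N.
  have [h|h] := ltnP i (size f); last by rewrite nth_default ?size_poly0.
  by rewrite leq_max (leq_bigmax (Ordinal h)) orbT.
have wid (G : nat -> S) : (forall i, f`_i = 0 -> G i = 0) ->
    \sum_(i < size f) G i = \sum_(i < N) G i.
  move=> h; rewrite (big_ord_widen N G) ?leq_maxl //.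
  rewrite big_mkcond; apply: eq_bigr => i _.
  by case: ltnP => // hi; rewrite h // nth_default.
rewrite (wid (fun i => q (s + i).+1 * pairing q s f`_i)); last first.
  by move=> i ->; rewrite pairing0 mulr0.
rewrite (wid (fun i => q (s + i)%N * pairing q s.+1 f`_i)); last first.
  by move=> i ->; rewrite pairing0 mulr0.
under eq_bigr do rewrite (pairingE _ _ (sN _)) mulr_sumr.
under [RHS]eq_bigr do rewrite (pairingE _ _ (sN _)) mulr_sumr.
rewrite exchange_big; apply: eq_bigr => i _; apply: eq_bigr => j _.
by rewrite fS addSn !mulrA (mulrC (q _)).
Qed.

(** * Derivations acting on rows *)

Definition derivation (S : comNzRingType) (D : S -> S) : Prop :=
  {morph D : a b / a + b} /\ (forall a b, D (a * b) = D a * b + a * D b).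

Section Derivation.
Variables (S : comNzRingType) (D : S -> S).
Hypothesis hD : derivation D.

Lemma derivation0 : D 0 = 0.
Proof. by have := hD.1 0 0; rewrite addr0 => /eqP; rewrite addrC -subr_eq subrr eq_sym => /eqP. Qed.

Lemma derivation1 : D 1 = 0.
Proof.
have := hD.2 1 1; rewrite !mulr1 mul1r => /eqP.
by rewrite addrC -subr_eq subrr eq_sym => /eqP.
Qed.

Lemma derivation_sum (I : Type) (s : seq I) (P : pred I) (F : I -> S) :
  D (\sum_(i <- s | P i) F i) = \sum_(i <- s | P i) D (F i).
Proof. exact: (big_morph _ hD.1 derivation0). Qed.

(** A derivation of S extends to {poly S} by annihilating 'X; this is how the
    derivation reaches the rows below the first one. *)
Definition coefwise (p : {poly S}) : {poly S} := \poly_(i < size p) D p`_i.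

Lemma coef_coefwise p i : (coefwise p)`_i = D p`_i.
Proof.
rewrite coef_poly; case: ltnP => // h.
by rewrite nth_default // derivation0.
Qed.

Lemma coefwise_derivation : derivation coefwise.
Proof.
split=> a b; apply/polyP => i.
  by rewrite coefD !coef_coefwise coefD hD.1.
rewrite coefD coef_coefwise !coefM derivation_sum -big_split.
by apply: eq_bigr => j _; rewrite hD.2 !coef_coefwise.
Qed.

Lemma coefwiseC c : coefwise c%:P = (D c)%:P.
Proof.
by apply/polyP => i; rewrite coef_coefwise !coefC; case: eqP; rewrite ?derivation0.
Qed.

Lemma coefwiseX : coefwise 'X = 0.
Proof.
apply/polyP => i; rewrite coef_coefwise coefX coef0.
by case: eqP => _; rewrite ?derivation0 ?derivation1.
Qed.

Variables (t : S) (q : nat -> S) (c : S).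
Hypotheses (Dt : D t = 0) (Dq0 : D (q 0%N) = 0).
Hypothesis DqS : forall r, D (q r.+1) = c * q r.

Lemma coefwise_rowshift r :
  coefwise (rowshift t q r.+1) = c%:P * rowshift t q r.
Proof.
have [dD dM] := coefwise_derivation.
have dN a : coefwise (- a) = - coefwise a.
  apply/eqP; rewrite -subr_eq0 opprK -dD addNr.
  by apply/eqP/polyP => i; rewrite coef_coefwise coef0 derivation0.
have e n : coefwise (rowshift t q n.+1) =
    t%:P * 'X * coefwise (rowshift t q n) + (D (q n.+1))%:P
    - 'X * (D (q n))%:P.
  rewrite /= !(dD, dN, dM) !coefwiseC coefwiseX Dt; ring.
elim: r => [|r IH]; first by rewrite e /= coefwiseC DqS Dq0 polyCM; ring.
by rewrite e IH !DqS /= !polyCM; ring.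
Qed.

Lemma derivation_pairing r p :
  D (pairing q r.+1 p) = c * pairing q r p + pairing q r.+1 (coefwise p).
Proof.
rewrite (@pairingE _ _ _ (coefwise p) (size p)) ?size_poly //.
rewrite derivation_sum mulr_sumr -big_split; apply: eq_bigr => j _.
by rewrite hD.2 coef_coefwise addSn DqS mulrA.
Qed.

End Derivation.

Fixpoint decrements (l : seq nat) : seq (seq nat) :=
  if l is r :: l' then (r.-1 :: l') :: map (cons r) (decrements l') else [::].

(** The hypothesis on q says D q(u) = c u q(u), which is stable under [rowshift];
    hence D acts on each row in turn by the same rule. *)
Lemma derivation_HLrows l (S : comNzRingType) (D : S -> S) t q c :
  derivation D -> D t = 0 -> D (q 0%N) = 0 ->
  (forall r, D (q r.+1) = c * q r) -> all (leq 1) l ->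
  D (HLrows l t q) = c * \sum_(l' <- decrements l) HLrows l' t q.
Proof.
elim: l S D t q c => [|[|r] l IH] //= S D t q c hD Dt D0 DS.
  by rewrite big_nil mulr0 derivation1.
move=> hl; rewrite (derivation_pairing hD DS) big_cons mulrDr; congr +%R.
rewrite (IH _ _ _ _ c%:P) //=.
- by rewrite pairingCM pairing_sum big_map.
- exact: coefwise_derivation.
- by rewrite coefwiseC // Dt.
- by rewrite coefwiseC // D0.
- exact: coefwise_rowshift.
Qed.

(** * Newton identities *)

(** Newton's identities u q'(u) = q(u) (sum_a P_a u^(a+1)). For the one-row
    Hall-Littlewood functions, P_a = (1 - t^(a+1)) p_(a+1). *)
Definition newton (S : comNzRingType) (P q : nat -> S) : Prop :=
  q 0%N = 1 /\
  forall r, r.+1%:R * q r.+1 = \sum_(a < r.+1) P a * q (r - a)%N.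

Section Newton.
Variable S : comNzRingType.
Implicit Types P q : nat -> S.

Definition newton_defect P q r :=
  r.+1%:R * q r.+1 - \sum_(a < r.+1) P a * q (r - a)%N.

(** Multiplying q(u) by 1 / (1 - x u) adds x^(a+1) to P_a: the two defects are
    related by the same factor, so that one vanishes iff the other does. *)
Lemma newton_geometric_defect x P q q' :
  q' 0%N = q 0%N -> (forall r, q' r.+1 - x * q' r = q r.+1) ->
  let P' a := P a + x ^+ a.+1 in
  newton_defect P' q' 0 = newton_defect P q 0 /\
  forall r, newton_defect P' q' r.+1 - x * newton_defect P' q' r
            = newton_defect P q r.+1.
Proof.
move=> h0 hS P'; rewrite /newton_defect; split.
  by rewrite !big_ord1 /= -hS /P' h0; ring.
move=> r.
have split (h : nat -> S) n : \sum_(a < n) P' a * h a =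
    \sum_(a < n) P a * h a + \sum_(a < n) x ^+ a.+1 * h a.
  by rewrite -big_split; apply: eq_bigr => a _; rewrite mulrDl.
rewrite (split (fun a => q' (r.+1 - a)%N)) (split (fun a => q' (r - a)%N)).
have e1 : \sum_(a < r.+2) P a * q' (r.+1 - a)%N
        - x * \sum_(a < r.+1) P a * q' (r - a)%N =
          \sum_(a < r.+2) P a * q (r.+1 - a)%N.
  rewrite big_ord_recr [RHS]big_ord_recr /= subnn h0 addrAC; congr +%R.
  rewrite mulr_sumr -sumrB; apply: eq_bigr => a _.
  by rewrite subSn -1?ltnS // -hS; ring.
have e2 : \sum_(a < r.+2) x ^+ a.+1 * q' (r.+1 - a)%N =
    x * q' r.+1 + x * \sum_(a < r.+1) x ^+ a.+1 * q' (r - a)%N.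
  rewrite big_ord_recl /= subn0 mulr_sumr; congr +%R.
  by apply: eq_bigr => a _; rewrite subSS (exprS x a.+1) mulrA.
rewrite -e1 e2 -hS -!natr1; ring.
Qed.

Lemma newton_geometric x P q q' :
  q' 0%N = q 0%N -> (forall r, q' r.+1 - x * q' r = q r.+1) ->
  newton (fun a => P a + x ^+ a.+1) q' <-> newton P q.
Proof.
move=> h0 hS; have [d0 dS] := newton_geometric_defect P h0 hS.
have dE P1 q1 : (forall r, newton_defect P1 q1 r = 0) <->
    (forall r, r.+1%:R * q1 r.+1 = \sum_(a < r.+1) P1 a * q1 (r - a)%N).
  rewrite /newton_defect; split=> h r; last by rewrite h subrr.
  by apply/eqP; rewrite -subr_eq0; apply/eqP.
set P' := fun a => _; rewrite /newton h0.
split=> -[-> h]; split=> //.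
  apply: (proj1 (dE P q)); have {}h := proj2 (dE P' q') h.
  case=> [|r]; first by rewrite -d0 h.
  by rewrite -dS !h mulr0 subr0.
apply: (proj1 (dE P' q')); have {}h := proj2 (dE P q) h.
elim=> [|r IH]; first by rewrite d0 h.
by move: (dS r); rewrite IH h mulr0 subr0.
Qed.

Lemma eq_newton P P' q : P =1 P' -> newton P q -> newton P' q.
Proof.
move=> e [h0 h]; split=> // r; rewrite h.
by apply: eq_bigr => a _; rewrite e.
Qed.

(** A new variable x multiplies q(u) by (1 - t x u) / (1 - x u). *)
Lemma newton_add_variable t x P q q' :
  q' 0%N = q 0%N ->
  (forall r, q' r.+1 - x * q' r = q r.+1 - t * x * q r) ->
  newton P q -> newton (fun a => P a + (1 - t ^+ a.+1) * x ^+ a.+1) q'.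
Proof.
move=> h0 hS hq.
(* q1(u) = (1 - t x u) q(u) *)
pose q1 r := if r is r'.+1 then q r'.+1 - t * x * q r' else q 0%N.
have h1 : newton (fun a => P a - (t * x) ^+ a.+1) q1.
  apply/(@newton_geometric (t * x) _ q1 q) => //.
  by apply: eq_newton hq => a; rewrite subrK.
have := proj2 (newton_geometric _ h0 hS) h1.
by apply: eq_newton => a; rewrite exprMn; ring.
Qed.

Hypothesis natS_reg : forall r (x y : S), r.+1%:R * x = r.+1%:R * y -> x = y.

Lemma newton_unique P q q' : newton P q -> newton P q' -> q =1 q'.
Proof.
move=> [q0 hq] [q0' hq'].
suff h n : forall r, (r < n)%N -> q r = q' r by move=> r; apply: (h r.+1).
elim: n => // n IH [|r] hr; first by rewrite q0.
apply: (@natS_reg r); rewrite hq hq'; apply: eq_bigr => a _.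
by rewrite IH // (leq_ltn_trans (leq_subr _ _)).
Qed.

(** If D moves only p_1, then D log q(u) = c u. *)
Lemma newton_derivation (D : S -> S) P q c :
  derivation D -> newton P q -> D (P 0%N) = c -> (forall a, D (P a.+1) = 0) ->
  forall r, D (q r.+1) = c * q r.
Proof.
move=> hD [q0 hq] DP0 DPS.
have D1 : D 1 = 0 by exact: derivation1.
have DM r x : D (r%:R * x) = r%:R * D x.
  elim: r => [|r IH]; first by rewrite !mul0r derivation0.
  by rewrite -natr1 !mulrDl !mul1r hD.1 IH.
suff h n : forall r, (r < n)%N -> D (q r.+1) = c * q r by move=> r; apply: (h r.+1).
elim: n => // n IH r hr.
apply: (@natS_reg r); rewrite -DM hq derivation_sum //.
under eq_bigr do rewrite hD.2.
rewrite big_split /= big_ord_recl /= DP0 subn0 big1 ?addr0; last first.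
  by move=> a _; rewrite DPS mul0r.
rewrite big_ord_recr /= subnn q0 D1 mulr0 addr0.
rewrite -natr1 mulrDl mul1r addrC; congr +%R.
case: r hr => [|r] hr; first by rewrite big_ord0 mul0r.
have -> : r.+1%:R * (c * q r.+1) = c * (r.+1%:R * q r.+1) by ring.
rewrite hq mulr_sumr; apply: eq_bigr => a _.
rewrite subSn ?IH //; [by ring| exact: leq_ltn_trans (leq_subr _ _) _|].
by rewrite -ltnS.
Qed.

Variables (inv : nat -> S) (P : nat -> S).

Fixpoint newton_list n : seq S :=
  if n is n'.+1 then
    let s := newton_list n' in
    rcons s (inv n' * \sum_(a < n'.+1) P a * s`_(n' - a))
  else [:: 1].

Definition newton_seq r := (newton_list r)`_r.

Lemma newton_seqP : (forall r, r.+1%:R * inv r = 1) -> newton P newton_seq.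
Proof.
move=> hinv; split=> // r.
have sz n : size (newton_list n) = n.+1.
  by elim: n => //= n IH; rewrite size_rcons IH.
have stable n m : (m <= n)%N -> (newton_list n)`_m = newton_seq m.
  elim: n => [|n IH]; first by rewrite leqn0 => /eqP->.
  rewrite leq_eqVlt => /orP[/eqP->//|h].
  by rewrite /= nth_rcons sz h IH.
rewrite {1}/newton_seq /= nth_rcons sz ltnn eqxx mulrA hinv mul1r.
by apply: eq_bigr => a _; rewrite stable ?leq_subr.
Qed.

End Newton.

Lemma newton_morph (S T : comNzRingType) (f : {rmorphism S -> T}) P q P' :
  (forall a, f (P a) = P' a) -> newton P q -> newton P' (fun r => f (q r)).
Proof.
move=> fP [q0 hq]; split=> [|r]; first by rewrite q0 rmorph1.
rewrite -(rmorph_nat f) -rmorphM hq rmorph_sum.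
by apply: eq_bigr => a _; rewrite rmorphM fP.
Qed.

(** * Finitely many variables *)

Section FiniteVariables.
Variables (E : fieldType) (t : E).

(** The coefficient of 1 / (1 - x_i u) in the partial fraction expansion of
    prod_j (1 - t x_j u) / (1 - x_j u). *)
Definition rowcoef n (x : 'I_n -> E) i : E :=
  (1 - t) * \prod_(j < n | j != i) ((x i - t * x j) / (x i - x j)).

(** The one-row function q_r(x_1, ..., x_n); the partial fraction formula fails at r = 0,
    where its value is 1 - t^n instead of 1. *)
Definition finrows n (x : 'I_n -> E) (r : nat) : E :=
  if r == 0%N then 1 else \sum_i rowcoef x i * x i ^+ r.

(** Lagrange interpolation at 0 and at the x_i of
    prod_j ('X - t x_j) - t^n prod_j ('X - x_j), a polynomial of degree at most n
    that vanishes at 0; the claim compares the coefficients of 'X^n. *)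
Lemma sum_rowcoef n (x : 'I_n -> E) : injective x -> (forall i, x i != 0) ->
  \sum_i rowcoef x i = 1 - t ^+ n.
Proof.
move=> xI x0.
pose Pi := \prod_(j < n) ('X - (x j)%:P).
pose A := \sum_i rowcoef x i *: ('X * \prod_(j < n | j != i) ('X - (x j)%:P)).
pose B := \prod_(j < n) ('X - (t * x j)%:P) - (t ^+ n) *: Pi.
have szP (y : 'I_n -> E) (Q : pred 'I_n) :
    size (\prod_(j < n | Q j) ('X - (y j)%:P)) = #|Q|.+1.
  by rewrite -big_filter size_prod_XsubC /= -sum1_card -sum1_size big_filter.
have lead (y : 'I_n -> E) (Q : pred 'I_n) :
    (\prod_(j < n | Q j) ('X - (y j)%:P))`_#|Q| = 1.
  have /monicP : \prod_(j < n | Q j) ('X - (y j)%:P) \is monic.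
    by apply: monic_prod => j _; exact: monicXsubC.
  by rewrite lead_coefE szP.
have cardn : #|[pred _ : 'I_n | true]| = n by rewrite eq_cardT // size_enum_ord.
have card1 i : (#|[pred j : 'I_n | j != i]|.+1 = n)%N.
  by rewrite -[RHS]card_ord [RHS](cardD1 i) add1n; congr S; apply: eq_card => j; rewrite !inE andbT.
have AB : A = B.
  apply/eqP; rewrite -subr_eq0; apply/negPn/negP => AB0.
  have := @max_poly_roots _ _ (0 :: [seq x i | i <- enum 'I_n]) AB0.
  have -> /= : all (root (A - B)) (0 :: [seq x i | i <- enum 'I_n]).
    apply/allP => z; rewrite /A /B /Pi inE => /orP[/eqP->|/mapP[i _ ->]].
      rewrite rootE hornerD hornerN horner_sum big1 ?sub0r; last first.
        by move=> i _; rewrite hornerZ hornerM hornerX mul0r mulr0.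
      rewrite oppr_eq0 hornerD hornerN hornerZ !horner_prod.
      rewrite -[X in t ^+ X]card_ord -prodr_const -big_split /=.
      apply/eqP; rewrite -[RHS](subrr (\prod_(j < n) - (t * x j))); congr (_ - _).
        by apply: eq_bigr => j _; rewrite hornerXsubC sub0r.
      by apply: eq_bigr => j _; rewrite hornerXsubC sub0r mulrN.
    rewrite rootE hornerD hornerN horner_sum (bigD1 i) //= [X in _ + X - _]big1 ?addr0; last first.
      move=> j ji; rewrite hornerZ hornerM horner_prod (bigD1 i) 1?eq_sym //=.
      by rewrite hornerXsubC subrr mul0r !mulr0.
    rewrite hornerD hornerN !hornerZ hornerM hornerX !horner_prod.
    rewrite [X in _ - (_ - t ^+ n * X)](bigD1 i) //= hornerXsubC subrr mul0r mulr0 subr0.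
    rewrite [X in _ - X](bigD1 i) //= hornerXsubC.
    rewrite [\prod_(i0 < n | _) ('X - (t * _)%:P).[_]](eq_bigr (fun j => x i - t * x j)); last first.
      by move=> j _; rewrite hornerXsubC.
    rewrite [\prod_(i0 < n | _) ('X - _%:P).[_]](eq_bigr (fun j => x i - x j)); last first.
      by move=> j _; rewrite hornerXsubC.
    rewrite /rowcoef [\prod_(j < n | _) (_ / _)]big_split /=.
    apply/eqP; rewrite prodfV.
    have h : \prod_(j < n | j != i) (x i - x j) != 0.
      rewrite prodf_seq_neq0; apply/allP => j _; apply/implyP => ji.
      by rewrite subr_eq0; apply: contra ji => /eqP /xI ->.
    by field.
  rewrite map_inj_uniq // enum_uniq andbT => /(_ isT).
  have -> : (0 \notin [seq x i | i <- enum 'I_n]).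
    by apply/mapP => -[i _ /eqP]; rewrite eq_sym (negPf (x0 i)).
  move=> /(_ isT); rewrite size_map size_enum_ord ltnNge; apply/negP; rewrite negbK.
  apply: (leq_trans (size_polyD _ _)); rewrite geq_max size_polyN; apply/andP; split.
    apply: (leq_trans (size_sum _ _ _)); apply/bigmax_leqP => i _.
    apply: (leq_trans (size_scale_leq _ _)); rewrite mulrC size_mulX ?szP ?card1 //.
    by rewrite -size_poly_gt0 szP.
  apply: (leq_trans (size_polyD _ _)); rewrite geq_max size_polyN szP cardn leqnn /=.
  by apply: (leq_trans (size_scale_leq _ _)); rewrite szP cardn.
have := congr1 (fun p : {poly E} => p`_n) AB.
rewrite /A /B coefB coefZ -[X in _`_X - _]cardn lead.
rewrite -[X in Pi`_X]cardn lead mulr1 => <-.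
rewrite coef_sum; apply: eq_bigr => i _.
have n0 : (n == 0%N) = false.
  by apply/negbTE; rewrite -lt0n; apply: leq_ltn_trans (ltn_ord i).
rewrite coefZ coefXM n0 (_ : n.-1 = #|[pred j | j != i]|) ?lead ?mulr1 //.
by rewrite -[RHS]/(#|[pred j | j != i]|.+1.-1); congr predn; rewrite card1.
Qed.

Lemma rowcoef_lift n (x : 'I_n.+1 -> E) i j :
  rowcoef x (lift i j) = rowcoef (fun l => x (lift i l)) j *
    ((x (lift i j) - t * x i) / (x (lift i j) - x i)).
Proof.
rewrite /rowcoef (bigD1_ord i) ?neq_lift //= -[RHS]mulrA; congr (_ * _).
by rewrite mulrC; congr (_ * _); apply: eq_bigl => l; rewrite (inj_eq lift_inj).
Qed.

(** Removing the variable x_i from the alphabet, coefficient by coefficient of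
    q(u) (1 - x_i u) = q'(u) (1 - t x_i u). *)
Lemma finrows_lift n (x : 'I_n.+1 -> E) i r :
  injective x -> (forall i, x i != 0) ->
  finrows x r.+1 - x i * finrows x r =
  finrows (fun j => x (lift i j)) r.+1 - t * x i * finrows (fun j => x (lift i j)) r.
Proof.
move=> xI x0.
have lI : injective (fun j => x (lift i j)) by move=> a b /xI /lift_inj.
have key m : \sum_j rowcoef x j * x j ^+ m.+1 - x i * \sum_j rowcoef x j * x j ^+ m =
  \sum_j rowcoef (fun l => x (lift i l)) j * x (lift i j) ^+ m.+1
  - t * x i * \sum_j rowcoef (fun l => x (lift i l)) j * x (lift i j) ^+ m.
  rewrite !mulr_sumr -!sumrB (bigD1_ord i) //= [X in X + _](_ : _ = 0) ?add0r.
    apply: eq_bigr => j _; rewrite rowcoef_lift !exprS.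
    have h : x (lift i j) - x i != 0.
      by rewrite subr_eq0; apply/eqP => /xI /eqP; rewrite eq_sym (negPf (neq_lift _ _)).
    by field.
  by rewrite exprS; ring.
case: r => [|r]; last exact: key.
have := key 0%N; rewrite /finrows /=.
under [X in _ - x i * X]eq_bigr do rewrite expr0 mulr1.
under [X in _ = _ - t * x i * X]eq_bigr do rewrite expr0 mulr1.
rewrite !sum_rowcoef // exprS => h.
have -> : forall a, a - x i * 1 = (a - x i * (1 - t * t ^+ n)) - x i * t * t ^+ n.
  by move=> a; ring.
by rewrite h; ring.
Qed.

Lemma newton_finrows n (x : 'I_n -> E) : injective x -> (forall i, x i != 0) ->
  newton (fun a => (1 - t ^+ a.+1) * \sum_i x i ^+ a.+1) (finrows x).
Proof.
elim: n x => [|n IH] x xI x0.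
  split=> // r; rewrite /finrows /= big_ord0 mulr0 big1 // => a _.
  by rewrite big_ord0 mulr0 mul0r.
have lI : injective (fun j => x (lift ord0 j)) by move=> a b /xI /lift_inj.
have := @newton_add_variable _ t (x ord0) _
  (finrows (fun j : 'I_n => x (lift ord0 j))) (finrows x) (erefl _)
  (fun r => finrows_lift ord0 r xI x0) (IH _ lI (fun j => x0 _)).
apply: eq_newton => a; rewrite big_ord_recl; ring.
Qed.

(** The partial fraction formula evaluates the auxiliary variable at each x_i, and at
    'X = x_i the shift removes x_i from the alphabet [finrows_lift]. *)
Lemma HLrows_finrows n (x : 'I_n.+1 -> E) r l :
  injective x -> (forall i, x i != 0) -> (0 < r)%N ->
  HLrows (r :: l) t (finrows x) = \sum_i rowcoef x i * x i ^+ r *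
    HLrows l t (finrows (fun j => x (lift i j))).
Proof.
move=> xI x0 r0 /=; set f := HLrows l _ _.
have fE i : f.[x i] = HLrows l t (finrows (fun j => x (lift i j))).
  rewrite -[LHS]/(horner_eval (x i) f); apply: HLrows_morph => [|m].
    by rewrite /= /horner_eval hornerC.
  rewrite /= /horner_eval.
  elim: m => [|m IH]; first by rewrite /= hornerC.
  by rewrite /= !hornerE IH -addrA (finrows_lift i m xI x0); ring.
under [RHS]eq_bigr do rewrite -fE horner_coef mulr_sumr.
rewrite exchange_big; apply: eq_bigr => j _.
rewrite /finrows addn_eq0 -leqn0 leqNgt r0 /= mulr_suml.
by apply: eq_bigr => i _; rewrite exprD; ring.
Qed.

Lemma HLrows_no_variable (x : 'I_0 -> E) r l : (0 < r)%N ->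
  HLrows (r :: l) t (finrows x) = 0.
Proof.
move=> r0; apply: big1 => j _.
by rewrite /finrows addn_eq0 -leqn0 leqNgt r0 big_ord0 mul0r.
Qed.

End FiniteVariables.

Section Symmetrization.
Variables (E : fieldType) (t : E).

Definition HLsym n (x : 'I_n -> E) (l : seq nat) : E :=
  \sum_(w : 'S_n)
     (\prod_(i < n) x (w i) ^+ nth 0%N l i) *
     (\prod_(i < n) \prod_(j < n | (i < j)%N)
        ((x (w i) - t * x (w j)) / (x (w i) - x (w j)))).

(** The permutations of n+1 points that send 0 to i are the lifts of the
    permutations of n points. *)
Lemma sum_perm_lift n (i : 'I_n.+1) (G : 'S_n.+1 -> E) :
  \sum_(w : 'S_n.+1 | w ord0 == i) G w = \sum_s G (lift_perm ord0 i s).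
Proof.
rewrite (reindex (lift_perm ord0 i)); last first.
  pose ulsf k0 (s : 'S_n.+1) k := odflt k (unlift (s k0) (s (lift k0 k))).
  have ulsfK k0 (s : 'S_n.+1) k: lift (s k0) (ulsf k0 s k) = s (lift k0 k).
    rewrite /ulsf; have:= neq_lift k0 k.
    by rewrite -(can_eq (permK s)) => /unlift_some[] ? ? ->.
  have inj_ulsf: injective (ulsf ord0 _).
    move=> s; apply: can_inj (ulsf (s ord0) s^-1%g) _ => k'.
    by rewrite {1}/ulsf ulsfK !permK liftK.
  exists (fun s => perm (inj_ulsf s)) => [s _ | s].
    by apply/permP=> k'; rewrite permE /ulsf lift_perm_lift lift_perm_id liftK.
  move/(s _ =P _) => si0; apply/permP=> k.
  case: (unliftP ord0 k) => [k'|] ->; rewrite ?lift_perm_id //.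
  by rewrite lift_perm_lift -si0 permE ulsfK.
by apply: eq_bigl => s; rewrite lift_perm_id eqxx.
Qed.

Lemma prod_ord_gt0 n (F : 'I_n.+1 -> E) :
  \prod_(j < n.+1 | (0 < j)%N) F j = \prod_(j < n) F (lift ord0 j).
Proof. by rewrite big_mkcond big_ord_recl /= mul1r. Qed.

Lemma prod_ord_gt_lift n (F : 'I_n.+1 -> E) (i : 'I_n) :
  \prod_(j < n.+1 | (lift ord0 i < j)%N) F j = \prod_(j < n | (i < j)%N) F (lift ord0 j).
Proof. by rewrite big_mkcond big_ord_recl /= mul1r [RHS]big_mkcond. Qed.

Lemma prod_ord_neq n (F : 'I_n.+1 -> E) (i : 'I_n.+1) :
  \prod_(j < n.+1 | j != i) F j = \prod_(j < n) F (lift i j).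
Proof.
rewrite big_mkcond (bigD1_ord i) //= eqxx mul1r.
by apply: eq_bigr => j _; rewrite eq_sym neq_lift.
Qed.

(** The sum over permutations is split along the image of the first index. *)
Lemma HLsym_rows n (x : 'I_n.+1 -> E) l :
  (1 - t) * HLsym x l = \sum_i rowcoef t x i * x i ^+ nth 0%N l 0 *
    HLsym (fun j => x (lift i j)) (behead l).
Proof.
rewrite /HLsym (partition_big (fun w : 'S_n.+1 => w ord0) xpredT) //= mulr_sumr.
apply: eq_bigr => i _; rewrite sum_perm_lift !mulr_sumr; apply: eq_bigr => s _.
rewrite big_ord_recl lift_perm_id /=.
under eq_bigr do rewrite lift_perm_lift -[bump _ _]/(_.+1) -nth_behead.
rewrite [X in (1 - t) * (_ * X)]big_ord_recl prod_ord_gt0 lift_perm_id.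
under [X in (1 - t) * (_ * (_ * X))]eq_bigr do rewrite prod_ord_gt_lift lift_perm_lift.
under [X in (1 - t) * (_ * (_ * X))]eq_bigr do under eq_bigr do rewrite lift_perm_lift.
under [X in (1 - t) * (_ * (X * _))]eq_bigr do rewrite lift_perm_lift.
rewrite /rowcoef prod_ord_neq.
rewrite [X in _ = (1 - t) * X * _ * _](reindex_inj (@perm_inj _ s)) /=.
ring.
Qed.

Lemma qpochS (K : comNzRingType) (a b : K) m :
  qpoch a b m.+1 = qpoch a b m * (1 - a * b ^+ m).
Proof. exact: big_ord_recr. Qed.

Lemma HLsym_nil n (x : 'I_n -> E) : injective x -> (forall i, x i != 0) ->
  (1 - t) ^+ n * HLsym x [::] = qpoch t t n.
Proof.
elim: n x => [|n IH] x xI x0.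
  rewrite mul1r /HLsym /qpoch big_ord0 (bigD1 1%g) //= !big_ord0 mulr1 big1 ?addr0 //.
  by move=> w; case/eqP; apply/permP => -[].
rewrite exprSr -mulrA HLsym_rows mulr_sumr qpochS -exprS -(sum_rowcoef t xI x0) mulr_sumr.
apply: eq_bigr => i _; rewrite expr0 mulr1 mulrCA IH //; first exact: mulrC.
  by move=> a b /xI /lift_inj.
Qed.

(** Both sides satisfy the same recursion on the first row; the factor
    (t; t)_(n - size l) accounts for the variables that carry no row, by the case
    l = [::] of the symmetrization [HLsym_nil]. *)
Lemma HLrows_HLsym l n (x : 'I_n -> E) :
  injective x -> (forall i, x i != 0) -> all (leq 1) l -> (size l <= n)%N ->
  HLrows l t (finrows t x) * qpoch t t (n - size l) = (1 - t) ^+ n * HLsym x l.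
Proof.
elim: l n x => [|r l IH] n x xI x0.
  by rewrite /= subn0 HLsym_nil // mul1r.
case: n x xI x0 => [|n] x xI x0 //= /andP[r0 hl] hn.
rewrite -/(HLrows (r :: l) t _) HLrows_finrows // subSS mulr_suml.
rewrite exprSr -mulrA HLsym_rows mulr_sumr; apply: eq_bigr => i _ /=.
rewrite -[LHS]mulrA [RHS]mulrCA; congr (_ * _).
by apply: IH => // a b /xI /lift_inj.
Qed.

End Symmetrization.

(** * Specializations determined by finitely many variables *)

Module PowerSums.
Import finmap monalg mpoly.
Import HallLittlewood.

Section Evaluation.
Variables (S : comNzRingType) (v : nat -> S).

Lemma cmonom_evalEw (d : {fset nat}) (m : {cmonom nat}) : fsubset (finsupp m) d ->
  cmonom_eval v m = \prod_(r <- d) v r ^+ m r.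
Proof.
move=> le; rewrite /cmonom_eval (big_fset_incl _ le) //=.
by move=> i _; rewrite -cmE_eq0 => /eqP ->; rewrite expr0.
Qed.

Lemma cmonom_eval_is_mmorphism : mmorphism (cmonom_eval v).
Proof.
split=> [m1 m2|]; last by rewrite /cmonom_eval mdom1 big_seq_fset0.
rewrite (@cmonom_evalEw (fsetU (finsupp m1) (finsupp m2)) (mmul m1 m2)) ?mdomD //.
rewrite (cmonom_evalEw (fsubsetUl _ (finsupp m2))).
rewrite (cmonom_evalEw (fsubsetUr (finsupp m1) _)) -big_split.
by apply: eq_bigr => r _; rewrite cmM exprD.
Qed.

HB.instance Definition _ := isMultiplicative.Build _ S (cmonom_eval v)
  cmonom_eval_is_mmorphism.

Lemma cmonom_evalU r : cmonom_eval v (ucm r) = v r.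
Proof. by rewrite /cmonom_eval mdomU big_seq_fset1 cmUU expr1. Qed.
End Evaluation.

Lemma mmap_cmonom_morph (K S T : comNzRingType) (f : {rmorphism S -> T})
    (g : K -> S) (h : K -> T) (v : nat -> S) (u : nat -> T) (p : {malg K[{cmonom nat}]}) :
  (forall c, f (g c) = h c) -> (forall r, f (v r) = u r) ->
  f (monalg.mmap g (cmonom_eval v) p) = monalg.mmap h (cmonom_eval u) p.
Proof.
move=> fg fv; rewrite !monalg.mmapE rmorph_sum; apply: eq_bigr => m _.
rewrite rmorphM fg; congr (_ * _); rewrite rmorph_prod.
by apply: eq_bigr => r _; rewrite rmorphXn fv.
Qed.

Lemma eq_specialize (K : fieldType) (v u : nat -> K) f : v =1 u ->
  specialize v f = specialize u f.
Proof. by move=> e; apply: (@mmap_cmonom_morph K K K idfun). Qed.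

Section Restriction.
Variables (K : numFieldType) (n : nat).
Local Notation symfun := {malg K[{cmonom nat}]}.

Lemma meval_restrict (x : 'I_n -> K) (f : symfun) :
  meval x (restrict n f) = specialize (fun r => \sum_i x i ^+ r.+1) f.
Proof.
apply: mmap_cmonom_morph => [c|r]; first exact: mevalC.
by rewrite /psum rmorph_sum; apply: eq_bigr => i _; rewrite rmorphXn /= mevalXU.
Qed.
End Restriction.

(** The images under p_(r+1) |-> 1 + s^(r+1) w^r are polynomials in w. At
    w = 1/(M+1) they are restrictions to the M+2 variables 1, s/(M+1), ...,
    s/(M+1), so that they agree for infinitely many w, hence at w = 0, which is the
    specialization in question. *)
Lemma specialize_determined (K : numFieldType) N (f g : {malg K[{cmonom nat}]})
    (s : K) :
  (forall n, (N <= n)%N -> restrict n f = restrict n g) ->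
  let v r := if r == 0%N then 1 + s else 1 in
  specialize v f = specialize v g.
Proof.
move=> fg v.
(* 'X stands for w *)
pose vp r : {poly K} := 1 + (s ^+ r.+1) *: 'X^r.
pose P (h : {malg K[{cmonom nat}]}) := monalg.mmap (@polyC K) (cmonom_eval vp) h.
have ev w h : (P h).[w] = specialize (fun r => 1 + s ^+ r.+1 * w ^+ r) h.
  rewrite -[LHS]/(horner_eval w _); apply: mmap_cmonom_morph => [c|r].
    by rewrite /= /horner_eval hornerC.
  by rewrite /= /horner_eval /vp !hornerE.
have agree M : (N <= M)%N -> (P f - P g).[M.+1%:R^-1] = 0.
  move=> NM; rewrite hornerD hornerN; apply/eqP; rewrite subr_eq0; apply/eqP.
  pose x (i : 'I_M.+2) := if i == ord0 then 1 else s / M.+1%:R.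
  have xE r : 1 + s ^+ r.+1 * M.+1%:R^-1 ^+ r = \sum_i x i ^+ r.+1.
    rewrite big_ord_recl /x eqxx expr1n; congr (_ + _).
    rewrite (eq_bigr (fun=> (s / M.+1%:R) ^+ r.+1)) //.
    have hM : M.+1%:R * M.+1%:R^-1 = 1 :> K by rewrite mulfV ?pnatr_eq0.
    rewrite sumr_const card_ord -[RHS]mulr_natl exprMn.
    rewrite -[LHS]mul1r -[X in X * _]hM !exprS.
    by move: (M.+1%:R : K) (_^-1) => a b; ring.
  rewrite !ev !(eq_specialize _ xE) -!meval_restrict fg //.
  by rewrite (leq_trans NM) // ltnW.
have PfPg : P f = P g.
  apply/eqP; rewrite -subr_eq0; apply/negPn/negP => h.
  pose D := P f - P g; pose rs := [seq (N + i).+1%:R^-1 : K | i <- iota 0 (size D)].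
  have := max_poly_roots (rs := rs) h.
  rewrite size_map size_iota ltnn => H; apply: notF; apply: H.
    apply/allP => z /mapP [i _ ->]; rewrite rootE agree ?leq_addr //.
  rewrite map_inj_uniq ?iota_uniq // => i j /invr_inj /eqP.
  by rewrite eqr_nat eqSS eqn_add2l => /eqP.
have := congr1 (fun p : {poly K} => p.[0]) PfPg; rewrite !ev => h.
have e r : v r = 1 + s ^+ r.+1 * 0 ^+ r.
  case: r => [|r]; first by rewrite /v eqxx expr1 expr0 mulr1.
  by rewrite /v /= (exprS 0) mul0r mulr0 addr0.
by rewrite !(eq_specialize _ e).
Qed.

End PowerSums.

(** * The Hall-Littlewood symmetric functions *)

Module HLExistence.
Import finmap monalg mpoly.
Import HallLittlewood PowerSums.

Section Existence.
Variables (K : numFieldType) (t : K).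
Hypothesis t_neq1 : forall i, t ^+ i.+1 != 1.
Local Notation symfun := {malg K[{cmonom nat}]}.

Lemma qpoch_neq0 m : qpoch t t m != 0.
Proof. by apply/prodf_neq0 => i _; rewrite subr_eq0 eq_sym -exprS t_neq1. Qed.

Lemma onemt_neq0 : 1 - t != 0.
Proof. by rewrite subr_eq0 eq_sym -(expr1 t) t_neq1. Qed.

Definition HLQcoef (lam : seq nat) : K :=
  \prod_(1 <= i < (\max_(a <- lam) a).+1) qpoch t t (partmult i lam).

Lemma HLQcoef_neq0 lam : HLQcoef lam != 0.
Proof.
by rewrite prodf_seq_neq0; apply/allP => i _; rewrite qpoch_neq0 implybT.
Qed.

Lemma HLv_rows n lam : all (leq 1) lam -> (size lam <= n)%N ->
  HLv n t lam = qpoch t t (n - size lam) * HLQcoef lam / (1 - t) ^+ n.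
Proof.
move=> hlam hn.
have partsE : parts n lam = lam ++ nseq (n - size lam) 0%N.
  apply: (@eq_from_nth _ 0%N) => [|i]; first by rewrite size_mkseq size_cat size_nseq subnKC.
  rewrite size_mkseq => hi; rewrite nth_mkseq // nth_cat nth_nseq.
  by case: ltnP => // h; rewrite nth_default // if_same.
have maxE : (\max_(a <- parts n lam) a = \max_(a <- lam) a)%N.
  rewrite partsE big_cat /= [X in maxn _ X](_ : _ = 0%N) ?maxn0 //.
  by elim: (n - _)%N => [|m IH]; rewrite /= ?big_nil // big_cons IH.
rewrite /HLv maxE; set M := (\max_(a <- lam) a)%N.
rewrite big_split /= prodfV prodrXr; congr (_ * _ ^-1).
  rewrite -(big_mkord xpredT (fun i => qpoch t t (partmult i (parts n lam)))).
  rewrite big_ltn //; congr (_ * _).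
    rewrite partsE /partmult count_cat count_nseq mul1n.
    rewrite (_ : count_mem 0%N lam = 0%N) //.
    by apply/count_memPn; apply/negP => /(allP hlam).
  apply: eq_big_nat => i /andP[i0 _]; rewrite partsE /partmult count_cat count_nseq.
  by rewrite /= eq_sym eqn0Ngt i0 mul0n addn0.
have sumE (s : seq nat) : (forall a, a \in s -> a <= M)%N ->
    (\sum_(i < M.+1) partmult i s = size s)%N.
  elim: s => [|a s IH] h; first by rewrite big1.
  rewrite /partmult /= big_split /= IH; last first.
    by move=> b bs; rewrite h // inE bs orbT.
  have aM : (a < M.+1)%N by rewrite ltnS h // inE eqxx.
  rewrite (bigD1 (Ordinal aM)) //= eqxx big1 ?addn0 ?add1n // => i.
  by rewrite -val_eqE /= eq_sym => /negPf ->.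
rewrite sumE ?size_mkseq // => a; rewrite partsE mem_cat => /orP[h|]; last first.
  by rewrite mem_nseq => /andP[_ /eqP->].
by rewrite /M (big_rem a) //= leq_maxl.
Qed.

Definition tsym : symfun := malgC t.
Definition psym (r : nat) : symfun := mkmalgU (ucm r) 1.
(** The one-row functions q_r, as polynomials in the power sums. *)
Definition qsym : nat -> symfun :=
  newton_seq (fun r => malgC (r.+1%:R^-1)) (fun a => (1 - tsym ^+ a.+1) * psym a).

Lemma newton_qsym : newton (fun a => (1 - tsym ^+ a.+1) * psym a) qsym.
Proof.
apply: newton_seqP => r.
rewrite -(rmorph_nat (@malgC {cmonom nat} K) r.+1) -rmorphM mulfV ?pnatr_eq0 //.
Qed.

(** A ring morphism is applied to [HLrows] by applying it to q, and by Newton's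
    identities the images of the q_r are determined by those of the p_r. *)
Lemma mmap_HLrows (S : comNzRingType) (g : {rmorphism K -> S}) (v : nat -> S)
    (u : S) (q : nat -> S) l :
  (forall r (x y : S), r.+1%:R * x = r.+1%:R * y -> x = y) ->
  g t = u -> newton (fun a => (1 - u ^+ a.+1) * v a) q ->
  monalg.mmap g (cmonom_eval v) (HLrows l tsym qsym) = HLrows l u q.
Proof.
move=> hS gt hq.
have [f [ft fp ->]] : exists f : {rmorphism symfun -> S},
    [/\ f tsym = u, forall a, f (psym a) = v a
      & forall x, monalg.mmap g (cmonom_eval v) x = f x].
  exists (monalg.mmap g (cmonom_eval v)); split=> // [|a].
    by rewrite /= monalg.mmapC.
  rewrite /= monalg.mmapU cmonom_evalU -[RHS]mul1r; congr (_ * _); exact: (rmorph1 g).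
apply: HLrows_morph => //; apply: (newton_unique hS _ hq).
apply: (newton_morph _ newton_qsym) => a.
move: fp ft; move: tsym psym => ts ps fp ft.
transitivity (f (1 - ts ^+ a.+1) * f (ps a)); first exact: rmorphM.
rewrite fp; congr (_ * _).
transitivity (f 1 - f (ts ^+ a.+1)); first exact: rmorphB.
by rewrite (rmorph1 f) (rmorphXn f) ft.
Qed.

(** In n variables this is [HLrows_HLsym], after comparing normalizations. *)
Lemma isHLP_rows lam : all (leq 1) lam ->
  isHLP t lam ((HLQcoef lam)^-1 *: HLrows lam tsym qsym).
Proof.
move=> hlam n; have -> : plength lam = size lam by apply/eqP; rewrite -all_count.
move=> hn.
pose g : {rmorphism K -> {fraction mpoly n K}} := (@tofrac (mpoly n K) \o @mpolyC n K).
pose v r := \sum_(i < n) @HLx K n i ^+ r.+1.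
have -> f : tofrac (restrict n f) = monalg.mmap g (cmonom_eval v) f.
  apply: mmap_cmonom_morph => [c|r] //=.
  rewrite /psum rmorph_sum; apply: eq_bigr => i _; exact: rmorphXn.
have xI : injective (@HLx K n).
  move=> i j /eqP; rewrite /HLx tofrac_eq => /eqP.
  move/(congr1 (mcoeff U_(j)%MM)); rewrite !mcoeffXU eqxx => /eqP.
  by rewrite pnatr_eq1 eqb1 => /eqP.
have x0 i : @HLx K n i != 0.
  rewrite /HLx tofrac_eq0; apply/eqP => /(congr1 (mcoeff U_(i)%MM)) /eqP.
  by rewrite mcoeffXU eqxx mcoeff0 oner_eq0.
have natE r (x y : {fraction mpoly n K}) : r.+1%:R * x = r.+1%:R * y -> x = y.
  apply: mulfI; rewrite -(rmorph_nat g) fmorph_eq0 pnatr_eq0 //.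
rewrite monalg.mmapZ (@mmap_HLrows _ g v (g t) _ _ natE (erefl _) (newton_finrows _ xI x0)).
have := HLrows_HLsym (g t) xI x0 hlam hn.
have -> m : qpoch (g t) (g t) m = g (qpoch t t m).
  rewrite /qpoch rmorph_prod; apply: eq_bigr => i _.
  by rewrite rmorphB rmorph1 rmorphM rmorphXn.
rewrite -(rmorph1 g) -rmorphB -rmorphXn /=.
have -> : HLpoly n t lam = g (HLv n t lam)^-1 * HLsym (g t) (@HLx K n) lam by [].
rewrite HLv_rows //.
set X := HLrows _ _ _; set Y := HLsym _ _ _ => XY.
have h1 : g (qpoch t t (n - size lam)) != 0 by rewrite fmorph_eq0 qpoch_neq0.
apply: (mulfI h1); rewrite mulrCA [_ * X]mulrC XY mulrA -rmorphM mulrA -rmorphM.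
rewrite -[in RHS]rmorphM; congr (_ * Y); apply: (congr1 g).
have h3 : (1 - t) ^+ n != 0 by rewrite expf_neq0 // onemt_neq0.
have h2 := HLQcoef_neq0 lam.
have h4 := qpoch_neq0 (n - size lam).
by field; rewrite h2 h3 h4.
Qed.

Lemma HLP_eq_rows lam (n : nat) : all (leq 1) lam -> (size lam <= n)%N ->
  restrict n (HLP t lam) = restrict n ((HLQcoef lam)^-1 *: HLrows lam tsym qsym).
Proof.
move=> hlam hn; have pl : plength lam = size lam by apply/eqP; rewrite -all_count.
have h1 := isHLP_rows hlam.
have h2 : isHLP t lam (HLP t lam) by apply: (@xgetPex _ 0 (isHLP t lam)); exists ((HLQcoef lam)^-1 *: HLrows lam tsym qsym).
by apply/eqP; rewrite -tofrac_eq h1 ?h2 ?pl.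
Qed.

Definition gammaP (a : nat) : {poly K} :=
  (1 - t ^+ a.+1)%:P * (if a == 0%N then 1 + 'X else 1).

(** The specialization p_1 |-> 1 + s, p_r |-> 1 for r >= 2 is made polynomial in s
    before it is evaluated at s = tau / (1 - t), so that it can be differentiated
    in s. *)
Lemma HLQ_gamma_alpha_rows (q : nat -> {poly K}) tau lam :
  newton gammaP q -> all (leq 1) lam ->
  HLQ_gamma_alpha t tau lam = (HLrows lam t%:P q).[tau / (1 - t)].
Proof.
move=> hq hlam; rewrite /HLQ_gamma_alpha /HLQ -/(HLQcoef lam) /specialize monalg.mmapZ.
rewrite -/(specialize _ _) (@specialize_determined _ (size lam) _ _ _ (fun n => @HLP_eq_rows _ n hlam)).
rewrite /specialize monalg.mmapZ /= mulrA mulfV ?HLQcoef_neq0 // mul1r.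
pose v r := if r == 0%N then 1 + tau / (1 - t) else 1.
pose qv r := (q r).[tau / (1 - t)].
have natE r (x y : K) : r.+1%:R * x = r.+1%:R * y -> x = y.
  by apply: mulfI; rewrite pnatr_eq0.
rewrite (@mmap_HLrows K idfun _ t qv) //.
  symmetry; rewrite -[LHS]/(horner_eval _ _); apply: HLrows_morph => // .
  by rewrite /= /horner_eval hornerC.
apply: (newton_morph (f := horner_eval _) _ hq) => a.
by rewrite /= /horner_eval /gammaP hornerM hornerC; case: eqP; rewrite !hornerE.
Qed.
End Existence.
End HLExistence.

(** * Removing boxes from a partition *)

(** The partition with m_i parts equal to i+1 for i < k, in decreasing order: the
    conjugate of a partition with gaps m_i [conjpart_blocks]. *)
Fixpoint blocks (m : nat -> nat) (k : nat) : seq nat :=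
  if k is k'.+1 then nseq (m k') k'.+1 ++ blocks m k' else [::].

Lemma eq_blocks m m' k : (forall i, (i < k)%N -> m i = m' i) ->
  blocks m k = blocks m' k.
Proof.
elim: k => //= k IH h; rewrite h ?leqnn // IH // => i ik; apply: h.
exact: ltnW.
Qed.

Lemma blocks_ge1 m k : all (leq 1) (blocks m k).
Proof. by elim: k => //= k IH; rewrite all_cat IH andbT all_nseq orbT. Qed.

Lemma size_blocks m k : size (blocks m k) = (\sum_(i < k) m i)%N.
Proof.
by elim: k => [|k IH]; rewrite ?big_ord0 // big_ord_recr size_cat size_nseq IH addnC.
Qed.

Lemma blocks_recl m k :
  blocks m k.+1 = map S (blocks (fun i => m i.+1) k) ++ nseq (m 0%N) 1%N.
Proof.
elim: k => [|k IH]; first by rewrite /= cats0.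
rewrite -[LHS]/(nseq (m k.+1) k.+2 ++ blocks m k.+1) IH catA.
by rewrite /= map_cat map_nseq.
Qed.

Lemma conjpart_cons a s : all (fun b => (b <= a)%N) s ->
  conjpart (a :: s) =
  map S (conjpart s) ++ nseq (a - \max_(b <- s) b)%N 1%N.
Proof.
move=> hs; rewrite /conjpart big_cons.
have maxa : (\max_(b <- s) b <= a)%N.
  by rewrite big_seq; apply/bigmax_leqP_seq => b bs _; exact: (allP hs).
rewrite (maxn_idPl maxa); apply: (@eq_from_nth _ 0%N).
  by rewrite size_mkseq size_cat size_map size_mkseq size_nseq subnKC.
move=> i; rewrite size_mkseq => ia; rewrite nth_mkseq //= ia add1n.
rewrite nth_cat size_map size_mkseq; case: ltnP => him.
  by rewrite (nth_map 0%N) ?size_mkseq // nth_mkseq.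
rewrite nth_nseq ltn_sub2r // ?(leq_ltn_trans him) //.
congr S; apply/eqP; rewrite -leqn0 leqNgt -has_count; apply/hasPn => b bs /=.
by rewrite -leqNgt (leq_trans _ him) // (big_rem b) //= leq_maxl.
Qed.

Lemma conjpart_blocks (a : nat -> nat) k :
  (forall i, a i.+1 <= a i)%N -> a k = 0%N ->
  conjpart (mkseq a k) = blocks (fun i => a i - a i.+1)%N k.
Proof.
elim: k a => [|k IH] a ha ak; first by rewrite /conjpart /= big_nil.
have mono i j : (i <= j)%N -> (a j <= a i)%N.
  by move=> ij; rewrite -(subnKC ij); elim: (j - i)%N => [|d IHd];
     rewrite ?addn0 // addnS; apply: leq_trans IHd.
have -> : mkseq a k.+1 = a 0%N :: mkseq (fun i => a i.+1) k.
  by rewrite /mkseq /= (iotaDl 1 0) -map_comp.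
rewrite conjpart_cons; last by apply/allP => _ /mapP[i _ ->]; rewrite mono.
rewrite IH // blocks_recl; congr (_ ++ nseq (_ - _) _).
case: k ak {IH} => [|k] ak; first by rewrite big_nil ak.
apply/eqP; rewrite eqn_leq; apply/andP; split.
  by rewrite big_map big_seq; apply/bigmax_leqP_seq => i _ _; rewrite mono.
by rewrite big_map (big_rem 0%N) ?mem_iota //= leq_maxl.
Qed.

Lemma decrements_cat l1 l2 : decrements (l1 ++ l2) =
  map (cat^~ l2) (decrements l1) ++ map (cat l1) (decrements l2).
Proof.
elim: l1 => [|r l1 IH] /=; first by rewrite map_id.
by rewrite IH map_cat -!map_comp.
Qed.

Section BlockStraightening.
Variables (S : comNzRingType) (t : S) (q : nat -> S).
Hypothesis q0 : q 0%N = 1.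
Local Notation H l := (HLrows l t q).

Lemma HLrows_straighten_block pre s b post :
  H (pre ++ s :: nseq b s.+1 ++ post) = t ^+ b * H (pre ++ nseq b s.+1 ++ s :: post).
Proof.
elim: b pre => [|b IH] pre; first by rewrite mul1r.
rewrite /= HLrows_straighten -cat_rcons IH exprS mulrA.
by rewrite -[in RHS]cat_rcons.
Qed.

(** Lowering the last but i of the b+1 equal rows and moving it to the end of its
    block costs t^i by straightening. *)
Lemma HLrows_decr_block pre s b post :
  \sum_(l <- decrements (nseq b.+1 s.+1)) H (pre ++ l ++ post) =
  (\sum_(i < b.+1) t ^+ i) * H (pre ++ nseq b s.+1 ++ s :: post).
Proof.
elim: b pre => [|b IH] pre; first by rewrite big_seq1 big_ord1 mul1r.
rewrite -[decrements _]/((s :: nseq b.+1 s.+1) ::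
  map (cons s.+1) (decrements (nseq b.+1 s.+1))).
rewrite big_cons big_map [in RHS]big_ord_recr mulrDl addrC; congr (_ + _).
  under eq_bigr do rewrite cat_cons -cat_rcons.
  by rewrite IH cat_rcons.
by rewrite cat_cons HLrows_straighten_block.
Qed.
End BlockStraightening.

Lemma HLrows_rcons0 l (S : comNzRingType) (t : S) q : q 0%N = 1 ->
  HLrows (rcons l 0%N) t q = HLrows l t q.
Proof.
elim: l S t q => [|r l IH] S t q q0 /=; first by rewrite -polyC1 pairingC q0 mulr1.
by rewrite IH //= q0.
Qed.

(** The effect on the gaps of lowering the j-th part of the conjugate partition. *)
Definition remove_box (m : nat -> nat) (j : nat) (i : nat) : nat :=
  if i == j then (m j).-1 else if i.+1 == j then (m i).+1 else m i.

(** Each block contributes the same partition with coefficient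
    1 + t + ... + t^(m_j - 1) [HLrows_decr_block]. *)
Lemma HLrows_decr_blocks (S : comNzRingType) (t : S) q pre m k : q 0%N = 1 ->
  \sum_(l <- decrements (blocks m k)) HLrows (pre ++ l) t q =
  \sum_(j < k) (\sum_(i < m j) t ^+ i) * HLrows (pre ++ blocks (remove_box m j) k) t q.
Proof.
move=> q0; elim: k pre => [|k IH] pre; first by rewrite big_nil big_ord0.
rewrite -[blocks m k.+1]/(nseq (m k) k.+1 ++ blocks m k) decrements_cat.
rewrite big_cat !big_map [RHS]big_ord_recr [LHS]addrC.
congr (_ + _).
  under eq_bigr do rewrite catA.
  rewrite IH; apply: eq_bigr => j _; rewrite -catA.
  congr (_ * HLrows (_ ++ nseq _ _ ++ _) t q).
  by rewrite /remove_box /= (gtn_eqF (ltn_ord j)) gtn_eqF // ltnS ltnW // ltn_ord.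
case mk : (m k) => [|b]; first by rewrite big_nil big_ord0 mul0r.
rewrite HLrows_decr_block; congr (_ * _).
rewrite -[blocks (remove_box m _) k.+1]/(nseq (remove_box m k k) k.+1 ++
  blocks (remove_box m k) k).
have -> : remove_box m k k = b by rewrite /remove_box eqxx mk.
case: k {IH} mk => [|k] mk; first by rewrite !cats0 catA cats1 HLrows_rcons0.
have -> : blocks (remove_box m k.+1) k.+1 = k.+1 :: nseq (m k) k.+1 ++ blocks m k.
  rewrite /= {1}/remove_box ltn_eqF // eqxx /=; congr (_ :: _ ++ _).
  by apply: eq_blocks => i ik; rewrite /remove_box !ltn_eqF // ?ltnS // ltnW.
by [].
Qed.

(** * Taylor coefficients of Q in tau *)

(** Padding with zeros makes the boundary cases of the recursions below uniform. *)
Definition extz k (v : {ffun 'I_k -> int}) (i : nat) : int :=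
  if insub i is Some j then v j else 0.

Lemma extz_ord k (v : {ffun 'I_k -> int}) (i : 'I_k) : extz v i = v i.
Proof. by rewrite /extz valK. Qed.

Lemma extz_out k (v : {ffun 'I_k -> int}) i : (k <= i)%N -> extz v i = 0.
Proof. by move=> ki; rewrite /extz insubF // ltnNge ki. Qed.

Definition unitvec k (j : 'I_k) : {ffun 'I_k -> int} := [ffun i => (i == j)%:Z].

Lemma extz_subunit k (v : {ffun 'I_k -> int}) (j : 'I_k) i :
  extz (v - unitvec j) i = extz v i - (i == j :> nat)%:Z.
Proof.
have [ik|ki] := ltnP i k; last by rewrite !extz_out // gtn_eqF // (leq_trans _ ki).
by rewrite -[i]/(nat_of_ord (Ordinal ik)) !extz_ord !ffunE.
Qed.

Lemma wt_subunit k (v : {ffun 'I_k -> int}) (j : 'I_k) : wt (v - unitvec j) = wt v - 1.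
Proof.
rewrite /wt (eq_bigr (fun i => v i - (i == j)%:Z)); last by move=> i _; rewrite !ffunE.
rewrite sumrB; congr (_ - _); rewrite (bigD1 j) //= eqxx big1 // => i /negPf ->.
by [].
Qed.

(** Since [extz] vanishes from k on, this includes nonnegativity. *)
Definition dominant k (v : {ffun 'I_k -> int}) : Prop :=
  forall i : nat, extz v i.+1 <= extz v i.

Lemma dominant_ge0 k (v : {ffun 'I_k -> int}) i : dominant v -> 0 <= extz v i.
Proof.
move=> hv; have h d : extz v (i + d) <= extz v i.
  by elim: d => [|d IH]; rewrite ?addn0 // addnS (le_trans (hv _)).
by have := h k; rewrite extz_out // leq_addl.
Qed.

Lemma dominant_subunit k (v : {ffun 'I_k -> int}) (j : 'I_k) : dominant v ->
  extz v j.+1 < extz v j -> dominant (v - unitvec j).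
Proof.
move=> hv hj i; rewrite !extz_subunit; have := hv i.
by have [->|] := eqVneq i j; have := hj; lia.
Qed.

Section Coefficients.
Variables (K : numFieldType) (t : K).

(** m! times the coefficient of s^m in Q_lambda at p_1 = 1 + s, p_r = 1 for
    r >= 2, with lambda the conjugate of v: differentiating in s lowers one entry
    of v, and s = 0 is the case of one variable equal to 1. *)
Fixpoint gcoef (m k : nat) (v : {ffun 'I_k -> int}) : K :=
  if m is m'.+1 then
    \sum_(j < k) (1 - t ^ (extz v j - extz v j.+1)) * gcoef m' (v - unitvec j)
  else if extz v 0 == 0 then 1 else if extz v 0 == 1 then 1 - t else 0.

Lemma gcoef_eq0 m k (v : {ffun 'I_k -> int}) : dominant v ->
  wt v < m%:Z -> gcoef m v = 0.
Proof.
elim: m v => [|m IH] v hv hm.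
  suff : 0 <= wt v by lia.
  by apply: sumr_ge0 => i _; rewrite -extz_ord dominant_ge0.
rewrite /=; apply: big1 => j _; have := hv j; rewrite le_eqVlt => /orP[/eqP->|hj].
  by rewrite subrr expr0z subrr mul0r.
rewrite IH ?mulr0 //; first exact: dominant_subunit.
by rewrite wt_subunit; lia.
Qed.

Hypothesis t_neq1 : forall i, t ^+ i.+1 != 1.

Definition rowspoly : nat -> {poly K} :=
  newton_seq (fun r => (r.+1%:R^-1)%:P) (HLExistence.gammaP t).

Lemma natmul_polyI r (x y : {poly K}) : r.+1%:R * x = r.+1%:R * y -> x = y.
Proof.
by apply: mulfI; rewrite -(rmorph_nat (@polyC K)) polyC_eq0 pnatr_eq0.
Qed.

Lemma newton_rowspoly : newton (HLExistence.gammaP t) rowspoly.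
Proof.
apply: newton_seqP => r.
by rewrite -(rmorph_nat (@polyC K)) -polyCM mulfV ?pnatr_eq0.
Qed.

Lemma deriv_derivation : derivation (@deriv K).
Proof.
by split=> [a b|a b]; rewrite ?derivD // derivM.
Qed.

Lemma deriv_rowspoly r : (rowspoly r.+1)^`() = (1 - t)%:P * rowspoly r.
Proof.
apply: (newton_derivation natmul_polyI deriv_derivation newton_rowspoly).
  by rewrite /HLExistence.gammaP eqxx derivM derivC derivD derivC derivX; ring.
by move=> a; rewrite /HLExistence.gammaP derivM !derivC; ring.
Qed.

Definition gap k (v : {ffun 'I_k -> int}) (i : nat) : nat :=
  `|extz v i - extz v i.+1|%N.

Lemma gap_remove_box k (v : {ffun 'I_k -> int}) (j : 'I_k) : dominant v ->
  extz v j.+1 < extz v j ->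
  remove_box (gap v) j =1 gap (v - unitvec j).
Proof.
move=> hv hj i; rewrite /remove_box /gap !extz_subunit; have hi := hv i.
have [->|ij] := eqVneq i j; first by rewrite gtn_eqF //; move: hj; lia.
have [e|ij'] := eqVneq i.+1 j; first by move: hi; rewrite e; lia.
by rewrite !subr0.
Qed.

(** The derivation rule for rows [derivation_HLrows] gives 1 - t times the sum over
    all lowered rows, and (1 - t)(1 + ... + t^(m-1)) = 1 - t^m. *)
Lemma deriv_HLpol k (v : {ffun 'I_k -> int}) : dominant v ->
  (HLrows (blocks (gap v) k) t%:P rowspoly)^`() =
  \sum_(j < k) (1 - t ^ (extz v j - extz v j.+1))%:P *
    HLrows (blocks (gap (v - unitvec j)) k) t%:P rowspoly.
Proof.
move=> hv; have q0 : rowspoly 0 = 1 by exact: newton_rowspoly.1.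
rewrite (derivation_HLrows deriv_derivation (c := (1 - t)%:P)) ?blocks_ge1 ?derivC //.
- have := HLrows_decr_blocks t%:P [::] (gap v) k q0.
  under eq_bigr do rewrite cat0s; move=> ->.
  rewrite mulr_sumr; apply: eq_bigr => j _ /=; rewrite mulrA.
  have e : (1 - t)%:P * (\sum_(i < gap v j) t%:P ^+ i) =
      (1 - t ^ (extz v j - extz v j.+1))%:P :> {poly K}.
    rewrite -[extz v j - _]gez0_abs ?subr_ge0 // -exprnP -/(gap v j).
    by rewrite !polyCB rmorphXn /= -opprB mulNr -subrX1 opprB.
  rewrite e; have := hv j; rewrite le_eqVlt => /orP[/eqP->|hj].
    by rewrite subrr expr0z subrr polyC0 !mul0r.
  by rewrite (eq_blocks (fun i _ => gap_remove_box hv hj i)).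
- exact: deriv_rowspoly.
Qed.

(** In a single variable, Q_lambda vanishes when lambda has two rows or more. *)
Lemma HLpol_const k (v : {ffun 'I_k -> int}) : dominant v ->
  (HLrows (blocks (gap v) k) t%:P rowspoly)`_0 =
  if extz v 0 == 0 then 1 else if extz v 0 == 1 then 1 - t else 0.
Proof.
move=> hv; have sz : (size (blocks (gap v) k))%:Z = extz v 0.
  rewrite size_blocks.
  have h n : (\sum_(i < n) gap v i)%N%:Z = extz v 0 - extz v n.
    elim: n => [|n IH]; first by rewrite big_ord0 subrr.
    rewrite big_ord_recr /= PoszD IH /gap; have := hv n; lia.
  by rewrite h (extz_out v (leqnn k)) subr0.
rewrite -sz; have := blocks_ge1 (gap v) k; move: (blocks _ _) => l hl.
rewrite -horner_coef0.
pose x (_ : 'I_1) : K := 1.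
have xI : injective x by move=> i j _; rewrite !ord1.
have x0 i : x i != 0 by rewrite oner_eq0.
have -> : (HLrows l t%:P rowspoly).[0] = HLrows l t (finrows t x).
  rewrite -[LHS]/(horner_eval 0 _); apply: HLrows_morph => [|r].
    by rewrite /= /horner_eval hornerC.
  have natI m (a b : K) : m.+1%:R * a = m.+1%:R * b -> a = b.
    by apply: mulfI; rewrite pnatr_eq0.
  have hq : newton (fun a => (1 - t ^+ a.+1) * \sum_i x i ^+ a.+1)
      (fun r => (rowspoly r).[0]).
    apply: (newton_morph (f := horner_eval 0) _ newton_rowspoly) => a.
    rewrite /= /horner_eval /HLExistence.gammaP hornerM hornerC big_ord1 expr1n.
    by case: eqP => _; rewrite !hornerE.
  exact: (newton_unique natI hq (newton_finrows t xI x0) r).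
case: l hl {sz} => [|r l] //= /andP[r0 hl].
rewrite -/(HLrows (r :: l) t _) HLrows_finrows // big_ord1 expr1n mulr1.
rewrite /rowcoef big_pred0 => [|j]; last by rewrite !ord1 eqxx.
rewrite mulr1; case: l hl => [|r' l] /=; first by rewrite mulr1.
move=> /andP[r'0 _]; rewrite -/(HLrows (r' :: l) t _).
by rewrite (@HLrows_no_variable _ t (fun j => x (lift ord0 j))) ?mulr0.
Qed.

Lemma HLpol_coef m k (v : {ffun 'I_k -> int}) : dominant v ->
  m`!%:R * (HLrows (blocks (gap v) k) t%:P rowspoly)`_m = gcoef m v.
Proof.
elim: m v => [|m IH] v hv; first by rewrite mul1r HLpol_const.
rewrite factS natrM -mulrA mulrCA [X in _ * X]mulr_natl -coef_deriv.
rewrite deriv_HLpol // coef_sum mulr_sumr /=; apply: eq_bigr => j _.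
rewrite coefCM mulrCA; have := hv j; rewrite le_eqVlt => /orP[/eqP->|hj].
  by rewrite subrr expr0z subrr !mul0r.
by rewrite IH //; apply: dominant_subunit.
Qed.

Lemma conjpart_shiftpart k (mu : {ffun 'I_k -> int}) d :
  let v := [ffun i => mu i - d] in dominant v ->
  conjpart (shiftpart mu d) = blocks (gap v) k.
Proof.
move=> v hv; have -> : shiftpart mu d = mkseq (fun i => `|extz v i|%N) k.
  rewrite /shiftpart /mkseq -val_enum_ord -map_comp; apply: eq_map => i /=.
  by rewrite extz_ord ffunE.
rewrite conjpart_blocks ?extz_out // => [|i].
  apply: eq_blocks => i _; rewrite /gap.
  by have := hv i; have := dominant_ge0 i hv; have := dominant_ge0 i.+1 hv; lia.
by have := hv i; have := dominant_ge0 i hv; have := dominant_ge0 i.+1 hv; lia.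
Qed.

Theorem HLQ_gamma_alpha_expansion k (mu : {ffun 'I_k -> int}) d tau N :
  let v := [ffun i => mu i - d] in dominant v -> wt v < N%:Z ->
  HallLittlewood.HLQ_gamma_alpha t tau (conjpart (shiftpart mu d)) =
  \sum_(m < N) (tau / (1 - t)) ^+ m / m`!%:R * gcoef m v.
Proof.
move=> v hv hN; rewrite conjpart_shiftpart //.
rewrite (HLExistence.HLQ_gamma_alpha_rows t_neq1 tau newton_rowspoly); last first.
  exact: blocks_ge1.
set p := HLrows _ _ _.
have fact0 m : m`!%:R != 0 :> K by rewrite pnatr_eq0 -lt0n fact_gt0.
have szp : (size p <= N)%N.
  apply/leq_sizeP => m Nm; apply: (mulfI (fact0 m)).
  rewrite mulr0 HLpol_coef // gcoef_eq0 //; apply: (lt_le_trans hN); by rewrite lez_nat.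
rewrite (horner_coef_wide _ szp); apply: eq_bigr => m _.
by rewrite -HLpol_coef // -/p [RHS]mulrA divfK // mulrC.
Qed.
End Coefficients.

From mathcomp Require Import all_classical.

(** * Finitely supported sums over integer vectors *)

Section Box.
Variables (K : numFieldType) (k : nat).
Implicit Types (F : {ffun 'I_k -> int} -> K).

(** Enumerates the box [-N, N]^k; the sums over all integer vectors below are
    turned into finite sums with it. *)
Definition of_box N (f : {ffun 'I_k -> 'I_(N + N).+1}) : {ffun 'I_k -> int} :=
  [ffun i => (f i)%:Z - N%:Z].

Definition in_box N (v : {ffun 'I_k -> int}) : Prop :=
  forall i, - N%:Z <= v i <= N%:Z.

Lemma of_box_inj N : injective (@of_box N).
Proof.
move=> f g /ffunP e; apply/ffunP => i; apply: val_inj => /=.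
by have := e i; rewrite !ffunE; lia.
Qed.

Lemma in_boxP N v : in_box N v -> exists f, v = @of_box N f.
Proof.
move=> h; have hi i : (absz (v i + N%:Z)%R < (N + N).+1)%N by have := h i; lia.
exists [ffun i => Ordinal (hi i)]; apply/ffunP => i.
by rewrite !ffunE /=; have := h i; lia.
Qed.

Lemma fsum_box N F (A : set {ffun 'I_k -> int}) :
  (forall v, F v != 0 -> in_box N v) -> (forall v, F v != 0 -> A v) ->
  \sum_(v \in A) F v = \sum_f F (@of_box N f).
Proof.
move=> h1 h2.
have -> : \sum_(v \in A) F v = \sum_(v \in [set: {ffun 'I_k -> int}]) F v.
  apply: fsbig_widen => // v [_ nA] /=.
  by apply/eqP; apply: contra_notT nA => /h2.
rewrite (@fsbigE _ _ _ _ _ (map (@of_box N) (index_enum _))) //.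
- by rewrite big_map; apply: eq_bigl => f; rewrite in_setT.
- by rewrite map_inj_uniq ?index_enum_uniq //; exact: of_box_inj.
- move=> v _ nv; apply/eqP; apply: contraNT nv => /h1 /in_boxP [f ->].
  by apply: map_f; rewrite mem_index_enum.
Qed.

Lemma fsum_shift F u :
  \sum_(v \in [set: {ffun 'I_k -> int}]) F v =
  \sum_(v \in [set: {ffun 'I_k -> int}]) F (v + u).
Proof.
rewrite (@reindex_fsbigT _ _ _ _ _ (fun v => v + u)) //.
by exists (fun v => v - u) => v; rewrite ?addrK ?subrK.
Qed.
End Box.

Lemma prod_update (K : comNzRingType) (I : finType) (F G : I -> K) (j : I) c :
  G j = c * F j -> (forall i, i != j -> G i = F i) ->
  \prod_i G i = c * \prod_i F i.
Proof.
move=> h1 h2; rewrite (bigD1 j) //= h1 [X in _ = _ * X](bigD1 j) //= mulrA.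
by congr (_ * _); apply: eq_bigr.
Qed.

(** * The weights of the limit law *)

(** The binomial coefficient z choose 2 for an arbitrary integer z. *)
Definition tri (z : int) : int := ((z * (z - 1)) %/ 2)%Z.

Lemma tri_sub1 z : tri (z - 1) = tri z - (z - 1).
Proof.
rewrite /tri; have -> : (z - 1) * (z - 1 - 1) = (1 - z) * 2 + z * (z - 1) by ring.
by rewrite divzMDl //; ring.
Qed.

Lemma tri_nat n : tri n%:Z = 'C(n, 2)%:Z.
Proof.
elim: n => [|n IH]; first by rewrite /tri mul0r div0z.
by rewrite binS bin1 PoszD -IH; have := tri_sub1 n.+1; rewrite -addn1 PoszD addrK; lia.
Qed.

Lemma extz_addunit n (w : {ffun 'I_n -> int}) (j : 'I_n) i :
  extz (w + unitvec j) i = extz w i + (i == j :> nat)%:Z.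
Proof.
by have := extz_subunit (w + unitvec j) j i; rewrite addrK => ->; rewrite subrK.
Qed.

Lemma wt_addunit n (w : {ffun 'I_n -> int}) (j : 'I_n) : wt (w + unitvec j) = wt w + 1.
Proof. by have := wt_subunit (w + unitvec j) j; rewrite addrK => ->; rewrite subrK. Qed.

Section Weight.
Variables (K : numFieldType) (t : K).
Hypothesis t0 : t != 0.
Hypothesis t_neq1 : forall i, t ^+ i.+1 != 1.

(** 1 / (t; t)_z, with the value 0 for z < 0 under which the recursion [ip_sub1]
    holds for all integers; it makes [weight] vanish off interlacing vectors. *)
Definition ip (z : int) : K := if z is Posz m then (qpoch t t m)^-1 else 0.

Lemma ip_sub1 z : ip (z - 1) = (1 - t ^ z) * ip z.
Proof.
case: z => [[|m]|m]; first by rewrite expr0z subrr mul0r.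
  have -> : m.+1%:Z - 1 = m%:Z by lia.
  rewrite /= /qpoch big_ord_recr /= -exprS -exprnP invfM mulrCA mulfV ?mulr1 //.
  by rewrite subr_eq0 eq_sym t_neq1.
have -> : Negz m - 1 = Negz m.+1 by lia.
by rewrite mulr0.
Qed.

Variable k : nat.
Implicit Types (th : {ffun 'I_k.+1 -> int}) (v : {ffun 'I_k -> int}).

Definition weight th v : K :=
  (-1) ^ (wt th - wt v) *
  ((\prod_(i < k.+1) t ^ tri (th i)) *
   ((\prod_(i < k.+1) ip (extz th i - extz v i)) *
    \prod_(i < k) ip (extz v i - extz th i.+1))).

(** The two moves of the j-th gap, v_j |-> v_j + 1 and th_(j+1) |-> th_(j+1) - 1,
    are both multiples of this common quantity. *)
Definition weight_gap th v (j : 'I_k) : K :=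
  (-1) ^ (wt th - wt v) *
  ((\prod_(i < k.+1) t ^ tri (th i)) *
   ((\prod_(i < k.+1) ip (extz th i - extz v i)) *
    \prod_(i < k) ip (extz v i - extz th i.+1 + (i == j)%:Z))).

Lemma sign_sub1 (z : int) : (-1) ^ (z - 1) = - (-1) ^ z :> K.
Proof. by rewrite expfzDr ?oppr_eq0 ?oner_eq0 // -[X in _ * X]/(((-1) : K)^-1) invrN1 mulrN1. Qed.

Lemma weight_gapE th v (j : 'I_k) :
  weight th v = (1 - t ^ (extz v j - extz th j.+1 + 1)) * weight_gap th v j.
Proof.
rewrite /weight /weight_gap.
have -> : \prod_(i < k) ip (extz v i - extz th i.+1) =
    (1 - t ^ (extz v j - extz th j.+1 + 1)) *
    \prod_(i < k) ip (extz v i - extz th i.+1 + (i == j)%:Z).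
  apply: (@prod_update _ _ _ _ j) => [|i /negPf->]; last by rewrite addr0.
  by rewrite eqxx -ip_sub1 addrK.
ring.
Qed.

Lemma weight_addunit th v (j : 'I_k) :
  weight th (v + unitvec j) = - (1 - t ^ (extz th j - extz v j)) * weight_gap th v j.
Proof.
rewrite /weight /weight_gap wt_addunit opprD addrA sign_sub1.
have -> : \prod_(i < k.+1) ip (extz th i - extz (v + unitvec j) i) =
    (1 - t ^ (extz th j - extz v j)) * \prod_(i < k.+1) ip (extz th i - extz v i).
  apply: (@prod_update _ _ _ _ (widen_ord (leqnSn k) j)) => [|i].
    by rewrite /= extz_addunit eqxx -ip_sub1 opprD addrA.
  by rewrite -val_eqE /= extz_addunit => /negPf->; rewrite addr0.
rewrite [\prod_(i < k) ip (extz (v + _) i - _)](eq_bigr (fun i : 'I_k =>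
  ip (extz v i - extz th i.+1 + (i == j)%:Z))); first by ring.
by move=> i _; rewrite extz_addunit addrAC.
Qed.

Lemma tri_subunit th (i : 'I_k.+1) :
  \prod_(l < k.+1) t ^ tri ((th - unitvec i) l) =
  t ^ (- (th i - 1)) * \prod_(l < k.+1) t ^ tri (th l).
Proof.
apply: (@prod_update _ _ _ _ i) => [|l li]; rewrite !ffunE ?eqxx.
  by rewrite tri_sub1 addrC expfzDr.
by rewrite (negPf li) subr0.
Qed.

Lemma ip_subunit th v (i : 'I_k.+1) :
  \prod_(l < k.+1) ip (extz (th - unitvec i) l - extz v l) =
  (1 - t ^ (extz th i - extz v i)) * \prod_(l < k.+1) ip (extz th l - extz v l).
Proof.
apply: (@prod_update _ _ _ _ i) => [|l li]; rewrite extz_subunit.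
  by rewrite eqxx -ip_sub1 addrAC.
by rewrite (inj_eq val_inj) (negPf li) subr0.
Qed.

Lemma weight_subunit0 th v :
  weight (th - unitvec ord0) v =
  - t ^ (- (extz th 0 - 1)) * (1 - t ^ (extz th 0 - extz v 0)) * weight th v.
Proof.
rewrite /weight wt_subunit tri_subunit ip_subunit addrAC sign_sub1.
rewrite -[th ord0]extz_ord /=.
rewrite [\prod_(i < k) ip (_ - extz (th - _) i.+1)](eq_bigr (fun i : 'I_k =>
  ip (extz v i - extz th i.+1))); first by ring.
by move=> i _; rewrite extz_subunit subr0.
Qed.

Lemma weight_subunitS th v (j : 'I_k) :
  weight (th - unitvec (lift ord0 j)) v =
  - t ^ (- (extz th j.+1 - 1)) * (1 - t ^ (extz th j.+1 - extz v j.+1)) * weight_gap th v j.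
Proof.
rewrite /weight /weight_gap wt_subunit tri_subunit ip_subunit addrAC sign_sub1.
rewrite -[th (lift _ _)]extz_ord /=.
rewrite [\prod_(i < k) ip (_ - extz (th - _) i.+1)](eq_bigr (fun i : 'I_k =>
  ip (extz v i - extz th i.+1 + (i == j)%:Z))); first by ring.
by move=> i _; rewrite extz_subunit /= eqSS opprB addrCA addrC.
Qed.

End Weight.

(** * The transfer operator *)

Section Transfer.
Variables (K : numFieldType) (t : K).
Variable k : nat.
Implicit Types (th : {ffun 'I_k.+1 -> int}) (v : {ffun 'I_k -> int}).
Implicit Types h : {ffun 'I_k.+1 -> int} -> K.

(** t^(th_(i-1)), with th_(-1) = +oo. *)
Definition prevpow th (i : nat) : K := if i is i'.+1 then t ^ extz th i' else 0.

(** The forward operator of the chain of rank drops; see [step_point_mass]. *)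
Definition transfer h th : K :=
  (1 - t ^ extz th k) * h th +
  \sum_(i < k.+1) (t ^ (extz th i - 1) - prevpow th i) * h (th - unitvec i).

Hypothesis t0 : t != 0.
Hypothesis t_neq1 : forall i, t ^+ i.+1 != 1.

(** With A_j = t^(th_j - v_j), every summand of the difference is a multiple of
    [weight] by a combination of A_j, A_(j+1) and the gap factors; the terms
    A_j - A_(j+1) telescope. *)
Lemma weight_transfer th v :
  \sum_(j < k) (1 - t ^ (extz (v + unitvec j) j - extz (v + unitvec j) j.+1)) *
      weight t th (v + unitvec j) =
  transfer (fun x => weight t x v) th.
Proof.
rewrite /transfer [X in _ = _ + X]big_ord_recl -[prevpow th ord0]/0 subr0 weight_subunit0 //.
pose A (i : nat) := t ^ (extz th i - extz v i).
pose B (i : nat) := t ^ (extz v i - extz th i.+1 + 1).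
pose W := weight t th v; rewrite -/W -/(A 0%N).
have Ak : t ^ extz th k = A k by rewrite /A [extz v k]extz_out // subr0.
have tel : \sum_(j < k) (A j - A j.+1) = A 0%N - A k.
  by elim: (k) => [|n IH]; rewrite ?big_ord0 ?subrr // big_ord_recr /= IH addrA subrK.
have -> : t ^ (extz th ord0 - 1) * (- t ^ (- (extz th 0 - 1)) * (1 - A 0%N) * W) =
    - (1 - A 0%N) * W.
  have e : t ^ (extz th 0 - 1) * t ^ (- (extz th 0 - 1)) = 1.
    by rewrite -expfzDr // subrr expr0z.
  transitivity (- (t ^ (extz th 0 - 1) * t ^ (- (extz th 0 - 1))) * (1 - A 0%N) * W).
    by rewrite /=; ring.
  by rewrite e; ring.
have -> : \sum_(i < k) (t ^ (extz th (lift ord0 i) - 1) - prevpow th (lift ord0 i)) *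
      weight t (th - unitvec (lift ord0 i)) v =
    \sum_(j < k) - (1 - A j.+1) * (1 - A j * B j) * weight_gap t th v j.
  apply: eq_bigr => j _; rewrite weight_subunitS //= -/(A j.+1).
  have -> : A j * B j = t ^ (extz th j) * t ^ (- (extz th j.+1 - 1)).
    by rewrite /A /B -!expfzDr //; congr (_ ^ _); ring.
  have e : t ^ (extz th j.+1 - 1) * t ^ (- (extz th j.+1 - 1)) = 1.
    by rewrite -expfzDr // subrr expr0z.
  move: e; set T := t ^ (extz th j.+1 - 1); set T1 := t ^ (- _) => e.
  transitivity (- (1 - A j.+1) * (T * T1 - t ^ extz th j * T1) * weight_gap t th v j).
    by ring.
  by rewrite e.
rewrite Ak addrA -mulrDl.
have -> : 1 - A k + - (1 - A 0%N) = A 0%N - A k by ring.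
rewrite -tel mulr_suml -big_split; apply: eq_bigr => j _ /=.
rewrite weight_addunit // -/(A j) !extz_addunit eqxx gtn_eqF // addr0.
have -> : t ^ (extz v j + true%:Z - extz v j.+1) = A j.+1 * B j.
  by rewrite /A /B -expfzDr //; congr (_ ^ _) => /=; ring.
by rewrite /W (weight_gapE t0 t_neq1 th v j) -/(B j); ring.
Qed.

Lemma weight_support th v : weight t th v != 0 ->
  [/\ 0 <= extz th k, (forall i : 'I_k, extz th i.+1 <= extz v i)
    & forall i : 'I_k, extz v i <= extz th i].
Proof.
have ipN z : ip t z != 0 -> 0 <= z by case: z => // n; rewrite eqxx.
rewrite /weight !mulf_eq0 !negb_or => /andP[_ /andP[_ /andP[/prodf_neq0 ha /prodf_neq0 hb]]].
split=> [|i|i].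
- by have /ipN := ha ord_max isT; rewrite /= [extz v k]extz_out // subr0.
- by have /ipN := hb i isT; rewrite subr_ge0.
- by have /ipN := ha (widen_ord (leqnSn k) i) isT; rewrite subr_ge0.
Qed.

Lemma weight_dominant th v : weight t th v != 0 -> dominant th /\ dominant v.
Proof.
move=> /weight_support [h0 h1 h2].
have h1' i : (i < k)%N -> extz th i.+1 <= extz v i by move=> ik; apply: (h1 (Ordinal ik)).
have h2' i : (i < k)%N -> extz v i <= extz th i by move=> ik; apply: (h2 (Ordinal ik)).
split=> i.
  have [ik|] := ltnP i k; first exact: le_trans (h1' _ ik) (h2' _ ik).
  rewrite leq_eqVlt => /orP[/eqP<-|ki]; first by rewrite [extz th k.+1]extz_out.
  by rewrite !extz_out // ltnW.
have [ik|ki] := ltnP i.+1 k; first exact: le_trans (h2' _ ik) (h1' _ (ltnW ik)).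
rewrite [extz v i.+1]extz_out //.
have [ik|ik] := ltnP i k; last by rewrite extz_out.
apply: le_trans (h1' _ ik); have -> : i.+1 = k by apply/eqP; rewrite eqn_leq ik.
by [].
Qed.

Lemma dominant_le n (w : {ffun 'I_n -> int}) i j : dominant w -> (i <= j)%N ->
  extz w j <= extz w i.
Proof.
move=> hw ij; rewrite -(subnKC ij); elim: (j - i)%N => [|d IH]; first by rewrite addn0.
by rewrite addnS; apply: le_trans IH.
Qed.

Definition wsum (m : nat) th : K :=
  \sum_(v \in [set: {ffun 'I_k -> int}]) weight t th v * gcoef t m v.

Lemma weight_in_box N th v : (forall i, `|extz th i| <= N%:Z) ->
  weight t th v != 0 -> in_box N v.
Proof.
move=> hN /weight_support [_ h1 h2] i.
have := h1 i; have := h2 i; have := hN i; have := hN i.+1; rewrite (extz_ord v); lia.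
Qed.

Lemma extz_bound n (w : {ffun 'I_n -> int}) : exists N, forall i, `|extz w i| <= N%:Z.
Proof.
exists (\max_(i < n) absz (w i))%N => i.
have [ik|ki] := ltnP i n; last by rewrite extz_out // normr0.
by rewrite -[i]/(nat_of_ord (Ordinal ik)) extz_ord -abszE lez_nat; apply: leq_bigmax.
Qed.

Lemma wsum_box N m th : (forall i, `|extz th i| <= N%:Z) ->
  wsum m th = \sum_f (weight t th (@of_box k N f)) * gcoef t m (of_box f).
Proof.
move=> hN; apply: (fsum_box (F := fun v => weight t th v * gcoef t m v)) => // v.
by rewrite mulf_eq0 negb_or => /andP[/(weight_in_box hN)].
Qed.

(** The recursion for [gcoef] removes a box from v; after a change of summation
    index the box is added to v in [weight], where it is exchanged for the
    transfer operator in th [weight_transfer]. *)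
Lemma wsumS m th : wsum m.+1 th = transfer (wsum m) th.
Proof.
have [N0 hN0] := extz_bound th; pose N := N0.+1.
have hN i : `|extz th i| <= N%:Z by rewrite (le_trans (hN0 i)) // lez_nat.
have hNs (j : 'I_k.+1) i : `|extz (th - unitvec j) i| <= N%:Z.
  by have := hN0 i; rewrite extz_subunit /N; case: eqP => _ /=; lia.
transitivity (\sum_f transfer (fun x => weight t x (@of_box k N f)) th *
    gcoef t m (of_box f)); last first.
  rewrite {2}/transfer (wsum_box _ hN).
  have -> : \sum_(i < k.+1) (t ^ (extz th i - 1) - prevpow th i) * wsum m (th - unitvec i) =
     \sum_f \sum_(i < k.+1) (t ^ (extz th i - 1) - prevpow th i) *
       weight t (th - unitvec i) (@of_box k N f) * gcoef t m (of_box f).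
    rewrite exchange_big; apply: eq_bigr => i _; rewrite (wsum_box _ (hNs i)) mulr_sumr.
    by apply: eq_bigr => f _; rewrite mulrA.
  rewrite mulr_sumr -big_split; apply: eq_bigr => f _ /=.
  by rewrite -mulr_suml mulrA -mulrDl.
rewrite (wsum_box _ hN) /=.
under eq_bigr do rewrite mulr_sumr.
under [RHS]eq_bigr do rewrite -weight_transfer mulr_suml.
rewrite exchange_big [RHS]exchange_big; apply: eq_bigr => j _ /=.
pose c v := (1 - t ^ (extz v j - extz v j.+1)).
transitivity (\sum_(v \in [set: {ffun 'I_k -> int}])
    weight t th v * (c v * gcoef t m (v - unitvec j))).
  symmetry; apply: (fsum_box (F := fun v => weight t th v * (c v * gcoef t m (v - unitvec j)))) => // v.
  by rewrite mulf_eq0 negb_or => /andP[/(weight_in_box hN)].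
rewrite (fsum_shift _ (unitvec j)).
transitivity (\sum_(v \in [set: {ffun 'I_k -> int}])
    c (v + unitvec j) * weight t th (v + unitvec j) * gcoef t m v).
  by apply: eq_fsbigr => v _; rewrite addrK; ring.
apply: (fsum_box (F := fun v => c (v + unitvec j) * weight t th (v + unitvec j) * gcoef t m v)) => // v.
move=> hF i; have h0 : weight t th (v + unitvec j) != 0.
  by apply: contraNneq hF => ->; rewrite mulr0 mul0r.
by have := weight_in_box hN0 h0 i; rewrite !ffunE /N; case: eqP => _ /=; lia.
Qed.
End Transfer.

(** * The initial signed measure *)

Definition constvec n (d : int) : {ffun 'I_n -> int} := [ffun=> d].

Section Initial.
Variables (K : numFieldType) (t : K).
Hypothesis t0 : t != 0.
Hypothesis t_neq1 : forall i, t ^+ i.+1 != 1.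

(** The coefficients of Euler's expansion of (t; t)_oo. *)
Definition startcoef (e : nat) : K := (-1) ^+ e * t ^+ 'C(e.+1, 2) / qpoch t t e.

Definition startvec k (e : int) : {ffun 'I_k.+1 -> int} :=
  [ffun i => if i == ord0 then e else 0].

Definition start k (th : {ffun 'I_k.+1 -> int}) : K :=
  if extz th 0 is Posz e then
    if th == startvec k e%:Z then startcoef e else 0
  else 0.

Lemma start_startvec k e : start (startvec k e%:Z) = startcoef e.
Proof. by rewrite /start -[0%N]/(nat_of_ord (@ord0 k)) extz_ord ffunE eqxx eqxx. Qed.

Lemma sum_box1 N (a : int) (G : int -> K) : `|a| <= N%:Z ->
  (forall z, z != a -> G z = 0) -> \sum_(z < (N + N).+1) G (z%:Z - N%:Z) = G a.
Proof.
move=> ha hG; have h : (absz (a + N%:Z)%R < (N + N).+1)%N by lia.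
rewrite (bigD1 (Ordinal h)) //= big1 ?addr0; first by congr G; lia.
move=> z; rewrite -val_eqE /= => hz; apply: hG; apply: contraNneq hz => e; lia.
Qed.

Lemma sum_box2 N (G : int -> K) : (0 < N)%N ->
  (forall z, z != 0 -> z != 1 -> G z = 0) ->
  \sum_(z < (N + N).+1) G (z%:Z - N%:Z) = G 0 + G 1.
Proof.
move=> N0 hG.
have e0 := @sum_box1 N 0 (fun z => if z == 0 then G z else 0); rewrite eqxx in e0.
have e1 := @sum_box1 N 1 (fun z => if z == 1 then G z else 0); rewrite eqxx in e1.
rewrite -{}e0 ?normr0 // => [|z /negPf-> //].
rewrite -{}e1 ?normr1 ?lez_nat // => [|z /negPf-> //].
rewrite -big_split; apply: eq_bigr => z _ /=; move: (_ - _) => y.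
have [->|y0] := eqVneq y 0; first by rewrite addr0.
by rewrite add0r; case: eqVneq => // y1; apply: hG.
Qed.

Section Factor.
Variables (k : nat) (th : {ffun 'I_k.+2 -> int}).

Definition rowfactor (i : nat) (z : int) : K :=
  (-1) ^ z * ip t (extz th i - z) * ip t (z - extz th i.+1) *
  (if i == 0%N then (if z == 0 then 1 else if z == 1 then 1 - t else 0) else 1).

(** For m = 0 the summand is a product over the coordinates of v, and so is the
    sum. *)
Lemma wsum0_factor N : (forall i, `|extz th i| <= N%:Z) ->
  wsum t 0 th = (-1) ^ wt th * (\prod_(i < k.+2) t ^ tri (th i)) * ip t (extz th k.+1) *
    \prod_(i < k.+1) \sum_(z < (N + N).+1) rowfactor i (z%:Z - N%:Z).
Proof.
move=> hN; have := bigA_distr_bigA (fun (i : 'I_k.+1) (z : 'I_(N + N).+1) => rowfactor i (z%:Z - N%:Z)).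
move=> -> /=; rewrite (wsum_box t0 _ hN) mulr_sumr /=.
apply: eq_bigr => f _; set v := of_box f.
have vE i : (f i)%:Z - N%:Z = extz v i by rewrite extz_ord ffunE.
rewrite [X in _ = _ * X](eq_bigr (fun i : 'I_k.+1 => rowfactor i (extz v i))); last first.
  by move=> i _; rewrite vE.
rewrite /weight.
have -> : \prod_(i < k.+2) ip t (extz th i - extz v i) =
    (\prod_(i < k.+1) ip t (extz th i - extz v i)) * ip t (extz th k.+1).
  by rewrite big_ord_recr /= [extz v k.+1]extz_out // subr0.
have -> : \prod_(i < k.+1) rowfactor i (extz v i) =
    (\prod_(i < k.+1) (-1) ^ extz v i) *
    (\prod_(i < k.+1) ip t (extz th i - extz v i)) *
    (\prod_(i < k.+1) ip t (extz v i - extz th i.+1)) * gcoef t 0 v.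
  rewrite /rowfactor !big_split; congr (_ * _ * _ * _).
  by rewrite big_ord_recl big1 //= mulr1.
have -> : \prod_(i < k.+1) (-1) ^ extz v i = (-1) ^ (- wt v) :> K.
  rewrite -exprz_inv invrN1 /wt.
  rewrite (big_morph (fun z => (-1 : K) ^ z) (id1 := 1) (op1 := *%R)) //.
    by apply: eq_bigr => i _; rewrite extz_ord.
  by move=> x y; rewrite expfzDr // oppr_eq0 oner_eq0.
rewrite expfzDr ?oppr_eq0 ?oner_eq0 //.
rewrite -/(gcoef t 0 v).
set w := gcoef t 0 v; set a := (-1) ^ wt th; set b := (-1) ^ (- wt v); ring.
Qed.
End Factor.

Lemma ip0 : ip t 0 = 1.
Proof. by rewrite /= /qpoch big_ord0 invr1. Qed.

Lemma ip1 : ip t 1 = (1 - t)^-1.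
Proof. by rewrite /= /qpoch big_ord1 expr0 mulr1. Qed.

Lemma ip_neg z : z < 0 -> ip t z = 0.
Proof. by case: z. Qed.

Lemma onem_neq0 : 1 - t != 0.
Proof. by rewrite subr_eq0 eq_sym -(expr1 t). Qed.

Lemma startcoefE e : startcoef e = (-1) ^ e%:Z * (t ^ tri e%:Z * t ^ e%:Z) * ip t e%:Z.
Proof. by rewrite /startcoef tri_nat binS bin1 exprD -!exprnP. Qed.

Lemma startcoef_pred e :
  (-1) ^ e.+1%:Z * t ^ tri e.+1%:Z * ip t e%:Z = - startcoef e.
Proof. by rewrite /startcoef tri_nat -!exprnP [(-1) ^+ e.+1]exprS mulN1r !mulNr. Qed.

Lemma start_neq0 k (th : {ffun 'I_k.+1 -> int}) : start th != 0 ->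
  0 <= extz th 0 /\ forall i : nat, extz th i.+1 = 0.
Proof.
rewrite /start; case E : (extz th 0) => [e|e]; last by rewrite eqxx.
case: (th =P startvec k e%:Z) => [->|_]; last by rewrite eqxx.
move=> _; split=> // i; have [ik|?] := ltnP i.+1 k.+1; last by rewrite extz_out.
by rewrite -[i.+1]/(nat_of_ord (Ordinal ik)) extz_ord ffunE.
Qed.

Lemma startP k (th : {ffun 'I_k.+1 -> int}) e : extz th 0 = e%:Z ->
  (forall i : nat, extz th i.+1 = 0) -> start th = startcoef e.
Proof.
move=> h0 h; suff -> : th = startvec k e%:Z by rewrite start_startvec.
apply/ffunP => i; rewrite ffunE -extz_ord -val_eqE /=.
by case: (nat_of_ord i).
Qed.

Lemma extz_subconst n (w : {ffun 'I_n -> int}) d i : (i < n)%N ->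
  extz (w - constvec n d) i = extz w i - d.
Proof. by move=> ik; rewrite -[i]/(nat_of_ord (Ordinal ik)) !extz_ord !ffunE. Qed.

(** In the product of [wsum0_factor], the factors i >= 1 vanish when
    (th_i, th_(i+1)) = (1, 0), and the factor i = 0 vanishes when th_1 >= 2.  Of
    the dominant vectors there remain (e, 0, ..., 0) and (e, 1, ..., 1), which
    carry the two terms of the right-hand side. *)
Lemma wsum0_dominant k (th : {ffun 'I_k.+1 -> int}) : dominant th ->
  wsum t 0 th = start th - start (th - constvec _ 1).
Proof.
move=> hth.
have h00 : 0 <= extz th 0 by exact: dominant_ge0.
case: k th hth h00 => [|k] th hth h00.
  have hN := extz_bound th; case: hN => N hN.
  rewrite (wsum_box t0 _ hN) (bigD1 [ffun=> ord0]) //= big1 ?addr0; last first.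
    by move=> f; case/eqP; apply/ffunP => -[].
  rewrite [extz (of_box _) 0]extz_out // eqxx mulr1 /weight big_ord0 mulr1 !big_ord1.
  rewrite [wt (of_box _)]/wt big_ord0 subr0 [extz (of_box _) _]extz_out // subr0.
  have -> : wt th = extz th 0 by rewrite /wt big_ord1 -extz_ord.
  rewrite -(extz_ord th ord0) /=.
  case E : (extz th 0) h00 => [e|//] _.
  have z i : extz th i.+1 = 0 by rewrite extz_out.
  rewrite (startP E z); case: e E => [|e] E.
    rewrite startcoefE expr0z mulr1 [start (th - _)](_ : _ = 0) ?subr0 ?mulrA //.
    apply/eqP; apply: contraT => /start_neq0 [] ; rewrite extz_subconst // E.
    by [].
  have E1 : extz (th - constvec 1 1) 0 = e%:Z by rewrite extz_subconst // E; lia.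
  rewrite (startP E1) => [|i]; last by rewrite extz_out.
  rewrite -startcoef_pred startcoefE.
  have -> : ip t e%:Z = (1 - t ^ e.+1%:Z) * ip t e.+1%:Z.
    by rewrite -ip_sub1 //; congr ip; lia.
  ring.
have [N0 hN0] := extz_bound th; pose N := N0.+1.
have hN i : `|extz th i| <= N%:Z by rewrite (le_trans (hN0 i)) // lez_nat.
rewrite (wsum0_factor hN).
set C := (-1) ^ wt th * _; set Sm := fun i : nat => \sum_(z < (N + N).+1) rowfactor th i (z%:Z - N%:Z).
rewrite -/(C) [X in C * _ * X](_ : _ = \prod_(i < k.+1) Sm i) // big_ord_recl.
have S0 : Sm 0%N = ip t (extz th 0) * ip t (- extz th 1) -
    (1 - t) * ip t (extz th 0 - 1) * ip t (1 - extz th 1).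
  rewrite /Sm (sum_box2 (G := rowfactor th 0)) //; last first.
    by move=> z /negPf z0 /negPf z1; rewrite /rowfactor z0 z1 /= mulr0.
  rewrite /rowfactor /= expr0z expr1z subr0 sub0r; ring.
have Sconst i : extz th i.+1 = extz th i -> (0 < i)%N -> Sm i = (-1) ^ extz th i.
  move=> e i0; rewrite /Sm (sum_box1 (a := extz th i) (G := rowfactor th i)) //.
    by rewrite /rowfactor e subrr ip0 !mulr1 gtn_eqF // mulr1.
  move=> z ze; rewrite /rowfactor e.
  have [h|h|h] := ltgtP z (extz th i).
  - by rewrite [ip t (z - _)]ip_neg ?subr_lt0 // mulr0 mul0r.
  - by rewrite [ip t (_ - z)]ip_neg ?subr_lt0 // mulr0 !mul0r.
  - by rewrite h eqxx in ze.
have Sjump i : extz th i = 1 -> extz th i.+1 = 0 -> (0 < i)%N -> Sm i = 0.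
  move=> e1 e0 i0; rewrite /Sm (sum_box2 (G := rowfactor th i)) //.
    rewrite /rowfactor e1 e0 gtn_eqF // !subr0 !subrr expr0z expr1z; ring.
  move=> z z0 z1; rewrite /rowfactor e1 e0.
  have [h|h] := ltP z 0; first by rewrite [ip t (z - _)]ip_neg ?subr0 // mulr0 mul0r.
  by rewrite [ip t (_ - z)]ip_neg ?mulr0 ?mul0r //; lia.
case E : (extz th 0) h00 => [e|//] _.
have [h1|h1] := eqVneq (extz th 1) 0.
  have z i : extz th i.+1 = 0.
    apply/eqP; rewrite eq_le dominant_ge0 // andbT -h1.
    by apply: dominant_le.
  rewrite (startP E z) [start (th - _)](_ : _ = 0); last first.
    apply/eqP; apply: contraT => /start_neq0 [_ /(_ 0%N)]; rewrite extz_subconst // h1.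
    by [].
  rewrite subr0 big1 => [|i _]; last by rewrite Sconst ?z ?expr0z.
  rewrite mulr1 S0 E h1 oppr0 subr0 ip0 ip1 z ip0 /C mulr1.
  have -> : wt th = e%:Z.
    by rewrite /wt big_ord_recl -extz_ord E big1 ?addr0 // => i _; rewrite -extz_ord z.
  have -> : \prod_(i < k.+2) t ^ tri (th i) = t ^ tri e%:Z.
    rewrite big_ord_recl -extz_ord E big1 ?mulr1 // => i _.
    by rewrite -extz_ord z /tri mul0r div0z expr0z.
  rewrite startcoefE ip_sub1 //; have h := onem_neq0.
  have -> : ip t e%:Z - (1 - t) * ((1 - t ^ e%:Z) * ip t e%:Z) * (1 - t)^-1 =
     t ^ e%:Z * ip t e%:Z.
    by rewrite [(1 - t) * _ / _]mulrAC mulfV //; ring.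
  by ring.
have sz : start th = 0.
  apply/eqP; apply: contraT => /start_neq0 [_ /(_ 0%N)] h; by rewrite h eqxx in h1.
have h1p : 0 < extz th 1 by rewrite lt_neqAle eq_sym h1 dominant_ge0.
rewrite sz sub0r.
have [h2|h2] := eqVneq (extz th 1) 1; last first.
  have -> : start (th - constvec k.+2 1) = 0.
    apply/eqP; apply: contraT => /start_neq0 [_ /(_ 0%N)]; rewrite extz_subconst //.
    by move=> /eqP; rewrite subr_eq0 (negPf h2).
  have n1 : - extz th 1 < 0 by lia.
  have n2 : 1 - extz th 1 < 0 by lia.
  by rewrite S0 (ip_neg n1) (ip_neg n2) !mulr0 subrr mul0r mulr0 oppr0.
have h01 i : extz th i.+1 = 0 \/ extz th i.+1 = 1.
  have := @dominant_ge0 _ th i.+1 hth; have : extz th i.+1 <= extz th 1 by exact: dominant_le.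
  rewrite h2; lia.
have [hall|hall] := boolP [forall i : 'I_k.+1, extz th i.+1 == 1].
  have z i : (i < k.+1)%N -> extz th i.+1 = 1.
    by move=> ik; apply/eqP; have /forallP/(_ (Ordinal ik)) := hall.
  have e0 : (0 < e)%N by have := hth 0%N; rewrite E h2; lia.
  case: e e0 E => // e _ E.
  have E1 : extz (th - constvec k.+2 1) 0 = e%:Z by rewrite extz_subconst // E; lia.
  rewrite (startP E1) => [|i]; last first.
    have [ik|ik] := ltnP i k.+1; last by rewrite extz_out.
    by rewrite extz_subconst // z // subrr.
  rewrite -startcoef_pred.
  have -> : \prod_(i < k) Sm (lift ord0 i) = (-1) ^ k%:Z.
    rewrite (eq_bigr (fun=> -1)) ?prodr_const ?card_ord // => i _.
    by rewrite Sconst /= ?z ?expr1z // ltnS // ltnW.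
  rewrite S0 E h2 z // subrr ip0 mulr1 [ip t (- 1)]ip_neg // mulr0 sub0r ip1 /C.
  have -> : wt th = e.+1%:Z + k.+1%:Z.
    rewrite /wt big_ord_recl -extz_ord E; congr (_ + _).
    rewrite (eq_bigr (fun=> 1)) ?sumr_const ?card_ord ?natz // => i _.
    by rewrite -extz_ord z.
  have -> : \prod_(i < k.+2) t ^ tri (th i) = t ^ tri e.+1%:Z.
    rewrite big_ord_recl -extz_ord E big1 ?mulr1 // => i _.
    by rewrite -extz_ord z /tri // subrr mulr0 div0z expr0z.
  have -> : e.+1%:Z - 1 = e%:Z by lia.
  rewrite expfzDr ?oppr_eq0 ?oner_eq0 // -[k.+1]addn1 PoszD expfzDr ?oppr_eq0 ?oner_eq0 //.
  have h := onem_neq0; have sg : (-1) ^ k%:Z * (-1) ^ k%:Z = 1 :> K.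
    by rewrite -exprnP -expr2 sqrr_sign.
  rewrite expr1z; move: sg; set s := (-1) ^ k%:Z; set u := (-1) ^ e.+1%:Z => sg.
  transitivity (u * t ^ tri e.+1%:Z * ip t e%:Z * (s * s) * ((1 - t) * (1 - t)^-1)).
    by ring.
  by rewrite sg mulfV // !mulr1.
have [i hi] : exists i : 'I_k.+1, extz th i.+1 != 1 by apply/existsP; rewrite -negb_forall.
have hi0 : extz th i.+1 = 0 by case: (h01 i) => // h; rewrite h eqxx in hi.
have [j [jk j1 j0]] : exists j, [/\ (j < k)%N, extz th j.+1 = 1 & extz th j.+2 = 0].
  have ex : exists j, extz th j.+1 == 0 by exists i; rewrite hi0.
  case: (ex_minnP ex) => -[|j] /eqP hj hmin; first by rewrite hj in h1.
  exists j; split=> //.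
    by have := hmin i; rewrite hi0 eqxx => /(_ isT) h; exact: leq_trans h (leq_ord i).
  by case: (h01 j) => // /eqP /hmin; rewrite ltnn.
rewrite [\prod_(_ < k) _](bigD1 (Ordinal jk)) //=.
have -> : Sm (bump 0 j) = 0 by exact: Sjump.
rewrite mul0r !mulr0.
symmetry; apply/eqP; rewrite oppr_eq0; apply: contraT => /start_neq0 [_ /(_ j.+1)].
by rewrite extz_subconst // j0.
Qed.
End Initial.

(** * Iterating the transfer operator *)

Section Binomial.
Variable K : numFieldType.

Definition binweight (n m : nat) (x : K) : K :=
  'C(n, m)%:R * x ^+ m * (1 - x) ^+ (n - m).

Lemma binweight_out n m x : (n < m)%N -> binweight n m x = 0.
Proof. by move=> h; rewrite /binweight bin_small // !mul0r. Qed.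

Lemma binweightS n m x :
  binweight n.+1 m.+1 x = (1 - x) * binweight n m.+1 x + x * binweight n m x.
Proof.
rewrite /binweight subSS binS natrD; have [h|h] := ltnP m n.
  have -> : (n - m)%N = (n - m.+1).+1 by lia.
  by rewrite !exprS; ring.
have z : 'C(n, m.+1) = 0%N by rewrite bin_small.
by rewrite z !exprS; ring.
Qed.

Lemma binweight_sum n x (W : nat -> K) :
  \sum_(m < n.+2) binweight n.+1 m x * W m =
  \sum_(m < n.+1) binweight n m x * ((1 - x) * W m + x * W m.+1).
Proof.
rewrite big_ord_recl /=.
under eq_bigr do rewrite /bump /= add1n binweightS mulrDl.
under [RHS]eq_bigr do rewrite mulrDr.
rewrite !big_split /= addrA; congr (_ + _); last by apply: eq_bigr => m _; ring.
rewrite big_ord_recr /= [binweight n n.+1 x]binweight_out // mulr0 mul0r addr0.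
rewrite [RHS]big_ord_recl /=; congr (_ + _).
  by rewrite /binweight !bin0 !subn0 exprS; ring.
by apply: eq_bigr => m _; rewrite /bump /= add1n; ring.
Qed.
End Binomial.

Section Iterates.
Variables (K : numFieldType) (t : K) (k : nat).
Implicit Types (h : {ffun 'I_k.+1 -> int} -> K) (th : {ffun 'I_k.+1 -> int}).

Local Notation P := (@transfer K t k).

Lemma eq_transfer h h' : h =1 h' -> P h =1 P h'.
Proof.
by move=> e th; rewrite /transfer e; congr (_ + _); apply: eq_bigr => i _; rewrite e.
Qed.

Lemma transfer_lin (I : Type) (r : seq I) (c : I -> K) (hs : I -> {ffun 'I_k.+1 -> int} -> K) th :
  P (fun x => \sum_(i <- r) c i * hs i x) th = \sum_(i <- r) c i * P (hs i) th.
Proof.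
rewrite /transfer mulr_sumr.
under [X in _ + X = _]eq_bigr do rewrite mulr_sumr.
rewrite [X in _ + X = _]exchange_big -big_split; apply: eq_bigr => i _ /=.
rewrite mulrDr mulrCA mulr_sumr; congr (_ + _).
by apply: eq_bigr => j _; rewrite mulrCA.
Qed.

Lemma transferB h h' th : P (fun x => h x - h' x) th = P h th - P h' th.
Proof.
rewrite /transfer; under eq_bigr do rewrite mulrBr.
rewrite sumrB; ring.
Qed.

Lemma iter_transferB n h h' th :
  iter n P (fun x => h x - h' x) th = iter n P h th - iter n P h' th.
Proof.
elim: n th => [|n IH] th //=.
by rewrite (eq_transfer IH) transferB.
Qed.

Lemma eq_iter_transfer n h h' : h =1 h' -> iter n P h =1 iter n P h'.
Proof. by elim: n => // n IH e; apply: eq_transfer; exact: IH. Qed.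

Lemma iter_transfer_lin n (I : Type) (r : seq I) (c : I -> K)
    (hs : I -> {ffun 'I_k.+1 -> int} -> K) th :
  iter n P (fun x => \sum_(i <- r) c i * hs i x) th =
  \sum_(i <- r) c i * iter n P (hs i) th.
Proof.
elim: n th => [|n IH] th //=.
by rewrite (eq_transfer IH) transfer_lin.
Qed.

(** The chain never lowers an entry, so that the value at th involves only initial
    vectors that are below th. *)
Lemma iter_transfer_local n h (i : 'I_k.+1) b :
  (forall x, extz x i < b -> h x = 0) -> forall th, extz th i < b -> iter n P h th = 0.
Proof.
move=> hh; elim: n => [|n IH] th hb /=; first exact: hh.
rewrite /transfer IH // mulr0 add0r big1 // => j _.
by rewrite IH ?mulr0 // extz_subunit; case: eqP => _ /=; lia.
Qed.

Hypothesis t0 : t != 0.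

(** All rates of the chain are multiplied by t^d when the vector is raised
    by d. *)
Lemma transfer_shift h d th :
  P (fun x => h (x - constvec _ d)) th =
  (1 - t ^ d) * h (th - constvec _ d) + t ^ d * P h (th - constvec _ d).
Proof.
have e i : (i < k.+1)%N -> t ^ d * t ^ (extz (th - constvec k.+1 d) i) = t ^ extz th i.
  by move=> ik; rewrite -expfzDr // extz_subconst // addrC subrK.
rewrite /transfer mulrDr mulr_sumr addrA; congr (_ + _).
  rewrite -(e k) //; ring.
apply: eq_bigr => i _; rewrite addrAC mulrA; congr (_ * h _).
rewrite mulrBr; congr (_ - _).
  rewrite -expfzDr //; congr (_ ^ _); rewrite extz_subconst //; ring.
by case: i => -[|i] ik /=; rewrite ?mulr0 // e // ltnW.
Qed.

Hypothesis t_neq1 : forall i, t ^+ i.+1 != 1.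

Lemma wsum0 th : wsum t 0 th = start t th - start t (th - constvec _ 1).
Proof.
have [hth|hth] := pselect (dominant th); first exact: wsum0_dominant.
rewrite [LHS]fsbig1 => [|v _]; last first.
  have [->|h] := eqVneq (weight t th v) 0; first by rewrite mul0r.
  by case: hth; case: (weight_dominant h).
have z1 : start t th = 0.
  apply/eqP; apply: contra_notT hth => /start_neq0 [h1 h2] [|i]; rewrite !h2 //.
rewrite z1; symmetry; apply/eqP; rewrite sub0r oppr_eq0.
apply: contra_notT hth => /start_neq0 [h1 h2].
have hS i : (i < k)%N -> extz th i.+1 = 1.
  by move=> ik; apply/eqP; rewrite -subr_eq0 -(@extz_subconst _ _ _ i.+1) ?h2.
move: h1; rewrite extz_subconst // => h1 [|i].
  by have [ik|ki] := ltnP 0 k; [rewrite hS //; lia | rewrite [extz th 1]extz_out //; lia].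
have [ik|ki] := ltnP i.+1 k; first by rewrite !hS // ltnW.
rewrite [extz th i.+2]extz_out //.
by have [ik'|ki'] := ltnP i k; [rewrite hS | rewrite extz_out].
Qed.

(** On the shifted functions x |-> wsum_m(x - d), the operator is 1 - t^d plus t^d
    times m |-> m + 1, a Bernoulli step with success probability t^d. *)
Lemma iter_transfer_wsum n (d : nat) th :
  iter n P (fun x => wsum t 0 (x - constvec _ d)) th =
  \sum_(m < n.+1) binweight n m (t ^+ d) * wsum t m (th - constvec _ d).
Proof.
elim: n th => [|n IH] th.
  by rewrite big_ord1 /binweight bin0 !mul1r.
rewrite /= (eq_transfer IH).
rewrite (transfer_lin _ (fun m : 'I_n.+1 => binweight n m (t ^+ d))
  (fun m x => wsum t m (x - constvec k.+1 d))).
rewrite (binweight_sum n (t ^+ d) (fun m => wsum t m (th - constvec k.+1 d))).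
by apply: eq_bigr => m _; rewrite transfer_shift -wsumS // exprnP.
Qed.

(** The differences wsum_0(. - d) = pi(. - d) - pi(. - d - 1) telescope to
    pi - pi(. - D), and the last term does not reach th when th_k < D. *)
Theorem iter_transfer_start n D th : extz th k < D%:Z ->
  iter n P (@start K t k) th =
  \sum_(d < D) \sum_(m < n.+1) binweight n m (t ^+ d) * wsum t m (th - constvec _ d).
Proof.
move=> hD.
under [RHS]eq_bigr do rewrite -iter_transfer_wsum -[iter _ _ _ _]mul1r.
rewrite -(iter_transfer_lin n (index_enum 'I_D) (fun=> 1)
  (fun (d : 'I_D) x => wsum t 0 (x - constvec k.+1 d))).
have tel x : \sum_(d < D) 1 * wsum t 0 (x - constvec k.+1 d) =
    start t x - start t (x - constvec k.+1 D).
  elim: (D) => [|d IH].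
    rewrite big_ord0 (_ : x - constvec k.+1 0 = x) ?subrr //.
    by apply/ffunP => i; rewrite !ffunE subr0.
  rewrite big_ord_recr /= IH mul1r wsum0 addrA subrK (_ : x - constvec _ d - constvec _ 1 = x - constvec _ d.+1) //.
  by apply/ffunP => i; rewrite !ffunE; lia.
rewrite (eq_iter_transfer n tel) iter_transferB.
rewrite [X in _ - X](@iter_transfer_local n _ ord_max D) ?subr0 //.
move=> x hx; apply/eqP; apply: contraT => /start_neq0 [h1 h2].
have : extz (x - constvec k.+1 D) k < 0 by rewrite extz_subconst //; move: hx; rewrite /=; lia.
have [e|e] := posnP k; first by rewrite (congr1 (extz _) e) ltNge h1.
by have := h2 k.-1; rewrite prednK // => ->.
Qed.
End Iterates.

(** * Adding a row to a matrix *)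

Section RankDrops.
Variable F : fieldType.

Lemma rank_col_mx_disjoint m1 m2 n (A : 'M[F]_(m1, n)) (B : 'M[F]_(m2, n)) :
  (forall a : 'rV_m1, (a *m A <= B)%MS -> a = 0) ->
  \rank (col_mx A B) = (m1 + \rank B)%N.
Proof.
move=> h; rewrite -addsmxE.
have fA : row_free A.
  by apply: inj_row_free => v vA; apply: h; rewrite vA sub0mx.
have c0 : (A :&: B)%MS = 0.
  apply/eqP/rowV0P => v; rewrite sub_capmx => /andP[/submxP[a ->] /h ->].
  by rewrite mul0mx.
by have := mxrank_sum_cap A B; rewrite c0 mxrank0 addn0 (eqP fA).
Qed.

Lemma rank_col_mx_sub m1 m2 n (A : 'M[F]_(m1, n)) (B : 'M[F]_(m2, n)) :
  (A <= B)%MS -> \rank (col_mx A B) = \rank B.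
Proof. by move=> h; rewrite -addsmxE (addsmx_idPr h). Qed.

Definition absorbed m (M : 'M[F]_m) (r : 'rV_m) (i : nat) : bool :=
  (r *m M ^+ i <= M ^+ i.+1)%MS.

Lemma absorbedS m (M : 'M[F]_m) r i : absorbed M r i -> absorbed M r i.+1.
Proof.
rewrite /absorbed => h; rewrite exprSr (exprSr M i.+1) mulmxA.
exact: submxMr.
Qed.

Lemma absorbed_le m (M : 'M[F]_m) r i j : (i <= j)%N ->
  absorbed M r i -> absorbed M r j.
Proof.
move=> ij; rewrite -(subnKC ij); elim: (j - i)%N => [|d IH]; first by rewrite addn0.
by rewrite addnS => /IH; apply: absorbedS.
Qed.

Definition add_row m (M : 'M[F]_m) (r : 'rV_m) : 'M[F]_(1 + m) :=
  block_mx (0 : 'M_1) r 0 M.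

Lemma add_row_exp m (M : 'M[F]_m) r i :
  add_row M r ^+ i.+1 = block_mx (0 : 'M_1) (r *m M ^+ i) 0 (M ^+ i.+1).
Proof.
elim: i => [|i IH]; first by rewrite !expr1 expr0 mulmx1.
rewrite exprS IH [LHS]mulmx_block !mul0mx !mulmx0 !add0r; congr block_mx.
Qed.

(** The powers of the enlarged matrix are those of M with the row r M^i on top. *)
Lemma rank_add_row_exp m (M : 'M[F]_m) r i :
  \rank (add_row M r ^+ i.+1) = (\rank (M ^+ i.+1) + ~~ absorbed M r i)%N.
Proof.
rewrite add_row_exp block_mxEh -[col_mx 0 0]/(col_mx (0 : 'M_(1,1)) 0) col_mx0 rank_row_0mx.
case E : (absorbed M r i); first by rewrite rank_col_mx_sub // addn0.
rewrite rank_col_mx_disjoint 1?addnC // => a ha.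
apply/eqP/negPn/negP => a0; case/negP: E.
have a00 : a 0 0 != 0.
  by apply: contra a0 => /eqP e; apply/eqP/matrixP => x y; rewrite !ord1 e mxE.
have e : a = (a 0 0)%:M by apply/matrixP => x y; rewrite !ord1 mxE eqxx mulr1n.
by move: ha; rewrite e mul_scalar_mx (eqmx_scale _ a00).
Qed.

(** Frobenius' rank inequality. *)
Lemma rank_drop_mono m (M : 'M[F]_m) i :
  (\rank (M ^+ i.+1) + \rank (M ^+ i.+1) <= \rank (M ^+ i.+2) + \rank (M ^+ i))%N.
Proof.
have := mxrank_Frobenius M (M ^+ i) M.
have -> : M *m M ^+ i = M ^+ i.+1 by rewrite exprS.
have -> : M ^+ i *m M = M ^+ i.+1 by rewrite exprSr.
have -> : M ^+ i.+1 *m M = M ^+ i.+2 by rewrite (exprSr M i.+1).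
by rewrite [X in (_ <= X)%N]addnC.
Qed.

Lemma rank_exp_le m (M : 'M[F]_m) i : (\rank (M ^+ i.+1) <= \rank (M ^+ i))%N.
Proof. by rewrite exprS; apply: mxrankM_maxr. Qed.

Variable k : nat.

Definition drops m (M : 'M[F]_m) : {ffun 'I_k.+1 -> int} := rank_drops k.+1 0 M.

Lemma extz_drops m (M : 'M[F]_m) i : (i < k.+1)%N ->
  extz (drops M) i = (\rank (M ^+ i))%:Z - (\rank (M ^+ i.+1))%:Z.
Proof. by move=> ik; rewrite -[i]/(nat_of_ord (Ordinal ik)) extz_ord ffunE subr0. Qed.

Lemma drops_dominant m (M : 'M[F]_m) : dominant (drops M).
Proof.
move=> i; have [ik|ki] := ltnP i.+1 k.+1.
  by rewrite !extz_drops // 1?ltnW //; have := rank_drop_mono M i; lia.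
rewrite [X in X <= _]extz_out //; have [ik|?] := ltnP i k.+1; last by rewrite extz_out.
by rewrite extz_drops //; have := rank_exp_le M i; lia.
Qed.

Definition absorbed_prev m (M : 'M[F]_m) r (i : nat) : bool :=
  if i is i'.+1 then absorbed M r i' else false.

Lemma drops_add_row m (M : 'M[F]_m) r (i : 'I_k.+1) :
  drops (add_row M r) i =
  drops M i + (absorbed M r i)%:Z - (absorbed_prev M r i)%:Z.
Proof.
rewrite !ffunE !subr0 rank_add_row_exp; case: i => -[|i] ik /=.
  by rewrite !expr0 !mxrank1; case: absorbed => /=; lia.
rewrite rank_add_row_exp; case: (absorbed _ _ i.+1); case: (absorbed _ _ i) => /=; lia.
Qed.

(** Absorption being monotone in i, the difference of the two indicators is the
    indicator of the first index i at which r is absorbed. *)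
Lemma sum_absorbed (R : pzRingType) m (M : 'M[F]_m) r (G : 'I_k.+1 -> R) g :
  (forall i : 'I_k.+1, absorbed M r i -> ~~ absorbed_prev M r i -> G i = g) ->
  ((forall i : 'I_k.+1, ~~ absorbed M r i) -> g = 0) ->
  g = \sum_(i < k.+1) ((absorbed M r i)%:R - (absorbed_prev M r i)%:R) * G i.
Proof.
move=> hG h0.
have ap i : absorbed_prev M r i -> absorbed M r i by case: i => //= i; exact: absorbedS.
have [/existsP[i0 hi0]|] := boolP [exists i : 'I_k.+1, absorbed M r i]; last first.
  rewrite negb_exists => /forallP h; rewrite h0 // big1 // => i _.
  have := h i; case E : (absorbed_prev M r i); first by rewrite (ap _ E).
  by move=> /negPf ->; rewrite subrr mul0r.
have [j hj hmin] := @arg_minnP _ i0 (fun i : 'I_k.+1 => absorbed M r i) id hi0.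
(* j is the first index at which r is absorbed. *)
have hpj : absorbed_prev M r j = false.
  case: j hj hmin => -[|j] jk //= hj hmin; apply/negP => h.
  by have := hmin (Ordinal (ltnW jk)) h; rewrite /= ltnn.
rewrite (bigD1 j) //= hj hpj subr0 mul1r hG ?hpj // big1 ?addr0 // => i ij.
have [lt|le] := ltnP i j.
  have E : absorbed M r i = false by apply/negP => /hmin; rewrite leqNgt lt.
  rewrite E; case E' : (absorbed_prev M r i); last by rewrite subrr mul0r.
  by rewrite (ap _ E') in E.
have lt : (j < i)%N by rewrite ltn_neqAle le andbT eq_sym.
case: i ij {le} lt => -[|i] ik //= _ ji.
have h1 : absorbed M r i by exact: absorbed_le hj.
by rewrite h1 (absorbedS h1) subrr mul0r.
Qed.

Lemma fun_drops_add_row (R : pzRingType) m (M : 'M[F]_m) r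
    (g : {ffun 'I_k.+1 -> int} -> R) :
  g (drops (add_row M r)) = g (drops M) +
  \sum_(i < k.+1) ((absorbed M r i)%:R - (absorbed_prev M r i)%:R) *
    (g (drops M + unitvec i) - g (drops M)).
Proof.
rewrite -(@sum_absorbed _ _ M r _ (g (drops (add_row M r)) - g (drops M))).
- by rewrite addrC subrK.
- move=> i hi hp; congr (g _ - _); apply/ffunP => j; rewrite drops_add_row [LHS]ffunE [unitvec i j]ffunE -[RHS]addrA.
  have ap l : absorbed_prev M r l -> absorbed M r l by case: l => //= l; exact: absorbedS.
  have below l : (l < i)%N -> absorbed M r l = false.
    move=> li; apply/negP => h; case/negP: hp.
    by case: (nat_of_ord i) li => // i' li /=; apply: absorbed_le h.
  congr (_ + _).
  have [->|ji] := eqVneq j i; first by rewrite hi (negPf hp).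
  have [lt|le] := ltnP j i.
    by rewrite below //; case: (nat_of_ord j) lt => //= l lt; rewrite below // ltnW.
  have lt : (i < j)%N by rewrite ltn_neqAle le andbT eq_sym.
  rewrite (absorbed_le _ hi) 1?ltnW //; case: (nat_of_ord j) lt => //= l lt.
  by rewrite (absorbed_le _ hi).
- move=> h; suff -> : drops (add_row M r) = drops M by rewrite subrr.
  apply/ffunP => i; rewrite drops_add_row (negPf (h i)).
  suff -> : absorbed_prev M r i = false by rewrite subr0 addr0.
  case: i => -[|i] ik //=; apply/negbTE; exact: (h (Ordinal (ltnW ik))).
Qed.
End RankDrops.

Section Counting.
Variables (F : finFieldType) (R : numFieldType).
Local Notation q := (#|F|%:R : R).
Local Notation t := (q^-1).

Lemma q_gt1 : 1 < q.
Proof. by rewrite ltr1n card_finNzRing_gt1. Qed.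

(** The absorbed rows are the kernel of the map induced by M^i on the quotient by
    the row space of M^(i+1); its rank is the i-th rank drop. *)
Lemma card_absorbed m (M : 'M[F]_m) i :
  (\sum_(r : 'rV[F]_m) (absorbed M r i)%:R) =
  q ^+ m * t ^+ (\rank (M ^+ i) - \rank (M ^+ i.+1)) :> R.
Proof.
pose N := M ^+ i *m cokermx (M ^+ i.+1).
have e r : absorbed M r i = (r <= kermx N)%MS.
  rewrite /absorbed submxE -mulmxA; apply/eqP/sub_kermxP => //.
have rN : \rank (kermx N) = (m - (\rank (M ^+ i) - \rank (M ^+ i.+1)))%N.
  rewrite mxrank_ker; congr (_ - _)%N.
  have := mxrank_mul_ker (M ^+ i) (cokermx (M ^+ i.+1)); rewrite -/N => <-.
  suff -> : \rank (M ^+ i :&: kermx (cokermx (M ^+ i.+1)))%MS = \rank (M ^+ i.+1) by rewrite addnK.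
  apply/eqP; rewrite eqn_leq; apply/andP; split; apply: mxrankS.
    apply/rV_subP => v; rewrite sub_capmx => /andP[_ /sub_kermxP h].
    by rewrite submxE; apply/eqP.
  rewrite sub_capmx; apply/andP; split; last by apply/sub_kermxP; rewrite mulmx_coker.
  by rewrite exprS; apply: submxMl.
have -> : \sum_(r : 'rV[F]_m) (absorbed M r i)%:R = #|rowg (kermx N)|%:R :> R.
  rewrite -sum1_card natr_sum [RHS]big_mkcond /=; apply: eq_bigr => r _.
  by rewrite mem_rowg e; case: ifP.
rewrite card_rowg rN natrX.
have le : (\rank (M ^+ i) - \rank (M ^+ i.+1) <= m)%N.
  by apply: leq_trans (leq_subr _ _) (rank_leq_row _).
have q0 : q != 0 by rewrite gt_eqF // (lt_trans ltr01 q_gt1).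
move: (_ - _)%N le => d le; rewrite exprB ?unitfE // exprVn //.
Qed.

Variable k : nat.
Implicit Types g : {ffun 'I_k.+1 -> int} -> R.

(** The backward operator of the chain: the mean of g after one step from th. *)
Definition step g (th : {ffun 'I_k.+1 -> int}) : R :=
  g th + \sum_(i < k.+1) (t ^ extz th i - prevpow t th i) * (g (th + unitvec i) - g th).

Lemma sum_add_row m (M : 'M[F]_m) g :
  \sum_(r : 'rV[F]_m) g (drops k (add_row M r)) = q ^+ m * step g (drops k M).
Proof.
under eq_bigr do rewrite fun_drops_add_row.
rewrite big_split /= sumr_const card_mx mul1n -[_ *+ (_ ^ _)]mulr_natl natrX /step mulrDr; congr (_ + _).
rewrite exchange_big mulr_sumr; apply: eq_bigr => i _ /=.
rewrite -mulr_suml mulrA; congr (_ * _); rewrite sumrB mulrBr.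
have h j : (j < k.+1)%N -> q ^+ m * t ^ extz (drops k M) j = \sum_(r : 'rV[F]_m) (absorbed M r j)%:R.
  move=> jk; rewrite card_absorbed extz_drops // exprnP; congr (_ * _ ^ _).
  by rewrite subzn ?rank_exp_le.
rewrite -h //; congr (_ - _).
case: i => -[|i] ik /=; first by rewrite mulr0 big1.
by rewrite h // ltnW.
Qed.

End Counting.

(** * The chain of rank drops *)

Section Expectation.
Variables (F : finFieldType) (R : realFieldType) (k : nat).
Local Notation q := (#|F|%:R : R).
Local Notation t := (q^-1).
Implicit Types g : {ffun 'I_k.+1 -> int} -> R.

Lemma in_strict_upper n (A : 'M[F]_n) :
  reflect (forall i j : 'I_n, (j <= i)%N -> A i j = 0) (A \in strict_upper F n).
Proof.
rewrite inE; apply: (iffP forallP) => h i.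
  by move=> j ji; apply/eqP; have /forallP/(_ j)/implyP := h i; apply.
by apply/forallP => j; apply/implyP => ji; apply/eqP/h.
Qed.

Lemma add_row_strict_upper n (A : 'M[F]_n) r :
  ((add_row A r : 'M_n.+1) \in strict_upper F n.+1) = (A \in strict_upper F n).
Proof.
apply/in_strict_upper/in_strict_upper => h i j ij.
  have <- : add_row A r (rshift 1 i) (rshift 1 j) = A i j by exact: block_mxEdr.
  by apply: h; rewrite /= leq_add2l.
case: (@split_ordP 1 n i) => i' ei; case: (@split_ordP 1 n j) => j' ej; subst.
- by rewrite [LHS]block_mxEul mxE.
- by move: ij; rewrite /= ord1.
- by rewrite [LHS]block_mxEdl mxE.
- by rewrite [LHS]block_mxEdr h //; move: ij; rewrite /= leq_add2l.
Qed.

Lemma sum_strict_upperS n (G : 'M[F]_n.+1 -> R) :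
  \sum_(A in strict_upper F n.+1) G A =
  \sum_(A in strict_upper F n) \sum_(r : 'rV_n) G (add_row A r).
Proof.
rewrite pair_big_dep /=.
rewrite (reindex_onto (fun p : 'M[F]_n * 'rV[F]_n => add_row p.1 p.2 : 'M_n.+1)
  (fun A : 'M_n.+1 => (drsubmx (A : 'M_(1 + n)), ursubmx (A : 'M_(1 + n))))) /=.
  apply: eq_bigl => -[A r] /=; rewrite add_row_strict_upper andbT.
  by rewrite /add_row block_mxKdr block_mxKur eqxx andbT.
move=> A /in_strict_upper hA; apply: etrans (@submxK _ 1 n 1 n A).
rewrite /add_row; congr (block_mx _ _ _ _); apply/matrixP => i j; rewrite !mxE hA //=.
  by rewrite !ord1.
by rewrite !ord1.
Qed.

Lemma card_strict_upperS n :
  #|strict_upper F n.+1|%:R = q ^+ n * #|strict_upper F n|%:R :> R.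
Proof.
rewrite -[#|strict_upper F n.+1|]sum1_card -[#|strict_upper F n|]sum1_card.
rewrite !natr_sum (sum_strict_upperS (fun=> 1)).
rewrite mulr_sumr; apply: eq_bigr => A _.
by rewrite sumr_const card_mx mul1n natrX mulr1.
Qed.

Lemma q_gt0 : 0 < q. Proof. exact: lt_trans ltr01 (q_gt1 F R). Qed.
Lemma q_neq0 : q != 0. Proof. by rewrite gt_eqF ?q_gt0. Qed.

Lemma card_strict_upper_gt0 n : 0 < #|strict_upper F n|%:R :> R.
Proof.
rewrite ltr0n; apply/card_gt0P; exists 0; apply/in_strict_upper => i j _.
by rewrite mxE.
Qed.

Definition expect n g : R :=
  (\sum_(A in strict_upper F n) g (drops k A)) / #|strict_upper F n|%:R.

(** The same chain started from (e, 0, ..., 0) instead of 0: at n = 0 the bordered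
    matrix is the zero matrix of size e. *)
Definition expect_ext e n g : R :=
  (\sum_(A in strict_upper F n) \sum_(V : 'M[F]_(n, e))
     g (drops k (block_mx A V (0 : 'M_(e, n)) 0))) / (#|strict_upper F n|%:R * q ^+ (n * e)).

Lemma expectS n g : expect n.+1 g = expect n (step F g).
Proof.
have h0 := card_strict_upper_gt0 n; have q0 := q_neq0.
rewrite /expect sum_strict_upperS card_strict_upperS.
under eq_bigr do rewrite sum_add_row.
by rewrite -mulr_sumr; field; rewrite expf_neq0 // gt_eqF.
Qed.

Lemma block_add_row n e (A : 'M[F]_n) (V : 'M_(n, e)) r s :
  block_mx (add_row A r) (col_mx s V) (0 : 'M_(e, 1 + n)) 0 =
  add_row (block_mx A V (0 : 'M_(e, n)) 0) (row_mx r s) :> 'M_(1 + (n + e)).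
Proof.
have := @block_mxA F 1 n e 1 n e 0 r s 0 A V 0 0 0.
by rewrite /= castmx_id col_mx0 row_mx0 => <-.
Qed.

Lemma sum_col_mx n e (G : 'M[F]_(1 + n, e) -> R) :
  \sum_(V : 'M[F]_(1 + n, e)) G V = \sum_(V : 'M[F]_(n, e)) \sum_(s : 'rV_e) G (col_mx s V).
Proof.
rewrite pair_bigA (reindex (fun p : 'M[F]_(n, e) * 'rV_e => col_mx p.2 p.1)) //=.
exists (fun V => (dsubmx V, usubmx V)) => [[V s] _|V _] /=.
  by rewrite col_mxKd col_mxKu.
by rewrite vsubmxK.
Qed.

Lemma sum_row_mx n e (G : 'rV[F]_(n + e) -> R) :
  \sum_(v : 'rV[F]_(n + e)) G v = \sum_(s : 'rV_e) \sum_(r : 'rV_n) G (row_mx r s).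
Proof.
rewrite pair_bigA (reindex (fun p : 'rV[F]_e * 'rV_n => row_mx p.2 p.1)) //=.
exists (fun v => (rsubmx v, lsubmx v)) => [[s r] _|v _] /=.
  by rewrite row_mxKl row_mxKr.
by rewrite hsubmxK.
Qed.

Lemma expect_extS e n g : expect_ext e n.+1 g = expect_ext e n (step F g).
Proof.
have h0 := card_strict_upper_gt0 n; have q0 := q_neq0.
rewrite /expect_ext sum_strict_upperS card_strict_upperS.
rewrite (eq_bigr (fun A => \sum_(V : 'M[F]_(n, e)) q ^+ (n + e) *
    step F g (drops k (block_mx A V (0 : 'M_(e, n)) 0)))); last first.
  move=> A _; under eq_bigr do rewrite (@sum_col_mx n e).
  rewrite exchange_big; apply: eq_bigr => V _ /=.
  rewrite exchange_big /=; under eq_bigr do under eq_bigr do rewrite block_add_row.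
  rewrite -sum_add_row sum_row_mx //.
under eq_bigr do rewrite -mulr_sumr.
rewrite -mulr_sumr mulSn !exprD; move: (\sum_(A in _) _) => X.
have [a0 b0 c0] : [/\ q ^+ n != 0, q ^+ e != 0 & q ^+ (n * e) != 0].
  by rewrite !expf_neq0.
have s0 : #|strict_upper F n|%:R != 0 :> R by rewrite gt_eqF.
by field; rewrite a0 b0 c0 s0.
Qed.

Lemma strict_upper0 (A : 'M[F]_0) : A \in strict_upper F 0.
Proof. by apply/in_strict_upper => -[]. Qed.

Lemma strict_upper0E : strict_upper F 0 = [set: _]%SET.
Proof. by apply/setP => A; rewrite strict_upper0 inE. Qed.

Lemma sum_empty_matrix m n (G : 'M[F]_(m, n) -> R) : (m * n = 0)%N ->
  \sum_A G A = G 0.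
Proof.
move=> mn0; rewrite (bigD1 0) //= big1 ?addr0 // => A /eqP; case.
apply/matrixP => i j; exfalso; have := ltn_ord i; have := ltn_ord j; nia.
Qed.

Lemma drops_0 m : drops k (0 : 'M[F]_m) = startvec k m%:Z.
Proof.
apply/ffunP => i; rewrite !ffunE subr0 -val_eqE; case: i => -[|i] ik /=.
  by rewrite expr0 expr1 mxrank1 mxrank0 subr0.
by rewrite !expr0n /= mxrank0 subrr.
Qed.

Lemma expect0 g : expect 0 g = g (startvec k 0).
Proof.
rewrite /expect strict_upper0E cardsT card_mx mul0n expn0 divr1.
by under eq_bigl do rewrite inE; rewrite sum_empty_matrix // drops_0.
Qed.

Lemma expect_ext0 e g : expect_ext e 0 g = g (startvec k e%:Z).
Proof.
rewrite /expect_ext strict_upper0E cardsT card_mx !mul0n expn0 expr0 mulr1 divr1.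
under eq_bigl do rewrite inE.
rewrite sum_empty_matrix // sum_empty_matrix //.
have -> : block_mx 0 0 0 0 = 0 :> 'M[F]_(0 + e) by exact: block_mx0.
by congr g; exact: (drops_0 e).
Qed.

Definition point_mass (eta th : {ffun 'I_k.+1 -> int}) : R := (th == eta)%:R.

Lemma sum_rates_upto n (th : {ffun 'I_k.+1 -> int}) :
  \sum_(i < n.+1) (t ^ extz th i - prevpow t th i) = t ^ extz th n.
Proof.
elim: n => [|n IH]; first by rewrite big_ord1 subr0.
by rewrite big_ord_recr /= IH addrC subrK.
Qed.

Lemma prevpow_subunit (th : {ffun 'I_k.+1 -> int}) (i : 'I_k.+1) :
  prevpow t (th - unitvec i) i = prevpow t th i.
Proof.
case: i => -[|i] ik //=; rewrite extz_subunit /= ltn_eqF //.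
by rewrite subr0.
Qed.

(** On point masses the backward operator is the forward operator in the other
    argument. *)
Lemma step_point_mass eta th : step F (point_mass eta) th =
  (1 - t ^ extz eta k) * point_mass eta th +
  \sum_(i < k.+1) (t ^ (extz eta i - 1) - prevpow t eta i) * point_mass (eta - unitvec i) th.
Proof.
rewrite /step; under eq_bigr do rewrite mulrBr.
rewrite sumrB -mulr_suml sum_rates_upto addrCA addrC; congr (_ + _).
  rewrite /point_mass; case: eqP => [->|_]; last by rewrite !mulr0 subr0.
  by rewrite !mulr1.
apply: eq_bigr => i _.
have e : (th + unitvec i == eta) = (th == eta - unitvec i).
  by rewrite [RHS]eq_sym subr_eq eq_sym.
rewrite /point_mass e.
have [->|_] := eqVneq th (eta - unitvec i); last by rewrite !mulr0.
by rewrite !mulr1 prevpow_subunit extz_subunit eqxx.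
Qed.

Lemma eq_expect g g' n : g =1 g' -> expect n g = expect n g'.
Proof. by move=> e; rewrite /expect; congr (_ / _); apply: eq_bigr. Qed.

Lemma expectD g g' n : expect n (fun x => g x + g' x) = expect n g + expect n g'.
Proof. by rewrite /expect big_split mulrDl. Qed.

Lemma expectZ c g n : expect n (fun x => c * g x) = c * expect n g.
Proof. by rewrite /expect -mulr_sumr mulrA. Qed.

Lemma expect_extD e g g' n :
  expect_ext e n (fun x => g x + g' x) = expect_ext e n g + expect_ext e n g'.
Proof.
rewrite /expect_ext; under eq_bigr do rewrite big_split.
by rewrite big_split mulrDl.
Qed.

Lemma expect_extZ e c g n : expect_ext e n (fun x => c * g x) = c * expect_ext e n g.
Proof.
rewrite /expect_ext; under eq_bigr do rewrite -mulr_sumr.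
by rewrite -mulr_sumr mulrA.
Qed.

Lemma expect_ext_sum e (I : Type) (r : seq I) (gs : I -> {ffun 'I_k.+1 -> int} -> R) n :
  expect_ext e n (fun x => \sum_(i <- r) gs i x) = \sum_(i <- r) expect_ext e n (gs i).
Proof.
rewrite /expect_ext -mulr_suml; congr (_ / _).
under eq_bigr do rewrite exchange_big.
by rewrite exchange_big.
Qed.

Lemma eq_expect_ext e g g' n : g =1 g' -> expect_ext e n g = expect_ext e n g'.
Proof.
move=> eg; rewrite /expect_ext; congr (_ / _); apply: eq_bigr => A _.
by apply: eq_bigr.
Qed.

Lemma expect_ext_point_mass e n eta : expect_ext e n (point_mass eta) =
  iter n (@transfer R t k) (fun x => point_mass x (startvec k e%:Z)) eta.
Proof.
elim: n eta => [|n IH] eta; first by rewrite expect_ext0.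
rewrite expect_extS (eq_expect_ext _ _ (step_point_mass eta)) expect_extD expect_extZ.
rewrite expect_ext_sum /= /transfer IH; congr (_ + _); apply: eq_bigr => i _.
by rewrite expect_extZ IH.
Qed.
End Expectation.

(** * Independence of the initial vector *)

Section Border.
Variables (F : fieldType).

Lemma trmx_exp n (A : 'M[F]_n) i : (A ^+ i)^T = A^T ^+ i.
Proof.
elim: i => [|i IH]; first by rewrite !expr0 trmx1.
by rewrite exprS -[A * _]/(A *m _) trmx_mul IH (exprSr A^T i).
Qed.

Lemma border_exp n e (A : 'M[F]_n) (V : 'M_(n, e)) i :
  block_mx A V (0 : 'M_(e, n)) 0 ^+ i.+1 =
  block_mx (A ^+ i.+1) (A ^+ i *m V) (0 : 'M_(e, n)) 0.
Proof.
elim: i => [|i IH]; first by rewrite !expr1 expr0 mul1mx.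
rewrite exprS IH [LHS]mulmx_block !mul0mx !mulmx0 !addr0; congr block_mx.
by rewrite mulmxA exprS.
Qed.

(** The power i+1 of the block matrix is A^(i+1) with the columns of A^i V added.
    If these are independent modulo the column space of A^(i+1) for i = k, then also
    for i < k; so the ranks of all powers increase by e, as does the size. *)
Lemma drops_border k n e (A : 'M[F]_n) (V : 'M_(n, e)) :
  (forall a : 'rV_e, absorbed A^T (a *m V^T) k -> a = 0) ->
  drops k (block_mx A V (0 : 'M_(e, n)) 0) = drops k A.
Proof.
move=> h.
have hi i : (i <= k)%N -> forall a : 'rV_e, absorbed A^T (a *m V^T) i -> a = 0.
  by move=> ik a ha; apply: h; exact: absorbed_le ha.
have rk i : (i <= k)%N ->
    \rank (block_mx A V (0 : 'M_(e, n)) 0 ^+ i.+1) = (\rank (A ^+ i.+1) + e)%N.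
  move=> ik; rewrite border_exp block_mxEv row_mx0 rank_col_mx0.
  rewrite -mxrank_tr tr_row_mx -addsmxE addsmxC addsmxE.
  rewrite rank_col_mx_disjoint ?mxrank_tr 1?addnC // => a ha.
  apply: (hi i ik); rewrite /absorbed -!trmx_exp -mulmxA -trmx_mul.
  exact: ha.
apply/ffunP => i; rewrite !ffunE !subr0 rk -1?ltnS //.
case: i => -[|i] ik /=; last by rewrite rk -1?ltnS 1?ltnW //; lia.
by rewrite !expr0 !mxrank1; lia.
Qed.
End Border.

Section Comparison.
Variables (F : finFieldType) (R : realFieldType) (k : nat).
Local Notation q := (#|F|%:R : R).
Local Notation t := (q^-1).

(** For a nonzero a, the row a V^T is uniform when V is. *)
Lemma sum_absorbed_mul n e (A : 'M[F]_n) (a : 'rV_e) : a != 0 ->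
  \sum_(V : 'M[F]_(n, e)) (absorbed A^T (a *m V^T) k)%:R =
  q ^+ (n * e) * t ^ extz (drops k A) k :> R.
Proof.
move=> a0; have q0 := q_neq0 F R.
(* Adding c r to V^T translates the row a V^T by r; averaging over r makes it uniform. *)
have [c ac] : exists c : 'cV_e, a *m c = 1%:M.
  by exists (pinvmx a); rewrite mulmxVp // /row_free rank_rV a0.
apply: (mulfI (expf_neq0 n q0)).
transitivity (\sum_(r : 'rV[F]_n) \sum_(V : 'M[F]_(n, e)) (absorbed A^T (a *m V^T + r) k)%:R : R).
  rewrite -natrX -[X in (_ ^ X)%N]mul1n -card_mx mulr_natl -sumr_const.
  apply: eq_bigr => r _.
  rewrite (reindex_inj (addIr (c *m r)^T)) /=; apply: eq_bigr => V _.
  by rewrite linearD /= trmxK mulmxDr mulmxA ac mul1mx.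
rewrite exchange_big /= (eq_bigr (fun=> \sum_(r : 'rV[F]_n) (absorbed A^T r k)%:R)); last first.
  move=> V _; rewrite [RHS](reindex_inj (addrI (a *m V^T))) //.
rewrite sumr_const card_mx -[_ *+ (_ ^ _)]mulr_natl natrX card_absorbed -!trmx_exp !mxrank_tr.
rewrite extz_drops // mulrCA exprnP; congr (_ * (_ * _ ^ _)).
by rewrite subzn // rank_exp_le.
Qed.

(** A union bound over the q^e combinations of the columns of V. *)
Lemma expect_ext_close e n (eta : {ffun 'I_k.+1 -> int}) :
  `|expect_ext F e n (point_mass R eta) - expect F n (point_mass R eta)| <=
  q ^+ e * expect F n (fun x : {ffun 'I_k.+1 -> int} => t ^ extz x k).
Proof.
have s0 := card_strict_upper_gt0 F R n; have q0 := q_gt0 F R.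
have qe0 : 0 < q ^+ (n * e) by rewrite exprn_gt0.
have sumV (x : R) : \sum_(V : 'M[F]_(n, e)) x = q ^+ (n * e) * x.
  by rewrite sumr_const card_mx -[x *+ _]mulr_natl natrX.
have -> : expect F n (point_mass R eta) =
    (\sum_(A in strict_upper F n) \sum_(V : 'M[F]_(n, e)) point_mass R eta (drops k A)) /
    (#|strict_upper F n|%:R * q ^+ (n * e)).
  under eq_bigr do rewrite sumV.
  by rewrite /expect -mulr_sumr; field; rewrite !gt_eqF.
rewrite /expect_ext -mulrBl -sumrB normrM.
rewrite [`|_^-1|]gtr0_norm ?invr_gt0 ?mulr_gt0 //.
have -> : q ^+ e * expect F n (fun x : {ffun 'I_k.+1 -> int} => t ^ extz x k) =
   (\sum_(A in strict_upper F n) q ^+ e * (q ^+ (n * e) * t ^ extz (drops k A) k)) /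
    (#|strict_upper F n|%:R * q ^+ (n * e)).
  rewrite -mulr_sumr -mulr_sumr /expect; field; rewrite !gt_eqF //.
rewrite ler_pM2r ?invr_gt0 ?mulr_gt0 //.
apply: le_trans (ler_norm_sum _ _ _) _; apply: ler_sum => A _.
rewrite -sumrB; apply: le_trans (ler_norm_sum _ _ _) _.
apply: (@le_trans _ _ (\sum_(V : 'M[F]_(n, e)) \sum_(a : 'rV[F]_e | a != 0)
    (absorbed A^T (a *m V^T) k)%:R)).
  apply: ler_sum => V _.
  have [/existsP[a /andP[a0 ha]]|hn] :=
      boolP [exists a : 'rV[F]_e, (a != 0) && absorbed A^T (a *m V^T) k].
    rewrite (bigD1 a) //= ha; apply: (@le_trans _ _ 1).
      by rewrite /point_mass; do 2 case: eqP => _; rewrite ?subrr ?subr0 ?sub0r ?normrN ?normr1 ?normr0 ?ler01.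
    by rewrite lerDl sumr_ge0 // => b _; rewrite ler0n.
  rewrite drops_border ?subrr ?normr0; first by apply: sumr_ge0 => b _; rewrite ler0n.
  move=> a ha; apply/eqP/negPn/negP => a0; case/negP: hn.
  by apply/existsP; exists a; rewrite a0.
rewrite exchange_big /=; under eq_bigr do rewrite sum_absorbed_mul //.
rewrite sumr_const -[_ *+ _]mulr_natl ler_wpM2r //.
  by rewrite mulr_ge0 // ?exprn_ge0 ?ltW // exprz_gt0 // invr_gt0.
by rewrite -natrX ler_nat -[X in (_ ^ X)%N]mul1n -card_mx max_card.
Qed.
End Comparison.

(** * Moments of the first and the last rank drop *)

Section Moments.
Variables (F : finFieldType) (R : realFieldType) (k : nat).
Local Notation q := (#|F|%:R : R).
Local Notation t := (q^-1).
Local Notation vec := {ffun 'I_k.+1 -> int}.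
Implicit Types g : vec -> R.

Lemma t_gt0 : 0 < t. Proof. by rewrite invr_gt0 q_gt0. Qed.
Lemma t_lt1 : t < 1. Proof. by rewrite invf_lt1 ?q_gt0 ?q_gt1. Qed.
Lemma t_neq0 : t != 0. Proof. by rewrite gt_eqF ?t_gt0. Qed.

Lemma ler_expect n g g' : (forall x, dominant x -> g x <= g' x) ->
  expect F n g <= expect F n g'.
Proof.
move=> h; rewrite /expect ler_pM2r ?invr_gt0 ?card_strict_upper_gt0 //.
by apply: ler_sum => A _; apply: h; exact: drops_dominant.
Qed.

Lemma expect_constant n (c : R) : expect F n (fun _ : vec => c) = c.
Proof.
rewrite /expect sumr_const -[_ *+ _]mulr_natl mulrAC mulfV ?mul1r //.
by rewrite gt_eqF ?card_strict_upper_gt0.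
Qed.

Lemma expect_sqr n g : expect F n g ^+ 2 <= expect F n (fun x => g x ^+ 2).
Proof.
pose a := expect F n g.
have : 0 <= expect F n (fun x => (g x - a) ^+ 2).
  by rewrite -(expect_constant n 0); apply: ler_expect => x _; rewrite sqr_ge0.
rewrite (@eq_expect _ _ _ _ (fun x => g x ^+ 2 + ((- (a *+ 2)) * g x + a ^+ 2))); last first.
  by move=> x; ring.
by rewrite !expectD expectZ expect_constant -/a; lra.
Qed.

Definition total (x : vec) : R := \sum_(i < k.+1) t ^ extz x i.

Lemma total_addunit x (i : 'I_k.+1) :
  total (x + unitvec i) - total x = - (1 - t) * t ^ extz x i.
Proof.
rewrite /total -sumrB (bigD1 i) //= big1 ?addr0; last first.
  move=> j ji; rewrite extz_addunit (_ : (j == i :> nat) = false) ?addr0 ?subrr //.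
  exact: negbTE.
by rewrite extz_addunit eqxx expfzDr ?t_neq0 //; ring.
Qed.

Lemma ler_texp (a b : int) : a <= b -> t ^ b <= t ^ a.
Proof.
move=> ab; have -> : b = a + (`|b - a|%N)%:Z by rewrite gez0_abs ?subr_ge0 // addrCA subrr addr0.
rewrite expfzDr ?t_neq0 // ger_pMr ?exprz_gt0 ?t_gt0 // -exprnP.
by rewrite exprn_ile1 // ltW ?t_gt0 ?t_lt1.
Qed.

(** By Abel summation, the drift of the total is - (1 - t) times a sum that
    dominates half the square of t^(x_k), the largest term of the total. *)
Lemma total_step x : dominant x ->
  step F total x <= total x - (1 - t) / (2 * k.+1%:R ^+ 2) * total x ^+ 2.
Proof.
move=> hx; rewrite /step lerD2l.
under eq_bigr do rewrite total_addunit.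
have tx i : 0 < t ^ extz x i by rewrite exprz_gt0 // t_gt0.
have h n : 2^-1 * (t ^ extz x n) ^+ 2 <=
    \sum_(i < n.+1) (t ^ extz x i - prevpow t x i) * t ^ extz x i.
  elim: n => [|n IH].
    by rewrite big_ord1 subr0; have := sqr_ge0 (t ^ extz x 0); lra.
  rewrite big_ord_recr /=; apply: le_trans (lerD IH (lexx _)).
  have := sqr_ge0 (t ^ extz x n.+1 - t ^ extz x n); lra.
have tot : total x <= k.+1%:R * t ^ extz x k.
  have -> : k.+1%:R * t ^ extz x k = \sum_(i < k.+1) t ^ extz x k.
    by rewrite sumr_const card_ord mulr_natl.
  by apply: ler_sum => i _; apply: ler_texp; apply: dominant_le; rewrite // -ltnS.
have tot0 : 0 <= total x by apply: sumr_ge0 => i _; exact: ltW.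
have tot2 : total x ^+ 2 <= k.+1%:R ^+ 2 * (t ^ extz x k) ^+ 2.
  by rewrite -exprMn lerXn2r // nnegrE // mulr_ge0 // ltW.
have -> : \sum_(i < k.+1) (t ^ extz x i - prevpow t x i) * (- (1 - t) * t ^ extz x i) =
    - ((1 - t) * \sum_(i < k.+1) (t ^ extz x i - prevpow t x i) * t ^ extz x i).
  by rewrite mulr_sumr -sumrN; apply: eq_bigr => i _; ring.
rewrite lerN2 -mulrA ler_pM2l ?subr_gt0 ?t_lt1 //.
apply: le_trans (h k); rewrite invfM -mulrA ler_pM2l ?invr_gt0 ?ltr0n //.
rewrite mulrC ler_pdivrMr ?exprn_gt0 ?ltr0n // mulrC //.
Qed.

Definition decay : R := 2 * k.+1%:R ^+ 2 / (1 - t).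

Lemma decay_gt0 : 0 < decay.
Proof. by rewrite divr_gt0 ?mulr_gt0 ?exprn_gt0 ?ltr0n ?subr_gt0 ?t_lt1. Qed.

(** With y = E[total] / decay, the drift and Jensen's inequality give
    y_(n+1) <= y_n - y_n^2, which preserves y_n <= 1 / (n + 2). *)
Lemma expect_total n : expect F n total <= decay / n.+2%:R.
Proof.
have d0 := decay_gt0.
elim: n => [|n IH].
  rewrite expect0 /total; under eq_bigr => i _.
    have -> : extz (startvec k 0) i = 0 by rewrite extz_ord ffunE if_same.
    rewrite expr0z; over.
  have -> : decay / 2%:R = k.+1%:R ^+ 2 / (1 - t).
    by rewrite /decay; field; rewrite q_neq0 subr_eq0 gt_eqF ?q_gt1.
  rewrite sumr_const card_ord.
  rewrite ler_pdivlMr ?subr_gt0 ?t_lt1 // expr2.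
  have k1 : (1 : R) <= k.+1%:R by rewrite ler1n.
  have t0 := t_gt0; nra.
rewrite expectS.
set a := expect F n total in IH *.
have a0 : 0 <= a.
  rewrite /a -(expect_constant n 0); apply: ler_expect => x _.
  by apply: sumr_ge0 => i _; rewrite ltW // exprz_gt0 // t_gt0.
have h : expect F n (step F total) <= a - decay^-1 * a ^+ 2.
  apply: (@le_trans _ _ (expect F n (fun x => total x + (- decay^-1) * total x ^+ 2))).
    apply: ler_expect => x hx; apply: le_trans (total_step hx) _.
    by rewrite /decay invf_div mulNr.
  by rewrite expectD expectZ -/a mulNr lerD2l lerN2 ler_pM2l ?invr_gt0 // expect_sqr.
apply: le_trans h _.
have n2 : 0 < n.+2%:R :> R by rewrite ltr0n.
have n3 : 0 < n.+3%:R :> R by rewrite ltr0n.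
pose y := a / decay; have -> : a = y * decay by rewrite /y divfK ?gt_eqF.
have -> : y * decay - decay^-1 * (y * decay) ^+ 2 = decay * (y - y ^+ 2).
  by field; rewrite gt_eqF.
rewrite ler_pM2l //.
have y0 : 0 <= y by rewrite /y divr_ge0 // ltW.
have y1 : y <= n.+2%:R^-1 by rewrite /y ler_pdivrMr // mulrC.
have n3E : n.+3%:R = n.+2%:R + 1 :> R by rewrite -natr1.
apply: (@le_trans _ _ (n.+2%:R^-1 - n.+2%:R^-1 ^+ 2)).
  have : n.+2%:R^-1 <= 2^-1 :> R by rewrite lef_pV2 ?posrE ?ltr0n // ler_nat.
  move: (n.+2%:R^-1) y1 => z; nra.
rewrite -[X in _ <= X]div1r ler_pdivlMr // n3E.
have -> : (n.+2%:R^-1 - n.+2%:R^-1 ^+ 2) * (n.+2%:R + 1) = 1 - n.+2%:R^-1 ^+ 2 :> R.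
  by have : n.+2%:R != 0 :> R; [rewrite gt_eqF | move: (n.+2%:R : R) => z hz; field].
by rewrite gerDl oppr_le0 sqr_ge0.
Qed.

Lemma expect_last n : expect F n (fun x : vec => t ^ extz x k) <= decay / n.+2%:R.
Proof.
apply: le_trans (expect_total n); apply: ler_expect => x _.
rewrite /total (bigD1 ord_max) //= lerDl sumr_ge0 // => i _.
by rewrite ltW // exprz_gt0 // t_gt0.
Qed.

(** One step multiplies q^(x_0) by q with probability t^(x_0). *)
Lemma expect_first n : expect F n (fun x : vec => t ^ (- extz x 0)) = 1 + n%:R * (q - 1).
Proof.
have t0 := t_neq0.
elim: n => [|n IH].
  by rewrite expect0 -[0%N]/(nat_of_ord (@ord0 k)) extz_ord ffunE oppr0 expr0z mul0r addr0.
rewrite expectS (@eq_expect _ _ _ _ (fun x : vec => t ^ (- extz x 0) + (q - 1))).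
  by rewrite expectD IH expect_constant -natr1; ring.
move=> x; rewrite /step; congr (_ + _).
rewrite big_ord_recl big1 ?addr0; last first.
  by move=> i _; rewrite extz_addunit addr0 subrr mulr0.
rewrite extz_addunit eqxx subr0 opprD expfzDr // /=.
have e : t ^ extz x 0 * t ^ (- extz x 0) = 1 by rewrite -expfzDr // subrr expr0z.
have -> : t ^ (- 1) = q by rewrite -invr_expz expr1z invrK.
by rewrite mulrBr mulrA e mul1r.
Qed.

Lemma expect_point_mass_ge0 n eta : 0 <= expect F n (point_mass R eta : vec -> R).
Proof. by rewrite -(expect_constant n 0); apply: ler_expect => x _; rewrite ler0n. Qed.

Lemma point_mass_markov n eta (g : vec -> R) : (forall x, 0 <= g x) ->
  expect F n (point_mass R eta) * g eta <= expect F n g.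
Proof.
move=> g0; rewrite mulrC -expectZ; apply: ler_expect => x _.
by rewrite /point_mass; case: eqP => [->|_]; rewrite ?mulr1 ?mulr0.
Qed.
End Moments.

(** * The mixture over initial vectors *)

Section Mixture.
Variables (F : finFieldType) (R : realFieldType) (k : nat).
Local Notation q := (#|F|%:R : R).
Local Notation t := (q^-1).

Lemma t_expn_neq1 i : t ^+ i.+1 != 1.
Proof. by rewrite lt_eqF // exprn_ilt1 // ?t_lt1 // ltW // t_gt0. Qed.

(** The initial vectors (e, 0, ..., 0) with e >= N do not reach eta. *)
Lemma iter_transfer_mixture n N (eta : {ffun 'I_k.+1 -> int}) : extz eta 0 < N%:Z ->
  iter n (@transfer R t k) (@start R t k) eta =
  \sum_(e < N) startcoef t e * expect_ext F e n (point_mass R eta).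
Proof.
move=> hN.
pose h (x : {ffun 'I_k.+1 -> int}) := \sum_(e < N) startcoef t e * point_mass R x (startvec k e%:Z).
have -> : \sum_(e < N) startcoef t e * expect_ext F e n (point_mass R eta) =
    iter n (@transfer R t k) h eta.
  rewrite (iter_transfer_lin t n (index_enum 'I_N) (fun e : 'I_N => startcoef t e)
    (fun e x => point_mass R x (startvec k (e : nat)%:Z))).
  by apply: eq_bigr => e _; rewrite expect_ext_point_mass.
apply/eqP; rewrite -subr_eq0 -iter_transferB; apply/eqP.
apply: (@iter_transfer_local _ _ _ n _ ord0 N) => // x hx.
rewrite /h /start /point_mass; case E : (extz x 0) => [e|e].
  have eN : (e < N)%N by move: hx; rewrite /= E.
  rewrite (bigD1 (Ordinal eN)) //= big1 ?addr0 => [|f fe]; last first.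
    case: eqP => [fx|_]; last by rewrite mulr0.
    move: E; rewrite -fx -[0%N]/(nat_of_ord (@ord0 k)) extz_ord ffunE eqxx => -[fe'].
    by rewrite -val_eqE /= fe' eqxx in fe.
  rewrite eq_sym; case: eqP => _; by rewrite ?mulr1 ?mulr0 subrr.
rewrite big1 ?subr0 // => f _; case: eqP => [fx|_]; last by rewrite mulr0.
by move: E; rewrite -fx -[0%N]/(nat_of_ord (@ord0 k)) extz_ord ffunE eqxx.
Qed.

(** Each of the N initial vectors is replaced with 0 at the cost of
    [expect_ext_close]. *)
Lemma mixture_close n N (eta : {ffun 'I_k.+1 -> int}) : extz eta 0 < N%:Z ->
  `|iter n (@transfer R t k) (@start R t k) eta -
    (\sum_(e < N) startcoef t e) * expect F n (point_mass R eta)| <=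
  (\sum_(e < N) `|startcoef t e| * q ^+ e) * (decay F R k / n.+2%:R).
Proof.
move=> hN; rewrite (iter_transfer_mixture n hN) mulr_suml -sumrB.
apply: le_trans (ler_norm_sum _ _ _) _; rewrite mulr_suml; apply: ler_sum => e _.
rewrite -mulrBr normrM -[X in _ <= X]mulrA ler_wpM2l //.
apply: (le_trans (@expect_ext_close F R k e n eta)).
apply: ler_wpM2l; last exact: expect_last.
by rewrite exprn_ge0 // ltW // q_gt0.
Qed.
End Mixture.

From mathcomp Require Import all_reals all_analysis.
Import numFieldNormedType.Exports.
Local Open Scope classical_set_scope.
Local Open Scope ring_scope.

(** * Gaussian bounds and Euler's identity *)

Section Gauss.
Variables (R : realType) (t : R).
Hypotheses (t0 : 0 < t) (t2 : t <= 2^-1).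

Lemma expt_cvg0 : (fun n => t ^+ n) @ \oo --> (0 : R).
Proof. by apply: cvg_expr; rewrite gtr0_norm //; apply: le_lt_trans t2 _; lra. Qed.

Lemma half_cvg0 : (fun n => (2^-1 : R) ^+ n) @ \oo --> (0 : R).
Proof. by apply: cvg_expr; rewrite gtr0_norm //; lra. Qed.

(** The ratio of consecutive terms of (2 rho)^j t^(j choose 2) is 2 rho t^j, which
    is at most 1 from some index on. *)
Lemma gauss_bound (rho : R) : 0 <= rho ->
  exists2 C, 0 <= C & forall j, rho ^+ j * t ^+ 'C(j, 2) <= C * 2^-1 ^+ j.
Proof.
move=> rho0; pose a := 2 * rho; pose x j := a ^+ j * t ^+ 'C(j, 2).
have a0 : 0 <= a by rewrite mulr_ge0.
have x0 j : 0 <= x j by rewrite mulr_ge0 // exprn_ge0 // ltW.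
have xS j : x j.+1 = x j * (a * t ^+ j).
  by rewrite /x binS bin1 exprS exprD; ring.
have [J hJ] : exists J, a * t ^+ J <= 1.
  have /cvgrPdist_le /(_ 1 ltr01) : (fun n => a * t ^+ n) @ \oo --> (a * 0 : R).
    by apply: cvgMr; exact: expt_cvg0.
  rewrite mulr0 => -[J _ /(_ J (leqnn J))] /=; rewrite sub0r normrN => h.
  by exists J; apply: le_trans h; rewrite ler_norm.
(* x decreases from J on, so that its maximum is attained at some j <= J. *)
exists (\sum_(i < J.+1) x i) => [|j]; first by apply: sumr_ge0.
have e : rho ^+ j * t ^+ 'C(j, 2) = x j * 2^-1 ^+ j.
  have two : (2 : R) ^+ j * 2^-1 ^+ j = 1 by rewrite -exprMn mulfV ?pnatr_eq0 // expr1n.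
  rewrite /x /a exprMn; transitivity ((2 ^+ j * 2^-1 ^+ j) * (rho ^+ j * t ^+ 'C(j, 2))).
    by rewrite two mul1r.
  by ring.
rewrite e ler_wpM2r ?exprn_ge0 ?invr_ge0 //.
have le n : (n <= J)%N -> x n <= \sum_(i < J.+1) x i.
  move=> nJ; rewrite (bigD1 (Ordinal (nJ : (n < J.+1)%N))) //= lerDl.
  by apply: sumr_ge0.
have [/le //|Jj] := leqP j J.
apply: le_trans (le J (leqnn J)); rewrite -(subnKC (ltnW Jj)).
elim: (j - J)%N => [|d IH]; first by rewrite addn0.
rewrite addnS xS; apply: le_trans IH; rewrite -[X in _ <= X]mulr1 ler_wpM2l //.
apply: le_trans hJ; rewrite ler_wpM2l // ler_wiXn2l ?leq_addr ?ltW //.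
by apply: le_lt_trans t2 _; lra.
Qed.

Lemma sum_half_le (C : R) J D : 0 <= C ->
  \sum_(J <= j < D) C * 2^-1 ^+ j <= 2 * C * 2^-1 ^+ J.
Proof.
move=> C0; have h0 n : 0 <= (2^-1 : R) ^+ n by rewrite exprn_ge0 // invr_ge0.
have [DJ|JD] := leqP D J; first by rewrite big_geq // !mulr_ge0.
rewrite -(subnKC (ltnW JD)).
suff -> : forall d, \sum_(J <= j < J + d) C * 2^-1 ^+ j = 2 * C * 2^-1 ^+ J - 2 * C * 2^-1 ^+ (J + d).
  by rewrite gerBl !mulr_ge0.
elim=> [|d IH]; first by rewrite addn0 big_geq // subrr.
rewrite addnS big_nat_recr ?leq_addr //= IH exprS; lra.
Qed.

(** The first terms of the pentagonal number series; the last power of t makes the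
    induction work. *)
Lemma qpoch_lower m : 1 - t - t ^+ 2 + t ^+ m.+2 <= qpoch t t m.+1.
Proof.
elim: m => [|m IH]; first by rewrite /qpoch big_ord1 expr0; lra.
rewrite /qpoch big_ord_recr /= -exprS; set x := t ^+ m.+2 in IH *.
have x0 : 0 <= x by rewrite exprn_ge0 // ltW.
have xt : x <= t ^+ 2 by rewrite ler_wiXn2l ?ltW //; apply: le_lt_trans t2 _; lra.
rewrite exprS -/x; move: IH; rewrite /qpoch; set Q := \prod_(i < m.+1) _ => IH.
have tt : t ^+ 2 <= 4^-1 by have := t0; have := t2; nra.
have x1 : 0 <= 1 - x by lra.
apply: le_trans (ler_wpM2r x1 IH).
have -> : (1 - t - t ^+ 2 + x) * (1 - x) = (1 - t - t ^+ 2) + t * x + x * (t ^+ 2 - x) by ring.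
by rewrite lerDl mulr_ge0 // subr_ge0.
Qed.

Lemma qpoch_ge4 m : 4^-1 <= qpoch t t m.
Proof.
case: m => [|m]; first by rewrite /qpoch big_ord0; lra.
apply: le_trans (qpoch_lower m); have h : 0 <= t ^+ m.+2 by rewrite exprn_ge0 // ltW.
have tt : t ^+ 2 <= 4^-1 by have := t0; have := t2; nra.
have := t2; lra.
Qed.

Lemma qpoch_gt0 m : 0 < qpoch t t m.
Proof. by apply: lt_le_trans (qpoch_ge4 m); lra. Qed.

Lemma qpoch_inv_le m : (qpoch t t m)^-1 <= 4.
Proof.
by rewrite invf_ple ?posrE ?qpoch_gt0 ?qpoch_ge4 //.
Qed.

Lemma qpoch_cvg : cvgn (qpoch t t).
Proof.
apply: nonincreasing_is_cvgn.
  apply/nonincreasing_seqP => m; rewrite /qpoch big_ord_recr /= ger_pMr ?qpoch_gt0 //.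
  by rewrite gerBl mulr_ge0 ?exprn_ge0 // ltW.
by exists 4^-1 => _ [m _ <-]; exact: qpoch_ge4.
Qed.

Definition qpoch_oo : R := limn (qpoch t t).

Lemma qpoch_oo_ge4 : 4^-1 <= qpoch_oo.
Proof. by apply: limr_ge; [exact: qpoch_cvg | near=> n; exact: qpoch_ge4]. Unshelve. all: by end_near. Qed.

Lemma qpoch_oo_gt0 : 0 < qpoch_oo.
Proof. by apply: lt_le_trans qpoch_oo_ge4; lra. Qed.

(** The terms of Euler's expansion of (t^m; t)_oo. *)
Definition euler_term (m e : nat) : R := (-1) ^+ e * t ^+ ('C(e, 2) + m * e) / qpoch t t e.

Lemma startcoef_euler e : startcoef t e = euler_term 1 e.
Proof. by rewrite /startcoef /euler_term binS bin1 mul1n. Qed.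

Lemma euler_rec m N : \sum_(e < N.+1) euler_term m e =
  (1 - t ^+ m) * \sum_(e < N.+1) euler_term m.+1 e + t ^+ m * euler_term m.+1 N.
Proof.
suff : \sum_(e < N.+1) (euler_term m e - euler_term m.+1 e) =
    - t ^+ m * \sum_(e < N) euler_term m.+1 e.
  rewrite sumrB => /eqP; rewrite subr_eq => /eqP ->.
  by rewrite [\sum_(e < N.+1) _]big_ord_recr /=; ring.
rewrite big_ord_recl /euler_term !muln0 subrr add0r mulr_sumr.
apply: eq_bigr => e _; rewrite /bump /=.
have h := qpoch_gt0 e; have h' := qpoch_gt0 e.+1.
have E : (qpoch t t e)^-1 = (1 - t ^+ e.+1) * (qpoch t t e.+1)^-1.
  by move: h'; rewrite /qpoch big_ord_recr /= -exprS => h'; field; move: h'; rewrite pmulr_rgt0 // => h'; rewrite !gt_eqF.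
by rewrite E binS bin1 !mulnS !mulSn !exprD !exprS; ring.
Qed.

Lemma euler_term_bound : exists2 C, 0 <= C & forall m e, `|euler_term m e| <= C * 2^-1 ^+ e * t ^+ (m * e).
Proof.
have [C C0 hC] := gauss_bound ler01.
exists (4 * C) => [|m e]; first by rewrite mulr_ge0.
have tn n : 0 <= t ^+ n by rewrite exprn_ge0 // ltW.
have qn : 0 <= (qpoch t t e)^-1 by rewrite invr_ge0 ltW // qpoch_gt0.
rewrite /euler_term exprD !normrM normrX normrN1 expr1n mul1r.
rewrite (ger0_norm (tn _)) (ger0_norm (tn _)) (ger0_norm qn).
rewrite mulrAC ler_wpM2r // mulrC -mulrA.
apply: ler_pM => //; first exact: qpoch_inv_le.
by have := hC e; rewrite expr1n mul1r.
Qed.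

(** The factorization (t; t)_oo = (t; t)_M (t^(M+1); t)_oo holds for the truncated
    expansions up to their last terms [euler_rec]; it is used with M = N, where the
    second factor is close to 1. *)
Lemma euler_sum : (fun N => \sum_(e < N) startcoef t e) @ \oo --> qpoch_oo.
Proof.
have [C C0 hC] := euler_term_bound.
pose A m N := \sum_(e < N) euler_term m e.
have t1 : t <= 1 by apply: le_trans t2 _; lra.
have h0 n : 0 <= (2^-1 : R) ^+ n by rewrite exprn_ge0 // invr_ge0.
have q1 m : qpoch t t m <= 1.
  by apply: prodr_ile1 => i _; rewrite subr_ge0 -exprS gerBl exprn_ile1 ?exprn_ge0 // ltW.
have step M N : `|A 1%N N.+1 - qpoch t t M * A M.+1 N.+1| <= C * 2^-1 ^+ N * \sum_(i < M) t ^+ i.+1.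
  elim: M => [|M IH]; first by rewrite /qpoch !big_ord0 mul1r subrr normr0 mulr0.
  have -> : A 1%N N.+1 - qpoch t t M.+1 * A M.+2 N.+1 =
     (A 1%N N.+1 - qpoch t t M * A M.+1 N.+1) + qpoch t t M * (t ^+ M.+1 * euler_term M.+2 N).
    have qS : qpoch t t M.+1 = qpoch t t M * (1 - t ^+ M.+1).
      by rewrite /qpoch big_ord_recr /= -exprS.
    by rewrite qS /A (euler_rec M.+1 N); ring.
  apply: le_trans (ler_normD _ _) _; rewrite big_ord_recr mulrDr /= lerD //.
  have tn n : 0 <= t ^+ n by rewrite exprn_ge0 // ltW.
  move: (euler_term M.+2 N) (hC M.+2 N) => u hu.
  rewrite !normrM [`|qpoch t t M|]gtr0_norm ?qpoch_gt0 // (ger0_norm (tn _)).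
  have -> : C * 2^-1 ^+ N * t ^+ M.+1 = 1 * (t ^+ M.+1 * (C * 2^-1 ^+ N)) by ring.
  apply: ler_pM => //; first by rewrite ltW // qpoch_gt0.
    by rewrite mulr_ge0.
  rewrite ler_wpM2l //; apply: le_trans hu _.
  by rewrite ler_piMr ?mulr_ge0 // exprn_ile1 // ltW.
have gsum M : \sum_(i < M) t ^+ i.+1 <= 1.
  suff : \sum_(i < M) t ^+ i.+1 <= 1 - 2^-1 ^+ M by move=> h; apply: le_trans h _; rewrite gerBl.
  elim: M => [|M IH]; first by rewrite big_ord0 subrr.
  rewrite big_ord_recr /=; have hx : t ^+ M.+1 <= 2^-1 ^+ M.+1 by rewrite lerXn2r ?nnegrE ?invr_ge0 // ltW.
  have e := exprS (2^-1 : R) M; lra.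
have tail M N : `|A M.+1 N.+1 - 1| <= 2 * C * t ^+ M.
  rewrite /A big_ord_recl /euler_term muln0 addn0 !expr0 {1}/qpoch big_ord0 divr1 mulr1.
  rewrite addrAC subrr add0r; apply: le_trans (ler_norm_sum _ _ _) _.
  apply: (@le_trans _ _ (\sum_(e < N) (C * 2^-1 ^+ e.+1) * t ^+ M)).
    apply: ler_sum => e _; apply: le_trans (hC _ _) _.
    rewrite ler_wpM2l ?mulr_ge0 // ler_wiXn2l //; first exact: ltW.
    by rewrite -[X in (X <= _)%N]muln1; apply: leq_mul.
  rewrite -mulr_suml ler_wpM2r ?exprn_ge0 ?(ltW t0) //.
  have := @sum_half_le C 0 N.+1 C0; rewrite expr0 mulr1 big_mkord big_ord_recl /=.
  by apply: le_trans; rewrite lerDr mulr_ge0.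
have main N : `|A 1%N N.+1 - qpoch t t N| <= C * 2^-1 ^+ N + 2 * C * t ^+ N.
  have -> : A 1%N N.+1 - qpoch t t N = (A 1%N N.+1 - qpoch t t N * A N.+1 N.+1) +
      qpoch t t N * (A N.+1 N.+1 - 1) by ring.
  apply: le_trans (ler_normD _ _) _; apply: lerD.
    by apply: le_trans (step N N) _; rewrite ler_piMr ?mulr_ge0.
  rewrite normrM -[X in _ <= X]mul1r; apply: ler_pM => //.
  by rewrite gtr0_norm ?qpoch_gt0.
rewrite -(cvg_shiftS (fun N => \sum_(e < N) startcoef t e)).
have -> : (fun N => \sum_(e < N.+1) startcoef t e) =
    (fun N => (A 1%N N.+1 - qpoch t t N) + qpoch t t N).
  by apply/funext => N; rewrite subrK; apply: eq_bigr => e _; rewrite startcoef_euler.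
rewrite -[qpoch_oo]add0r; apply: cvgD; last exact: qpoch_cvg.
apply/norm_cvg0P.
apply: (@squeeze_cvgr _ _ _ _ (fun=> 0) (fun N => C * 2^-1 ^+ N + 2 * C * t ^+ N)).
- by near=> N; rewrite normr_ge0 main.
- exact: cvg_cst.
- rewrite -[X in _ --> X](_ : C * 0 + 2 * C * 0 = 0); last by rewrite !mulr0 addr0.
  by apply: cvgD; apply: cvgMr; [exact: half_cvg0 | exact: expt_cvg0].
Unshelve. all: by end_near. Qed.

Lemma startcoef_moment : exists2 B, 0 <= B &
  forall N, \sum_(e < N) `|startcoef t e| * t^-1 ^+ e <= B.
Proof.
have [C C0 hC] := euler_term_bound; exists (2 * C) => [|N]; first by rewrite mulr_ge0.
have := @sum_half_le C 0 N C0; rewrite expr0 mulr1 big_mkord; apply: le_trans.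
apply: ler_sum => e _; rewrite startcoef_euler.
have te : 0 < t ^+ e by rewrite exprn_gt0.
rewrite exprVn ler_pdivrMr //; apply: le_trans (hC _ _) _.
by rewrite mul1n.
Qed.
End Gauss.

(** * The terms of the limit law *)

Lemma signature_dominant n (w : {ffun 'I_n -> int}) d : signature n w ->
  (forall i, d <= w i) -> dominant (w - constvec n d).
Proof.
move=> sw hd i; have [ik|ik] := ltnP i.+1 n.
  rewrite !extz_subconst // 1?ltnW // lerD2r.
  have := @sw (Ordinal (ltnW ik)) (Ordinal ik) (leqnSn i).
  by rewrite -!extz_ord.
rewrite [extz _ i.+1]extz_out //; have [ik'|ik'] := ltnP i n; last by rewrite extz_out.
by rewrite extz_subconst // -[i]/(nat_of_ord (Ordinal ik')) extz_ord subr_ge0.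
Qed.

Lemma wt_subconst n (w : {ffun 'I_n -> int}) d : wt (w - constvec n d) = wt w - n%:Z * d.
Proof.
rewrite /wt (eq_bigr (fun i => w i - d)); last by move=> i _; rewrite !ffunE.
by rewrite sumrB sumr_const card_ord -mulr_natl natz.
Qed.

Section SignatureVectors.
Variables (k : nat) (L : {ffun 'I_k.+1 -> int}).
Lemma extz_curE (i : 'I_k) : extz L i = cur L i.
Proof. exact: (extz_ord L (widen_ord (leqnSn k) i)). Qed.

Lemma extz_nxtE (i : 'I_k) : extz L i.+1 = nxt L i.
Proof. exact: (extz_ord L (lift ord0 i)). Qed.

End SignatureVectors.

Section LimitTerm.
Variables (R : realType) (t : R).
Hypotheses (t0 : 0 < t) (t2 : t <= 2^-1).

(** The Poisson probability of m for the mean y. *)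
Definition poi (y : R) (m : nat) : R := expR (- y) * (y ^+ m / m`!%:R).

Lemma small_neq0 : t != 0. Proof. by rewrite gt_eqF. Qed.

Lemma small_neq1 i : t ^+ i.+1 != 1.
Proof.
by rewrite lt_eqF // exprn_ilt1 // ?ltW //; apply: le_lt_trans t2 _; lra.
Qed.

Lemma ip_abs z : 0 <= z -> ip t z = (qpoch t t `|z|%N)^-1.
Proof. by case: z. Qed.

Variables (k : nat) (L : {ffun 'I_k.+1 -> int}).
Hypothesis sL : signature k.+1 L.

Lemma weight_interlaces d (mu : {ffun 'I_k -> int}) : d <= L ord_max ->
  interlaces mu L ->
  t ^+ (\sum_(i < k.+1) 'C(`|L i - d|%N, 2)) /
   (qpoch t t `|L ord_max - d|%N * \prod_(i < k) qpoch t t `|cur L i - nxt L i|%N) *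
  ((-1) ^ (wt L - wt mu - d) *
      (\prod_(i < k) qbinom `|cur L i - nxt L i|%N `|cur L i - mu i|%N t)) =
  weight t (L - constvec k.+1 d) (mu - constvec k d).
Proof.
move=> hd hmu; have hq m : qpoch t t m != 0 by rewrite gt_eqF // qpoch_gt0.
rewrite /weight !wt_subconst.
have -> : wt L - k.+1%:Z * d - (wt mu - k%:Z * d) = wt L - wt mu - d.
  by rewrite intS; ring.
have -> : \prod_(i < k.+1) t ^ tri ((L - constvec k.+1 d) i) =
    t ^+ (\sum_(i < k.+1) 'C(`|L i - d|%N, 2)).
  rewrite -prodrXr; apply: eq_bigr => i _; rewrite !ffunE.
  have h : d <= L i by apply: le_trans hd _; apply: sL; rewrite -ltnS ltn_ord.
  by rewrite -[X in tri X]gez0_abs ?subr_ge0 // tri_nat.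
set T := t ^+ (\sum_(i < _) _).
rewrite big_ord_recr /= [extz (mu - _) k]extz_out // subr0.
have -> : ip t (extz (L - constvec k.+1 d) k) = (qpoch t t `|L ord_max - d|%N)^-1.
  by rewrite extz_subconst // -[k in extz _ k]/(nat_of_ord (@ord_max k)) extz_ord ip_abs // subr_ge0.
rewrite [\prod_(i < k) ip t (extz (L - _) i - _)](eq_bigr (fun i : 'I_k =>
  (qpoch t t `|cur L i - mu i|%N)^-1)) => [|i _]; last first.
  have ik : (i < k.+1)%N by rewrite ltnW // ltnS.
  rewrite extz_subconst // extz_subconst // extz_curE extz_ord.
  have /andP[_ h] := hmu i.
  by rewrite ip_abs; [congr (qpoch _ _ `|_|%N)^-1; ring | lia].
rewrite [\prod_(i < k) ip t (extz (mu - _) i - _)](eq_bigr (fun i : 'I_k =>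
  (qpoch t t `|mu i - nxt L i|%N)^-1)) => [|i _]; last first.
  rewrite extz_subconst // extz_subconst ?ltnS // extz_nxtE extz_ord.
  have /andP[h _] := hmu i.
  by rewrite ip_abs; [congr (qpoch _ _ `|_|%N)^-1; ring | lia].
rewrite [\prod_(i < k) qbinom _ _ _](eq_bigr (fun i : 'I_k =>
   qpoch t t `|cur L i - nxt L i|%N * ((qpoch t t `|cur L i - mu i|%N)^-1 *
   (qpoch t t `|mu i - nxt L i|%N)^-1))) => [|i _]; last first.
  rewrite /qbinom invfM; congr (_ * (_ * (qpoch t t _)^-1)).
  have /andP := hmu i; lia.
rewrite !big_split /= invfM.
have hP : \prod_(i < k) qpoch t t `|cur L i - nxt L i|%N != 0.
  by apply/prodf_neq0 => i _.
by field; rewrite ?hq ?hP.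
Qed.

(** Each Q in the term is replaced with its finite Taylor expansion in chi t^d, and
    the sums are exchanged; [weight] extends the sum to all integer vectors. *)
Lemma Lterm_expansion chi d M : d <= L ord_max -> k%:Z * `|L ord0 - d| < M%:Z ->
  Lterm t chi L d = \sum_(m < M) poi (chi * t ^ d) m * wsum t m (L - constvec k.+1 d).
Proof.
move=> hd hM; set y := chi * t ^ d.
have h1t : 1 - t != 0 by rewrite subr_eq0 eq_sym -[t]expr1 small_neq1.
have hmuP mu : interlaces mu L -> wt (mu - constvec k d) < M%:Z.
  move=> hmu; apply: le_lt_trans hM; rewrite wt_subconst.
  have : wt mu <= k%:Z * L ord0.
    rewrite /wt; apply: (@le_trans _ _ (\sum_(i < k) L ord0)).
      apply: ler_sum => i _; have /andP[_ h] := hmu i; apply: le_trans h _.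
      exact: sL.
    by rewrite sumr_const card_ord -mulr_natl natz.
  have h0 : d <= L ord0 by apply: le_trans hd _; apply: sL.
  by rewrite ger0_norm ?subr_ge0 // mulrBr; lia.
pose G mu := weight t (L - constvec k.+1 d) (mu - constvec k d) *
   \sum_(m < M) poi y m * gcoef t m (mu - constvec k d).
have [N hN] := extz_bound (L - constvec k.+1 d).
transitivity (\sum_(mu \in [set: {ffun 'I_k -> int}]) G mu); last first.
  transitivity (\sum_(v \in [set: {ffun 'I_k -> int}])
      weight t (L - constvec k.+1 d) v * \sum_(m < M) poi y m * gcoef t m v).
    symmetry; exact: (fsum_shift (fun v => weight t (L - constvec k.+1 d) v *
      \sum_(m < M) poi y m * gcoef t m v) (- constvec k d)).
  rewrite (fsum_box (N := N) (F := fun v => weight t (L - constvec k.+1 d) v *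
      \sum_(m < M) poi y m * gcoef t m v)) //; last first.
    by move=> v; rewrite mulf_eq0 negb_or => /andP[/(weight_in_box small_neq0 hN)].
  under [RHS]eq_bigr do rewrite (wsum_box small_neq0 _ hN) mulr_sumr.
  rewrite exchange_big; apply: eq_bigr => f _ /=.
  by rewrite mulr_sumr; apply: eq_bigr => m _; ring.
rewrite /Lterm.
set A := [set mu | _].
have finA : finite_set A.
  have [N' hN'] := extz_bound L.
  apply: (@sub_finite_set _ _ [set of_box f | f in [set: {ffun 'I_k -> 'I_(N' + N').+1}]]).
    move=> mu [_ hmu]; have [|f ->] := @in_boxP k N' mu; last by exists f.
    move=> i; have := hmu i; have := hN' i; have := hN' i.+1.
    rewrite extz_curE extz_nxtE; lia.
  exact/finite_image/finite_finset.
transitivity (\sum_(mu \in A) G mu); last first.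
  apply: fsbig_widen => // mu [_ nA] /=; rewrite /G.
  have [->|hw] := eqVneq (weight t (L - constvec k.+1 d) (mu - constvec k d)) 0; first by rewrite mul0r.
  case: nA; have [_ h1 h2] := weight_support hw; have [_ hv] := weight_dominant hw.
  have e i : (i < k)%N -> extz (mu - constvec k d) i = extz mu i - d by exact: extz_subconst.
  split=> [i j ij|i].
    have := dominant_le hv ij; rewrite !e // !extz_ord; lia.
  have ik : (i < k.+1)%N by rewrite ltnW // ltnS.
  have := h1 i; have := h2 i; rewrite e // !extz_subconst ?ltnS // extz_ord extz_curE extz_nxtE.
  by lia.
rewrite mulr_fsumr //.
apply: eq_fsbigr => mu /set_mem [smu hmu]; rewrite /G -weight_interlaces //.
have ev : [ffun i => mu i - d] = mu - constvec k d by apply/ffunP => i; rewrite !ffunE.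
have domv : dominant (mu - constvec k d).
  apply: signature_dominant => // i; apply: le_trans hd _.
  have /andP[h _] := hmu i; apply: le_trans h.
  by apply: sL; rewrite -ltnS ltn_ord.
rewrite (@HLQ_gamma_alpha_expansion _ t small_neq1 k mu d _ M) ?ev ?hmuP //.
have -> : (1 - t) * t ^ d * chi / (1 - t) = y.
  by rewrite /y; field.
have -> : \sum_(m < M) poi y m * gcoef t m (mu - constvec k d) =
  expR (- y) * \sum_(m < M) y ^+ m / m`!%:R * gcoef t m (mu - constvec k d).
  by rewrite mulr_sumr; apply: eq_bigr => m _; rewrite /poi; ring.
ring.
Qed.
End LimitTerm.

(** * Absolute convergence *)

Section WsumBound.
Variables (R : realType) (t : R).
Hypotheses (t0 : 0 < t) (t2 : t <= 2^-1).

Let t1 : t <= 1. Proof. by apply: le_trans t2 _; lra. Qed.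

Lemma onem_expz_itv (z : int) : 0 <= z -> 0 <= 1 - t ^ z <= 1.
Proof.
case: z => // n _; rewrite -exprnP subr_ge0 gerBl exprn_ge0 ?(ltW t0) // andbT.
by rewrite exprn_ile1 // ltW.
Qed.

Lemma gcoef_bound m k (v : {ffun 'I_k -> int}) : dominant v ->
  `|gcoef t m v| <= k%:R ^+ m.
Proof.
elim: m v => [|m IH] v hv /=.
  case: ifP => _; first by rewrite normr1.
  by case: ifP => _; rewrite ?normr0 // ger0_norm ?subr_ge0 // gerBl ltW.
apply: le_trans (ler_norm_sum _ _ _) _.
apply: (@le_trans _ _ (\sum_(j < k) k%:R ^+ m)); last first.
  by rewrite sumr_const card_ord exprS mulr_natl.
apply: ler_sum => j _; have := hv j; rewrite le_eqVlt => /orP[/eqP->|hj].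
  by rewrite subrr expr0z subrr mul0r normr0 exprn_ge0.
have /andP[h0 h1] := @onem_expz_itv (extz v j - extz v j.+1) ltac:(lia).
rewrite normrM (ger0_norm h0) -[X in _ <= X]mul1r; apply: ler_pM => //.
by apply: IH; exact: dominant_subunit.
Qed.

Lemma ip_bound z : 0 <= ip t z <= 4.
Proof.
case: z => [n|n] /=; last by rewrite lexx ler0n.
by rewrite qpoch_inv_le // invr_ge0 ltW // qpoch_gt0.
Qed.

Lemma tri_ge0 z : 0 <= tri z.
Proof. by rewrite /tri divz_ge0 //; case: z => [[|n]|n]; rewrite ?mul0r //; nia. Qed.

Variable k : nat.
Implicit Types (th : {ffun 'I_k.+1 -> int}) (v : {ffun 'I_k -> int}).

Lemma weight_bound th v (j : nat) : extz th k = j%:Z ->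
  `|weight t th v| <= 4 ^+ (k.+1 + k) * t ^+ 'C(j, 2).
Proof.
move=> hj; rewrite /weight normrM.
have -> : `|(-1) ^ (wt th - wt v)| = 1 :> R.
  by case: (wt th - wt v) => n; rewrite ?NegzE -?exprnN -?exprnP ?normrV ?normrX ?normrN1 ?expr1n ?invr1 // unitrX // unitrN unitr1.
have tt z : 0 <= t ^ tri z <= 1.
  case: (tri z) (tri_ge0 z) => // n _.
  by rewrite -exprnP exprn_ge0 ?exprn_ile1 // ltW.
have iA n (z : 'I_n -> int) : 0 <= \prod_i ip t (z i) <= 4 ^+ n.
  rewrite prodr_ge0 /=; last by move=> i _; case/andP: (ip_bound (z i)).
  rewrite -[X in _ ^+ X]card_ord -prodr_const; apply: ler_prod => i _; exact: ip_bound.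
have T0 : 0 <= \prod_(i < k.+1) t ^ tri (th i).
  by apply: prodr_ge0 => i _; case/andP: (tt (th i)).
have T1 : \prod_(i < k.+1) t ^ tri (th i) <= t ^+ 'C(j, 2).
  rewrite (bigD1 ord_max) //= -extz_ord /= hj tri_nat -exprnP.
  rewrite -[X in _ <= X]mulr1 ler_wpM2l ?exprn_ge0 ?(ltW t0) //.
  by apply: prodr_ile1 => i _; exact: tt.
have /andP[a0 a1] := iA k.+1 (fun i => extz th i - extz v i).
have /andP[b0 b1] := iA k (fun i => extz v i - extz th i.+1).
rewrite mul1r ger0_norm ?mulr_ge0 // [X in _ <= X]mulrC exprD.
by rewrite ler_pM ?mulr_ge0 // ler_pM.
Qed.

Lemma weight_wt th v x : weight t th v != 0 -> extz th 0 <= x%:Z ->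
  0 <= wt v <= k%:Z * x%:Z.
Proof.
move=> hw hx; have [_ hv] := weight_dominant hw; have [_ _ h2] := weight_support hw.
have [hth _] := weight_dominant hw.
apply/andP; split; first by apply: sumr_ge0 => i _; rewrite -extz_ord dominant_ge0.
rewrite /wt; apply: (@le_trans _ _ (\sum_(i < k) x%:Z)).
  apply: ler_sum => i _; rewrite -extz_ord; apply: le_trans (h2 i) _.
  by apply: le_trans hx; exact: dominant_le.
by rewrite sumr_const card_ord -mulr_natl natz.
Qed.

Lemma wsum_eq0 m th (x : nat) : extz th 0 <= x%:Z -> (k * x < m)%N -> wsum t m th = 0.
Proof.
move=> hx hm; apply: fsbig1 => v _.
have [->|hw] := eqVneq (weight t th v) 0; first by rewrite mul0r.
rewrite gcoef_eq0 ?mulr0 //; first by case: (weight_dominant hw).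
by have := weight_wt hw hx; lia.
Qed.

Lemma wsum_bound m th (x j : nat) : dominant th -> extz th 0 <= x%:Z ->
  extz th k = j%:Z ->
  `|wsum t m th| <= (x + x).+1%:R ^+ k * (4 ^+ (k.+1 + k) * t ^+ 'C(j, 2)) * k%:R ^+ m.
Proof.
move=> hth hx hj.
have hN i : `|extz th i| <= x%:Z.
  rewrite ger0_norm ?dominant_ge0 //; apply: le_trans hx; exact: dominant_le.
rewrite (wsum_box (small_neq0 t0) _ hN); apply: le_trans (ler_norm_sum _ _ _) _.
set B := 4 ^+ _ * _; have B0 : 0 <= B by rewrite mulr_ge0 ?exprn_ge0 ?(ltW t0).
apply: (@le_trans _ _ (\sum_(f : {ffun 'I_k -> 'I_(x + x).+1}) B * k%:R ^+ m)).
  apply: ler_sum => f _; rewrite normrM.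
  have [->|hw] := eqVneq (weight t th (of_box f)) 0.
    by rewrite normr0 mul0r mulr_ge0 ?exprn_ge0.
  apply: ler_pM => //; first exact: weight_bound.
  by apply: gcoef_bound; case: (weight_dominant hw).
by rewrite sumr_const card_ffun !card_ord -[_ *+ (_ ^ _)]mulr_natl natrX mulrA.
Qed.

Lemma pow_sum_le n : \sum_(m < n) (k%:R : R) ^+ m <= k.+2%:R ^+ n.
Proof.
elim: n => [|n IH]; first by rewrite big_ord0 expr0 ler01.
have e : k.+2%:R = k.+1%:R + 1 :> R by rewrite natr1.
rewrite big_ord_recr exprS {1}e mulrDl mul1r addrC /= lerD //.
apply: (@le_trans _ _ (k.+2%:R ^+ n)).
  by rewrite lerXn2r ?nnegrE // ler_nat; lia.
by rewrite ler_peMl ?exprn_ge0 // ler1n.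
Qed.

(** For x = j + L_0 - L_k, the sum has at most (2x + 1)^k nonzero terms for each
    m, and m <= k x; these exponential factors in j are absorbed by t^(j choose 2)
    [gauss_bound]. *)
Lemma wsum_total_bound (L : {ffun 'I_k.+1 -> int}) : signature k.+1 L ->
  exists2 C, 0 <= C & forall j M,
    \sum_(m < M) `|wsum t m (L - constvec k.+1 (L ord_max - j%:Z))| <= C * 2^-1 ^+ j.
Proof.
move=> sL; pose w := `|L ord0 - L ord_max|%N.
have hw : L ord0 - L ord_max = w%:Z by rewrite /w gez0_abs // subr_ge0; apply: sL.
pose rho : R := (4 * k.+2%:R) ^+ k.
have rho0 : 0 <= rho by rewrite exprn_ge0 // mulr_ge0.
have [C C0 hC] := gauss_bound t0 t2 rho0.
exists (k.+2%:R * 4 ^+ (k.+1 + k) * rho ^+ w * C) => [|j M].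
  by rewrite !mulr_ge0 ?exprn_ge0.
set th := L - _; pose x := (j + w)%N.
have hth : dominant th.
  apply: signature_dominant => // i; apply: (@le_trans _ _ (L ord_max)); first by rewrite gerBl.
  by apply: sL; rewrite -ltnS ltn_ord.
have hj : extz th k = j%:Z.
  rewrite extz_subconst // -[k in extz _ k]/(nat_of_ord (@ord_max k)) extz_ord.
  by rewrite opprB addrC subrK.
have hx : extz th 0 <= x%:Z.
  rewrite extz_subconst // -[0%N]/(nat_of_ord (@ord0 k)) extz_ord /x PoszD -hw.
  by rewrite opprB addrCA.
pose B := (x + x).+1%:R ^+ k * (4 ^+ (k.+1 + k) * t ^+ 'C(j, 2)).
have B0 : 0 <= B by rewrite !mulr_ge0 ?exprn_ge0 ?(ltW t0).
apply: (@le_trans _ _ (\sum_(m < (k * x).+1) B * k%:R ^+ m)).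
  rewrite -(big_mkord xpredT (fun m => `|wsum t m th|)).
  rewrite -(big_mkord xpredT (fun m => B * k%:R ^+ m)).
  have z m : (k * x < m)%N -> `|wsum t m th| = 0 by move=> h; rewrite (wsum_eq0 hx h) normr0.
  apply: (@le_trans _ _ (\sum_(0 <= m < (k * x).+1) `|wsum t m th|)).
    have [h|h] := leqP M (k * x).+1.
      rewrite [X in _ <= X](@big_cat_nat _ _ _ M) //= lerDl; exact: sumr_ge0.
    rewrite (@big_cat_nat _ _ _ (k * x).+1) //=; last exact: ltnW.
    by rewrite [X in _ + X]big_nat_cond [X in _ + X]big1 ?addr0 // => m /andP[/andP[hm _] _]; exact: z.
  by apply: ler_sum => m _; exact: wsum_bound.
rewrite -mulr_sumr; apply: le_trans (ler_wpM2l B0 (pow_sum_le _)) _.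
have hx4 : (x + x).+1%:R <= 4 ^+ x :> R.
  by rewrite -natrX ler_nat; elim: (x) => // n IH; rewrite expnS; lia.
have e : k.+2%:R * 4 ^+ (k.+1 + k) * rho ^+ w * C * 2^-1 ^+ j =
   k.+2%:R * 4 ^+ (k.+1 + k) * rho ^+ w * (C * 2^-1 ^+ j) by rewrite !mulrA.
rewrite e; apply: (@le_trans _ _ (k.+2%:R * 4 ^+ (k.+1 + k) * rho ^+ w * (rho ^+ j * t ^+ 'C(j, 2)))).
  have -> : k.+2%:R * 4 ^+ (k.+1 + k) * rho ^+ w * (rho ^+ j * t ^+ 'C(j, 2)) =
     (4 ^+ x) ^+ k * (4 ^+ (k.+1 + k) * t ^+ 'C(j, 2)) * k.+2%:R ^+ (k * x).+1.
    by rewrite /rho /x exprS exprM [(4 ^+ (j + w)) ^+ k]exprAC !exprMn !exprD; ring.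
  rewrite /B ler_wpM2r ?exprn_ge0 // ler_wpM2r ?mulr_ge0 ?exprn_ge0 ?(ltW t0) //.
  by rewrite lerXn2r ?nnegrE ?exprn_ge0.
by rewrite ler_wpM2l ?mulr_ge0 ?exprn_ge0.
Qed.
End WsumBound.

(** * The Poisson limit of binomial probabilities *)

Section Poisson.
Variable R : realType.
Implicit Types x y : R.

Lemma bernoulli_onem n x : 0 <= x <= 1 -> 1 - n%:R * x <= (1 - x) ^+ n.
Proof.
move=> /andP[x0 x1]; elim: n => [|n IH]; first by rewrite mul0r subr0.
rewrite exprS -natr1; have h : 0 <= 1 - x by lra.
have n0 : 0 <= n%:R * x * x by rewrite !mulr_ge0.
apply: le_trans (ler_wpM2l h IH); nra.
Qed.

Lemma binweight_itv n m x : 0 <= x <= 1 -> 0 <= binweight n m x <= 1.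
Proof.
move=> /andP[x0 x1]; have x1' : 0 <= 1 - x by lra.
apply/andP; split; first by rewrite !mulr_ge0 ?exprn_ge0.
elim: n m => [|n IH] [|m].
- by rewrite /binweight !mul1r.
- by rewrite binweight_out.
- by rewrite /binweight bin0 !mul1r exprn_ile1 // gerBl.
rewrite binweightS; have := IH m; have := IH m.+1.
move: (binweight n m x) (binweight n m.+1 x) => a b hb ha; nra.
Qed.

Lemma ffact_bounds n m i : (i <= m)%N -> ((n - m) ^ i <= n ^_ i <= n ^ i)%N.
Proof.
elim: i => [|i IH] im; first by rewrite ffactn0 !expn0 leqnn.
have /andP[h1 h2] := IH (ltnW im).
rewrite ffactnSr !expnSr !leq_mul ?leq_subr //; lia.
Qed.

(** Here a is the ratio of the falling factorial of n to n^m and b is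
    (1 - y/n)^(n-m), to be compared with 1 and exp(-y). *)
Lemma binweight_poi n m y : (0 < n)%N -> (m <= n)%N -> 0 <= y <= n%:R ->
  2 * y * m%:R <= n%:R ->
  `|binweight n m (y / n%:R) - poi y m| <=
  y ^+ m * (m%:R ^+ 2 + y ^+ 2 + 2 * y * m%:R) / n%:R.
Proof.
move=> n0 mn /andP[y0 yn] hym; have N0 : 0 < n%:R :> R by rewrite ltr0n.
have Nn0 : n%:R != 0 :> R by rewrite gt_eqF.
pose u := y / n%:R.
have u0 : 0 <= u by rewrite divr_ge0.
have u1 : u <= 1 by rewrite ler_pdivrMr // mul1r.
pose a : R := 'C(n, m)%:R * m`!%:R / n%:R ^+ m.
pose b := (1 - u) ^+ (n - m).
pose c := y ^+ m / m`!%:R.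
have f0 : m`!%:R != 0 :> R by rewrite pnatr_eq0 -lt0n fact_gt0.
have c0 : 0 <= c by rewrite divr_ge0 ?exprn_ge0.
have cy : c <= y ^+ m.
  by rewrite ler_pdivrMr ?ltr0n ?fact_gt0 // ler_peMr ?exprn_ge0 // ler1n fact_gt0.
have eB : binweight n m u = c * (a * b).
  rewrite /binweight -/b /c /a /u expr_div_n; field.
  by rewrite expf_neq0.
have eP : poi y m = c * expR (- y) by rewrite /poi mulrC.
have /andP[a_lo a_hi] : 1 - m%:R ^+ 2 / n%:R <= a <= 1.
  have /andP[h1 h2] := @ffact_bounds n m m (leqnn m).
  rewrite /a -natrM bin_ffact; apply/andP; split; last first.
    by rewrite ler_pdivrMr ?exprn_gt0 // mul1r -natrX ler_nat.
  apply: (@le_trans _ _ ((1 - m%:R / n%:R) ^+ m)).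
    have := @bernoulli_onem m (m%:R / n%:R); rewrite mulrA -expr2; apply.
    by rewrite divr_ge0 //= ler_pdivrMr // mul1r ler_nat.
  have -> : 1 - m%:R / n%:R = (n - m)%:R / n%:R :> R by rewrite natrB //; field.
  rewrite expr_div_n ler_wpM2r ?invr_ge0 ?exprn_ge0 //.
  by rewrite -natrX ler_nat.
have b0 : 0 <= b by rewrite exprn_ge0 // subr_ge0.
have b1 : b <= 1 by rewrite exprn_ile1 ?subr_ge0 // gerBl.
have e1 : expR (- y) <= 1 by rewrite -[X in _ <= X]expR0 ler_expR oppr_le0.
have e0 : 0 <= expR (- y) := expR_ge0 _.
have b_lo : expR (- y) - y ^+ 2 / n%:R <= b.
  apply: (@le_trans _ _ ((1 - u) ^+ n)); last first.
    by rewrite ler_wiXn2l ?leq_subr ?subr_ge0 ?gerBl.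
  have hu : expR (- u) * (1 - u ^+ 2) <= 1 - u.
    have -> : 1 - u ^+ 2 = (1 + u) * (1 - u) by ring.
    rewrite mulrA ler_piMl ?subr_ge0 // -[X in _ <= X](expRxMexpNx_1 u) mulrC.
    by rewrite ler_wpM2r ?expR_ge0 // expR_ge1Dx.
  have u21 : u ^+ 2 <= 1 by rewrite exprn_ile1.
  apply: (@le_trans _ _ ((expR (- u) * (1 - u ^+ 2)) ^+ n)); last first.
    by rewrite lerXn2r ?nnegrE ?mulr_ge0 ?expR_ge0 ?subr_ge0.
  rewrite exprMn -expRM_natl.
  have -> : n%:R * - u = - y by rewrite /u; field.
  have := @bernoulli_onem n (u ^+ 2); rewrite u21 exprn_ge0 // => /(_ isT).
  have -> : n%:R * u ^+ 2 = y ^+ 2 / n%:R by rewrite /u; field.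
  move=> h; apply: le_trans (ler_wpM2l e0 h); rewrite mulrBr mulr1 lerD2l lerN2.
  by rewrite ler_piMl // divr_ge0 ?exprn_ge0.
have b_hi : b <= expR (- y) + 2 * y * m%:R / n%:R.
  pose z := y * m%:R / n%:R.
  have z0 : 0 <= z by rewrite divr_ge0 ?mulr_ge0.
  have z2 : 2 * z <= 1.
    have -> : 2 * z = 2 * y * m%:R / n%:R by rewrite /z; ring.
    by rewrite ler_pdivrMr // mul1r.
  have hb : b <= expR (- y) * expR z.
    apply: (@le_trans _ _ (expR (- u) ^+ (n - m))).
      rewrite lerXn2r ?nnegrE ?expR_ge0 ?subr_ge0 //.
      by have := @expR_ge1Dx R (- u).
    rewrite -expRM_natl -expRD natrB //.
    have -> : (n%:R - m%:R) * - u = - y + z by rewrite /u /z; field.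
    by [].
  have hz : expR z <= 1 + 2 * z.
    have h1 := @expR_ge1Dx R (- z); have h2 := expRxMexpNx_1 z.
    have h3 := expR_ge0 z; nra.
  apply: (le_trans hb); have -> : 2 * y * m%:R / n%:R = 2 * z by rewrite /z; ring.
  have := ler_wpM2l e0 hz; nra.
have m2 : 0 <= m%:R ^+ 2 / n%:R :> R by rewrite divr_ge0 ?exprn_ge0.
have y2 : 0 <= y ^+ 2 / n%:R by rewrite divr_ge0 ?exprn_ge0.
have ym : 0 <= 2 * y * m%:R / n%:R by rewrite divr_ge0 ?mulr_ge0.
have main : `|a * b - expR (- y)| <= (m%:R ^+ 2 + y ^+ 2 + 2 * y * m%:R) / n%:R.
  rewrite !mulrDl ler_norml; apply/andP; split; nra.
rewrite -/u eB eP -mulrBr normrM ger0_norm // -mulrA.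
by apply: ler_pM => //.
Qed.

Lemma binweight_cvg m Y (eps : R) : 0 < eps -> exists N, forall n y, (N <= n)%N ->
  0 <= y <= Y -> `|binweight n m (y / n%:R) - poi y m| <= eps.
Proof.
move=> e0; have [Y0|Y0] := leP 0 Y; last by exists 0%N => n y _; lra.
pose B : R := Y ^+ m * (m%:R ^+ 2 + Y ^+ 2 + 2 * Y * m%:R).
have B0 : 0 <= B by rewrite !mulr_ge0 ?addr_ge0 ?exprn_ge0 ?mulr_ge0.
pose c : R := B / eps + Y + 2 * Y * m%:R + m%:R + 1.
exists (Num.truncn c).+1 => n y hn /andP[y0 yY].
have cn : c <= n%:R.
  by apply/ltW/(lt_le_trans (truncnS_gt c)); rewrite ler_nat.
have p1 : 0 <= B / eps by rewrite divr_ge0 // ltW.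
have p2 : 0 <= 2 * Y * m%:R by rewrite !mulr_ge0.
have p3 : 0 <= m%:R :> R by [].
have n0 : 0 < n%:R :> R by rewrite /c in cn; lra.
have mn : (m <= n)%N by rewrite -(ler_nat R); rewrite /c in cn; lra.
have yn : 0 <= y <= n%:R by rewrite /c in cn; lra.
have ym : y * m%:R <= Y * m%:R by rewrite ler_wpM2r.
apply: le_trans (binweight_poi _ mn yn _) _; first by rewrite -(ltr0n R).
  by rewrite /c in cn; lra.
rewrite ler_pdivrMr //; apply: (@le_trans _ _ B).
  have h1 : y ^+ 2 <= Y ^+ 2 by rewrite lerXn2r ?nnegrE.
  have h2 : 0 <= 2 * y * m%:R by rewrite !mulr_ge0.
  have h3 : 0 <= m%:R ^+ 2 :> R by rewrite exprn_ge0.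
  have h4 : 0 <= y ^+ 2 by rewrite exprn_ge0.
  apply: ler_pM => //; rewrite ?exprn_ge0 //; first lra; last lra.
  by rewrite lerXn2r ?nnegrE.
by rewrite mulrC -ler_pdivrMr //; rewrite /c in cn; lra.
Qed.

(** A limit of binomial probabilities. *)
Lemma poi_itv m y : 0 <= y -> 0 <= poi y m <= 1.
Proof.
move=> y0; apply/andP; split.
  by rewrite mulr_ge0 ?expR_ge0 // divr_ge0 ?exprn_ge0.
apply/ler_addgt0Pl => eps e0.
have [N hN] := @binweight_cvg m y eps e0.
pose n := (N + (Num.truncn y).+1)%N.
have hn : y <= n%:R by apply/ltW/(lt_le_trans (truncnS_gt y)); rewrite ler_nat leq_addl.
have n0 : 0 < n%:R :> R by rewrite ltr0n /n addnS.
have := hN n y (leq_addr _ _); rewrite y0 lexx => /(_ isT).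
have /andP[_ h] : 0 <= binweight n m (y / n%:R) <= 1.
  by apply: binweight_itv; rewrite divr_ge0 //= ler_pdivrMr // mul1r.
by rewrite ler_distl => /andP[h' _]; lra.
Qed.
End Poisson.

(** * Convergence at a fixed signature *)

Lemma series_tail (R : realType) (f : nat -> R) C D : 0 <= C ->
  (forall j, `|f j| <= C * 2^-1 ^+ j) ->
  `|limn (series f) - \sum_(j < D) f j| <= 2 * C * 2^-1 ^+ D.
Proof.
move=> C0 hf.
have cvf : cvgn (series f).
  apply: normed_cvg; apply: (@series_le_cvg _ _ (geometric C 2^-1)) => //= [n|].
    by rewrite mulr_ge0 ?exprn_ge0 ?invr_ge0.
  by apply: is_cvg_geometric_series; rewrite gtr0_norm //; lra.
rewrite -(big_mkord xpredT f) distrC.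
have h n : (D <= n)%N -> `|\sum_(0 <= j < D) f j - series f n| <= 2 * C * 2^-1 ^+ D.
  move=> hn; rewrite /series /= [X in _ - X](@big_cat_nat _ _ _ D) //= opprD addrA subrr sub0r normrN.
  apply: le_trans (ler_norm_sum _ _ _) _; apply: le_trans (sum_half_le D n C0).
  by apply: ler_sum.
rewrite ler_distl lerBlDr; apply/andP; split.
  apply: limr_le => //; exists D => // n /= /h; rewrite ler_distl => /andP[]; lra.
rewrite -lerBlDr; apply: limr_ge => //; exists D => // n /= /h.
by rewrite ler_distl => /andP[]; lra.
Qed.

Lemma wide_sum_bound (R : numDomainType) (c W : nat -> R) (B : R) M :
  (forall m, 0 <= c m <= 1) -> \sum_(m < M) `|W m| <= B ->
  `|\sum_(m < M) c m * W m| <= B.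
Proof.
move=> hc; apply: le_trans; apply: le_trans (ler_norm_sum _ _ _) _.
apply: ler_sum => m _; have /andP[c0 c1] := hc m.
by rewrite normrM ger0_norm // ler_piMl.
Qed.

Section FixedSignature.
Variables (F : finFieldType) (R : realType) (k : nat).
Local Notation q := (#|F|%:R : R).
Local Notation t := (q^-1).

Lemma t_le_half : t <= 2^-1.
Proof.
have q1 := @q_gt1 F R; rewrite lef_pV2 ?posrE ?(lt_trans _ q1) ?ltr01 //.
by rewrite ler_nat -(ltr_nat R).
Qed.

Let t0 : 0 < t := t_gt0 F R.
Let t2 : t <= 2^-1 := t_le_half.
Let q0 : 0 < q := q_gt0 F R.

Variable L : {ffun 'I_k.+1 -> int}.
Hypothesis sL : signature k.+1 L.

Local Notation depth j := (L ord_max - (j : nat)%:Z).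

Lemma rate_eq n s D chi j : (0 < n)%N -> n%:R = chi * q ^+ s ->
  L ord_max + s%:Z = D%:Z -> (j <= D)%N ->
  chi * t ^ depth j / n%:R = t ^+ (D - j).
Proof.
move=> n0 hn hD jD; have n0' : n%:R != 0 :> R by rewrite pnatr_eq0 -lt0n.
have chi0 : chi != 0 by apply: contraNneq n0' => e; rewrite hn e mul0r.
rewrite hn invfM -exprVn mulrACA mulfV // mul1r exprnP -expfzDr ?gt_eqF //.
by rewrite exprnP; congr (_ ^ _); lia.
Qed.

(** The sum over the shifts d = L_k + s - j is rewritten as a sum over j, at which
    the success probability is chi t^(L_k - j) / n [rate_eq]. *)
Lemma iter_start_reindex n s D chi : (0 < n)%N -> n%:R = chi * q ^+ s ->
  L ord_max + s%:Z = D%:Z ->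
  iter n (transfer t (k := k)) (start t (k := k)) (L + constvec k.+1 s%:Z) =
  \sum_(j < D.+1) \sum_(m < n.+1)
    binweight n m (chi * t ^ depth j / n%:R) * wsum t m (L - constvec k.+1 (depth j)).
Proof.
move=> n0 hn hD.
rewrite (iter_transfer_start (t_neq0 F R) (t_expn_neq1 F R) n (D := D.+1)); last first.
  by rewrite -[k in extz _ k]/(nat_of_ord (@ord_max k)) extz_ord !ffunE hD ltz_nat.
rewrite (reindex_inj rev_ord_inj); apply: eq_bigr => j _ /=.
have jD : (j <= D)%N by rewrite -ltnS.
apply: eq_bigr => m _; rewrite (rate_eq n0 hn hD jD) subSS; congr (_ * wsum t m _).
by apply/ffunP => i; rewrite !ffunE; lia.
Qed.

Let w := `|L ord0 - L ord_max|%N.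

Lemma first_depth j : extz (L - constvec k.+1 (depth j)) 0 <= (j + w)%N%:Z.
Proof.
have hw : 0 <= L ord0 - L ord_max by rewrite subr_ge0; apply: sL.
rewrite extz_subconst // -[0%N]/(nat_of_ord (@ord0 k)) extz_ord PoszD gez0_abs //.
by rewrite opprB addrCA.
Qed.

Lemma Lterm_depth chi j M : (k * (j + w) < M)%N ->
  Lterm t chi L (depth j) =
  \sum_(m < M) poi (chi * t ^ depth j) m * wsum t m (L - constvec k.+1 (depth j)).
Proof.
move=> hM; apply: Lterm_expansion => //; first by rewrite gerBl.
have hw : 0 <= L ord0 - L ord_max by rewrite subr_ge0; apply: sL.
by rewrite opprB addrCA -[L ord0 - _]gez0_abs // -/w -PoszD ger0_norm // -PoszM ltz_nat.
Qed.

Lemma sum_trim (c : nat -> R) j M n : (k * (j + w) < M)%N -> (M <= n)%N ->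
  \sum_(m < n) c m * wsum t m (L - constvec k.+1 (depth j)) =
  \sum_(m < M) c m * wsum t m (L - constvec k.+1 (depth j)).
Proof.
move=> hM Mn; rewrite -!(big_mkord xpredT (fun m => c m * wsum t m _)).
rewrite (@big_cat_nat _ _ _ M) //= [X in _ + X]big_nat_cond.
rewrite [X in _ + X]big1 ?addr0 // => m; rewrite andbT => /andP[hm _]; rewrite (wsum_eq0 t0 t2 (first_depth j)) ?mulr0 //.
exact: leq_trans hm.
Qed.

(** Dominated convergence: the terms j >= J of both sums are bounded by
    [wsum_total_bound], and the finitely many others converge uniformly in chi. *)
Theorem iter_start_close eps : 0 < eps -> exists N, forall n s chi, (N <= n)%N ->
  n%:R = chi * q ^+ s -> 1 <= chi <= q ->
  `|iter n (transfer t (k := k)) (start t (k := k)) (L + constvec k.+1 s%:Z) -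
    limn (series (fun j => Lterm t chi L (depth j)))| <= eps.
Proof.
move=> eps0; have [C C0 hC] := wsum_total_bound t0 t2 sL.
have C1 : 0 < C + 1 by rewrite ltr_wpDl.
have [J hJ] : exists J, 2^-1 ^+ J <= eps / (8 * (C + 1)).
  have e8 : 0 < eps / (8 * (C + 1)) by rewrite divr_gt0 // mulr_gt0.
  have /cvgrPdist_le /(_ _ e8) [J _ /(_ J (leqnn J))] := @half_cvg0 R.
  by rewrite /= sub0r normrN => h; exists J; apply: le_trans h; rewrite ler_norm.
pose e' := eps / (4 * (C + 1)); have e'0 : 0 < e' by rewrite divr_gt0 // mulr_gt0.
pose M := (k * (J + w)).+1; pose K := (J + `|L ord_max|)%N.
pose Y := q * q ^+ K.
have /choice [Nf hNf] m := @binweight_cvg R m Y e' e'0.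
(* n >= q^(K+1) forces s >= K, so that the first J depths are present *)
exists (maxn (\max_(m < M) Nf m) (maxn M (#|F| ^ K.+1))) => n s chi.
rewrite !geq_max => /and3P[hN1 hN2 hN3] hn /andP[chi1 chiq].
have chi0 : 0 <= chi by apply: le_trans chi1.
have n0 : (0 < n)%N by exact: leq_trans hN2.
have N0 : 0 < n%:R :> R by rewrite ltr0n.
have sK : (K <= s)%N.
  have : q ^+ K.+1 <= q ^+ s.+1.
    rewrite exprS -natrX; apply: (@le_trans _ _ n%:R); first by rewrite -natrM -expnS ler_nat.
    by rewrite hn exprS ler_wpM2r ?exprn_ge0 // ltW.
  by rewrite ler_eXn2l ?q_gt1.
have [D hD] : exists D : nat, L ord_max + s%:Z = D%:Z.
  exists (absz (L ord_max + s%:Z)%R); rewrite gez0_abs //.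
  by move: sK; rewrite /K; clear; lia.
have JD : (J <= D.+1)%N by move: sK hD; rewrite /K; clear; lia.
rewrite (iter_start_reindex n0 hn hD).
pose I j := \sum_(m < n.+1)
    binweight n m (chi * t ^ depth j / n%:R) * wsum t m (L - constvec k.+1 (depth j)).
pose T j := Lterm t chi L (depth j).
have y0 j : 0 <= chi * t ^ depth j by rewrite mulr_ge0 // exprz_ge0 // ltW.
have hI j : (j <= D)%N -> `|I j| <= C * 2^-1 ^+ j.
  move=> jD; refine (@wide_sum_bound R (fun m => binweight n m (chi * t ^ depth j / n%:R))
    (fun m => wsum t m (L - constvec k.+1 (depth j))) _ n.+1 _ (hC j n.+1)) => m.
  apply: binweight_itv.
  rewrite (rate_eq n0 hn hD jD) exprn_ge0 ?(ltW t0) // exprn_ile1 ?(ltW t0) //.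
  exact/ltW/t_lt1.
have hT j : `|T j| <= C * 2^-1 ^+ j.
  rewrite /T (@Lterm_depth _ j _ (leqnn _)).
  refine (@wide_sum_bound R (poi (chi * t ^ depth j))
    (fun m => wsum t m (L - constvec k.+1 (depth j))) _ _ _ (hC j _)) => m.
  exact: poi_itv.
have hIT j : (j < J)%N -> `|I j - T j| <= e' * (C * 2^-1 ^+ j).
  move=> jJ; have jM : (k * (j + w) < M)%N by rewrite ltnS leq_mul2l leq_add2r (ltnW jJ) orbT.
  rewrite /I (sum_trim (fun m => binweight n m (chi * t ^ depth j / n%:R)) jM (leqW hN2)) /T (Lterm_depth _ jM) -sumrB.
  apply: le_trans (ler_norm_sum _ _ _) _.
  apply: le_trans (ler_wpM2l (ltW e'0) (hC j M)); rewrite mulr_sumr.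
  apply: ler_sum => m _; rewrite -mulrBl normrM ler_wpM2r //.
  apply: hNf; first by apply: leq_trans hN1; apply: (leq_bigmax m).
  rewrite y0 /=; apply: ler_pM => //; first by rewrite exprz_ge0 // ltW.
  have -> : q ^+ K = t ^ (- K%:Z) by rewrite -invr_expz -exprnP exprVn invrK.
  by apply: ler_texp; rewrite /K; move: jJ; clear; lia.
have -> : \sum_(j < D.+1) I j - limn (series T) = \sum_(j < J) (I j - T j) +
    \sum_(J <= j < D.+1) I j + (\sum_(j < J) T j - limn (series T)).
  rewrite sumrB -!(big_mkord xpredT I) (@big_cat_nat _ _ _ J) //=; ring.
have b1 : `|\sum_(j < J) (I j - T j)| <= e' * (2 * C).
  apply: le_trans (ler_norm_sum _ _ _) _.
  have := sum_half_le 0 J C0; rewrite expr0 mulr1 => h.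
  apply: le_trans (ler_wpM2l (ltW e'0) h); rewrite big_mkord mulr_sumr.
  by apply: ler_sum => j _; apply: hIT.
have b2 : `|\sum_(J <= j < D.+1) I j| <= 2 * C * 2^-1 ^+ J.
  apply: le_trans (ler_norm_sum _ _ _) _; apply: le_trans (sum_half_le J D.+1 C0).
  by apply: ler_sum_nat => j /andP[_ jD]; apply: hI.
have b3 : `|\sum_(j < J) T j - limn (series T)| <= 2 * C * 2^-1 ^+ J.
  by rewrite distrC; exact: series_tail.
have b4 : e' * (2 * C) <= eps / 2.
  by rewrite /e' mulrAC ler_pdivrMr ?mulr_gt0 //; nra.
have b5 : 2 * C * 2^-1 ^+ J <= eps / 4.
  apply: (@le_trans _ _ (2 * C * (eps / (8 * (C + 1))))); first by rewrite ler_wpM2l ?mulr_ge0.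
  by rewrite mulrA ler_pdivrMr ?mulr_gt0 //; nra.
apply: le_trans (ler_normD _ _) _; apply: le_trans (lerD (ler_normD _ _) (lexx _)) _.
lra.
Qed.
End FixedSignature.

(** * Convergence and tails of the law *)

Section LawLimit.
Variables (F : finFieldType) (R : realType) (k : nat).
Local Notation q := (#|F|%:R : R).
Local Notation t := (q^-1).
Implicit Type L : {ffun 'I_k.+1 -> int}.

Let t0 : 0 < t := t_gt0 F R.
Let t2 : t <= 2^-1 := t_le_half F R.
Let q0 : 0 < q := q_gt0 F R.

Lemma expect_point_mass_le1 n (eta : {ffun 'I_k.+1 -> int}) : expect F n (point_mass R eta) <= 1.
Proof.
rewrite -[X in _ <= X](@expect_constant F R k n 1); apply: ler_expect => x _.
by rewrite /point_mass; case: eqP.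
Qed.

(** [mixture_close] with N tending to infinity. *)
Lemma iter_start_expect : exists2 B, 0 <= B & forall n (eta : {ffun 'I_k.+1 -> int}),
  `|iter n (transfer t (k := k)) (start t (k := k)) eta -
    qpoch_oo t * expect F n (point_mass R eta)| <= B / n.+2%:R.
Proof.
have [B0 B0p hB] := startcoef_moment t0 t2; have d0 := decay_gt0 F R k.
exists (B0 * decay F R k) => [|n eta]; first by rewrite mulr_ge0 // ltW.
apply/ler_addgt0Pl => e e0.
have /cvgrPdist_le /(_ _ e0) [N1 _ hN1] := euler_sum t0 t2.
pose N := (N1 + `|extz eta 0|.+1)%N.
have hN : extz eta 0 < N%:Z by rewrite /N; lia.
have := @mixture_close F R k n N eta hN; have := hN1 N (leq_addr _ _) => /=.
set S := \sum_(e < N) _; set p := expect _ _ _ => h1 h2.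
have p0 : 0 <= p := @expect_point_mass_ge0 F R k n eta.
have p1 : p <= 1 := expect_point_mass_le1 n eta.
rewrite [iter _ _ _ _ - _](_ : _ = (iter n (transfer t (k := k)) (start t (k := k)) eta - S * p)
   + (S - qpoch_oo t) * p); last by ring.
apply: le_trans (ler_normD _ _) _; rewrite addrC; apply: lerD.
  rewrite normrM distrC (ger0_norm p0) -[X in _ <= X]mulr1.
  by apply: ler_pM.
apply: le_trans h2 _; rewrite -[X in _ <= X]mulrA ler_wpM2r //.
  by rewrite divr_ge0 // ltW.
by have := hB N; rewrite invrK.
Qed.

Theorem law_close L eps : signature k.+1 L -> 0 < eps ->
  exists N, forall n s chi, (N <= n)%N -> n%:R = chi * q ^+ s -> 1 <= chi <= q ->
  `|expect F n (point_mass R (L + constvec k.+1 s%:Z)) - Llaw t chi L| <= eps.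
Proof.
move=> sL e0; have e8 : 0 < eps / 8 by rewrite divr_gt0.
have [N1 hN1] := iter_start_close F sL e8.
have [B B0 hB] := iter_start_expect.
exists (maxn N1 (Num.truncn (B / (eps / 8))).+1) => n s chi.
rewrite geq_max => /andP[n1 n2] hn hchi.
have h1 := hN1 n s chi n1 hn hchi; have h2 := hB n (L + constvec k.+1 s%:Z).
have h3 : B / n.+2%:R <= eps / 8.
  rewrite ler_pdivrMr ?ltr0n // mulrC -ler_pdivrMr //.
  by apply/ltW/(lt_le_trans (truncnS_gt _)); rewrite ler_nat (leq_trans n2) // ltnW // ltnW.
move: h1 h2; set I := iter _ _ _ _; set S := limn _; set p := expect _ _ _ => h1 h2.
have Q0 := qpoch_oo_gt0 t0 t2; have Q4 := qpoch_oo_ge4 t0 t2.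
rewrite /Llaw -/(qpoch_oo t) -/S.
have -> : p - (qpoch_oo t)^-1 * S = (qpoch_oo t)^-1 * (qpoch_oo t * p - S).
  by rewrite mulrBr mulKf // gt_eqF.
rewrite normrM gtr0_norm ?invr_gt0 // mulrC ler_pdivrMr //.
have : `|qpoch_oo t * p - S| <= eps / 8 + eps / 8.
  have -> : qpoch_oo t * p - S = (qpoch_oo t * p - I) + (I - S) by ring.
  apply: le_trans (ler_normD _ _) _; apply: lerD => //.
  by rewrite distrC; exact: le_trans h2 h3.
nra.
Qed.

(** Markov's inequality for q^(eta_0). *)
Lemma law_upper n s chi L : (0 < n)%N -> n%:R = chi * q ^+ s -> 1 <= chi <= q ->
  expect F n (point_mass R (L + constvec k.+1 s%:Z)) <= q ^+ 2 * t ^ (L ord0).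
Proof.
move=> n0 hn /andP[c1 cq]; have qs : 0 < q ^+ s by rewrite exprn_gt0.
have := @point_mass_markov F R k n (L + constvec k.+1 s%:Z) (fun x => t ^ (- extz x 0)).
rewrite expect_first -[0%N]/(nat_of_ord (@ord0 k)) extz_ord !ffunE.
set p := expect _ _ _ => h.
have {}h : p * t ^ (- (L ord0 + s%:Z)) <= 1 + n%:R * (q - 1).
  by apply: h => x; rewrite exprz_ge0 // ltW.
move: h; rewrite -invr_expz ler_pdivrMr ?exprz_gt0 // => h; apply: (le_trans h).
rewrite expfzDr ?gt_eqF // -exprnP exprVn mulrCA [X in _ <= X]mulrC ler_wpM2l ?exprz_ge0 ?(ltW t0) //.
rewrite ler_pdivrMr //; have q1 := ltW (@q_gt1 F R).
have n1 : 1 <= n%:R :> R by rewrite ler1n.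
apply: (@le_trans _ _ (n%:R * q)); first nra.
rewrite hn expr2 mulrAC; apply: ler_wpM2r; first exact: ltW.
by apply: ler_wpM2r cq; exact: ltW.
Qed.

(** Markov's inequality for t^(eta_k). *)
Lemma law_lower n s chi L : (0 < n)%N -> n%:R = chi * q ^+ s -> 1 <= chi <= q ->
  expect F n (point_mass R (L + constvec k.+1 s%:Z)) <= decay F R k * t ^ (- L ord_max).
Proof.
move=> n0 hn /andP[c1 cq]; have qs : 0 < q ^+ s by rewrite exprn_gt0.
have := @point_mass_markov F R k n (L + constvec k.+1 s%:Z) (fun x => t ^ extz x k).
rewrite -[k in extz (L + _) k]/(nat_of_ord (@ord_max k)) extz_ord !ffunE.
set p := expect _ _ _ => h.
have {}h : p * t ^ (L ord_max + s%:Z) <= decay F R k / n.+2%:R.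
  by apply: le_trans (expect_last F R k n); apply: h => x; rewrite exprz_ge0 // ltW.
have T0 : 0 < t ^ (L ord_max) by rewrite exprz_gt0.
move: h; rewrite expfzDr ?gt_eqF // -exprnP exprVn mulrA ler_pdivrMr // => h.
rewrite -invr_expz ler_pdivlMr //; apply: (le_trans h).
rewrite -mulrA ger_pMr ?decay_gt0 // mulrC ler_pdivrMr ?ltr0n // mul1r.
apply: (@le_trans _ _ n%:R); last by rewrite ler_nat; lia.
by rewrite hn ler_peMl // ltW.
Qed.

(** The sizes n q^j, at the levels s + j, share the same chi; along them the
    probabilities converge to the limit law. *)
Lemma Llaw_le n s chi L b : signature k.+1 L -> (0 < n)%N -> n%:R = chi * q ^+ s ->
  1 <= chi <= q ->
  (forall n' s', (0 < n')%N -> n'%:R = chi * q ^+ s' ->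
     expect F n' (point_mass R (L + constvec k.+1 s'%:Z)) <= b) ->
  0 <= Llaw t chi L <= b.
Proof.
move=> sL n0 hn hc hb.
have near e : 0 < e -> exists2 p, 0 <= p <= b & `|p - Llaw t chi L| <= e.
  move=> e0; have [N hN] := law_close sL e0.
  have hj : n%:R * (#|F| ^ N)%N%:R = chi * q ^+ (s + N) by rewrite hn natrX exprD mulrA.
  have F1 : (1 < #|F|)%N by rewrite -(ltr_nat R) q_gt1.
  rewrite -natrM in hj; exists (expect F (n * #|F| ^ N) (point_mass R (L + constvec k.+1 (s + N)%N%:Z))).
    by rewrite expect_point_mass_ge0 hb // muln_gt0 n0 expn_gt0 ltnW.
  apply: hN => //; apply: (@leq_trans (#|F| ^ N)); last by rewrite leq_pmull.
  by rewrite ltnW // ltn_expl.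
apply/andP; split; apply/ler_addgt0Pl => e /near [p /andP[p0 pb]];
  rewrite ler_norml => /andP[]; lra.
Qed.
End LawLimit.

(** * The limit theorem *)

Lemma log_scale (R : realType) (q n : nat) : (1 < q)%N -> (0 < n)%N ->
  let x := log_base R q n in
  exists2 s : nat, Num.floor x = s%:Z &
    n%:R = q%:R `^ frac_part x * q%:R ^+ s /\ 1 <= q%:R `^ frac_part x <= q%:R.
Proof.
move=> q1 n0 x; have q1R : 1 < q%:R :> R by rewrite ltr1n.
have q0R : 0 < q%:R :> R by apply: lt_trans q1R.
have lnq : 0 < ln (q%:R : R) by apply: ln_gt0.
have x0 : 0 <= x by apply: divr_ge0; [rewrite ln_ge0 ?ler1n | exact: ltW].
have /andP[f1 f2] := floor_itv x.
have fl0 : 0 <= Num.floor x by rewrite floor_ge0.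
exists `|Num.floor x|%N; first by rewrite gez0_abs.
split.
  have -> : q%:R ^+ `|Num.floor x|%N = q%:R `^ (Num.floor x)%:~R :> R.
    by rewrite powR_intmul ?(ltW q0R) // -[in RHS](gez0_abs fl0).
  rewrite -powRD; last by rewrite (gt_eqF q0R) implybT.
  by rewrite /frac_part subrK /powR (gt_eqF q0R) /x /log_base divfK ?gt_eqF // lnK // posrE ltr0n.
have g0 : 0 <= frac_part x by rewrite subr_ge0.
have g1 : frac_part x <= 1 by move: f2; rewrite /frac_part intrD; lra.
apply/andP; split.
  by rewrite -[X in X <= _](@powRr0 _ q%:R) ler_powR // ltW.
by rewrite -[X in _ <= X](powRr1 (ltW q0R)) ler_powR // ltW.
Qed.

Lemma unif_law_expect (F : finFieldType) (R : realType) k n c (L : {ffun 'I_k.+1 -> int}) :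
  unif_law R (strict_upper F n) (@rank_drops F n k.+1 c) L =
  expect F n (point_mass R (L + constvec k.+1 c)).
Proof.
rewrite /unif_law /expect; congr (_ / _); rewrite -sum1_card natr_sum.
rewrite [LHS](eq_bigl (fun A => (A \in strict_upper F n) && (rank_drops k.+1 c A == L))).
  rewrite big_mkcondr; apply: eq_bigr => A _; rewrite /point_mass.
  have -> : (drops k A == L + constvec k.+1 c) = (rank_drops k.+1 c A == L).
    rewrite -subr_eq; congr (_ == _); apply/ffunP => i; rewrite !ffunE; ring.
  by case: (_ == _).
by move=> A; rewrite inE.
Qed.

(** A point of S makes the supremum nonnegative. *)
Lemma Dinfty_cvg0 (R : realType) (T : Type) (S : set T) (M1 M2 : nat -> T -> R) :
  S !=set0 ->
  (forall eps : R, 0 < eps -> exists N, forall n x, (N <= n)%N -> S x ->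
     `|M1 n x - M2 n x| <= eps) ->
  Dinfty S (M1 n) (M2 n) @[n --> \oo] --> (0 : \bar R)%E.
Proof.
move=> [x0 Sx0] h.
have D0 n : (0 <= Dinfty S (M1 n) (M2 n))%E.
  apply: (@le_trans _ _ (`|M1 n x0 - M2 n x0|%:E)); first by rewrite lee_fin.
  by apply: ereal_sup_ubound; exists x0.
have De eps : 0 < eps -> exists N, forall n, (N <= n)%N -> (Dinfty S (M1 n) (M2 n) <= eps%:E)%E.
  move=> /h [N hN]; exists N => n /hN hn; apply: ge_ereal_sup => _ [x Sx <-].
  by rewrite lee_fin; exact: hn.
have fin n eps : (Dinfty S (M1 n) (M2 n) <= eps%:E)%E -> Dinfty S (M1 n) (M2 n) \is a fin_num.
  by move=> le; rewrite ge0_fin_numE //; apply: le_lt_trans le (ltry _).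
apply/fine_cvgP; split.
  by have [N hN] := De 1 ltr01; exists N => // n /= /hN; exact: fin.
apply/cvgrPdist_le => eps e0; have [N hN] := De eps e0; exists N => // n /= /hN le.
rewrite sub0r normrN ger0_norm ?fine_ge0 //.
by rewrite -lee_fin fineK // (fin n eps).
Qed.

Theorem theorem1p2 (R : realType) (q : nat) (F : finFieldType)
    (hq : #|F| = q) (k : nat) :
  Dinfty (signature k.+1)
    (unif_law R (strict_upper F n)
       (@rank_drops F n k.+1 (Num.floor (log_base R q n))))
    (Llaw (q%:R^-1 : R) (q%:R `^ frac_part (log_base R q n)))
    @[n --> \oo] --> (0 : \bar R)%E.
Proof.
subst q; have q1 : (1 < #|F|)%N by rewrite -(ltr_nat R) q_gt1.
apply: Dinfty_cvg0 => [|eps e0]; first by exists 0 => i j _; rewrite !ffunE.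
set Q : R := #|F|%:R.
have t0 : 0 < Q^-1 := t_gt0 F R.
(* Off the box [-M, M]^(k+1), both laws are at most eps. *)
have [M [hM1 hM2]] : exists M : nat, Q ^+ 2 * Q^-1 ^+ M <= eps /\ decay F R k * Q^-1 ^+ M <= eps.
  have c (a : R) : (fun n => a * Q^-1 ^+ n) @ \oo --> (0 : R).
    rewrite -(mulr0 a); apply: cvgMr; exact: expt_cvg0 t0 (t_le_half F R).
  have /cvgrPdist_le /(_ _ e0) [M1 _ h1] := c (Q ^+ 2).
  have /cvgrPdist_le /(_ _ e0) [M2 _ h2] := c (decay F R k).
  exists (maxn M1 M2); have := h1 _ (leq_maxl M1 M2); have := h2 _ (leq_maxr M1 M2).
  by rewrite /= !sub0r !normrN => l1 l2; split; [apply: le_trans l2 | apply: le_trans l1]; rewrite ler_norm.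
have /choice [Nf hNf] (f : {ffun 'I_k.+1 -> 'I_(M + M).+1}) : exists N,
    signature k.+1 (of_box f) -> forall n s chi, (N <= n)%N ->
    n%:R = chi * Q ^+ s -> 1 <= chi <= Q ->
    `|expect F n (point_mass R (of_box f + constvec k.+1 s%:Z)) - Llaw Q^-1 chi (of_box f)| <= eps.
  have [sf|nsf] := pselect (signature k.+1 (of_box f)); last by exists 0%N.
  by have [N hN] := law_close F sf e0; exists N.
exists (maxn 1 (\max_f Nf f)) => n L; rewrite geq_max => /andP[n0 hn] sL.
rewrite unif_law_expect.
have [s -> [hs hc]] := @log_scale R _ n q1 n0.
move: hs hc; set chi := _ `^ _; rewrite -/Q => hs hc.
have T0 x : 0 <= x <= eps -> forall y, 0 <= y <= eps -> `|x - y| <= eps.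
  by move=> /andP[x0 x1] y /andP[y0 y1]; rewrite ler_norml; apply/andP; split; lra.
have hL i : L ord_max <= L i <= L ord0 by rewrite !sL // -ltnS.
have [hi|hi] := leP M%:Z (L ord0).
  have b : Q ^+ 2 * Q^-1 ^ (L ord0) <= eps.
    apply: le_trans hM1; rewrite ler_wpM2l ?exprn_ge0 //.
    by rewrite exprnP; exact: ler_texp.
  apply: T0.
    by rewrite expect_point_mass_ge0 (le_trans (law_upper _ n0 hs hc)).
  apply: (@Llaw_le F R k n s) => // n' s' n'0 hn'.
  exact: le_trans (law_upper _ n'0 hn' hc) b.
have [lo|lo] := leP (L ord_max) (- M%:Z).
  have b : decay F R k * Q^-1 ^ (- L ord_max) <= eps.
    apply: le_trans hM2; rewrite ler_wpM2l ?(ltW (decay_gt0 _ _ _)) //.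
    by rewrite exprnP; apply: ler_texp; lia.
  apply: T0.
    by rewrite expect_point_mass_ge0 (le_trans (law_lower _ n0 hs hc)).
  apply: (@Llaw_le F R k n s) => // n' s' n'0 hn'.
  exact: le_trans (law_lower _ n'0 hn' hc) b.
have [i|f Lf] := @in_boxP k.+1 M L.
  by have := hL i; lia.
rewrite Lf in sL *; apply: hNf => //.
by apply: leq_trans hn; exact: leq_bigmax.
Qed.
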